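(* Let $\lambda\in\{1,-1\}$, let $m\ge1$ and $n\ge1$ be integers, and let $g_0,g_1,g_2:[0,\infty)\to\mathbb{R}$ satisfy $$g_j\in C^{[\frac{m+5-j}{3}]}([0,\infty)),\quad j=0,1,2,$$ $$(1+t)^ng_j^{(i)}(t)\in L^1([0,\infty)),\quad j=0,1,2,\ \ i=0,1,\dots,\Big[\frac{m+5-j}{3}\Big].$$ Then the spectral functions $A(k)$ and $B(k)$ associated with $g_0,g_1,g_2$ (defined in the context) have the following properties: (a) $A(k)$ and $B(k)$ are continuous for $k\in\bar D_+$ and analytic for $k\in D_+$. (b) There exist complex constants $\{A_j,B_j\}_{j=1}^m$ such that $$A(k)=1+\frac{A_1}{k}+\cdots+\frac{A_m}{k^m}+O\Big(\frac1{k^{m+1}}\Big),\qquad B(k)=\frac{B_1}{k}+\cdots+\frac{B_m}{k^m}+O\Big(\frac1{k^{m+1}}\Big),$$ uniformly as $k\to\infty$ with $k\in\bar D_+$. (c) For $j=1,\dots,n$, the derivatives $A^{(j)}(k)$ and $B^{(j)}(k)$ have continuous extensions to $k\in\bar D_+$ and, with the same constants, $$A^{(j)}(k)=\frac{d^j}{dk^j}\Big(1+\frac{A_1}{k}+\cdots+\frac{A_m}{k^m}\Big)+O\Big(\frac1{k^{m+1-2j}}\Big),\qquad B^{(j)}(k)=\frac{d^j}{dk^j}\Big(\frac{B_1}{k}+\cdots+\frac{B_m}{k^m}\Big)+O\Big(\frac1{k^{m+1-2j}}\Big),$$ uniformly as $k\to\infty$ with $k\in\bar D_+$. (d) $A(k)=\overline{A(-\bar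 k)}$ and $B(k)=\overline{B(-\bar k)}$ for $k\in\bar D_+$. (e) $A(k)\overline{A(\bar k)}-\lambda B(k)\overline{B(\bar k)}=1$ for $k\in\Gamma$.
   Context: $[x]$ denotes the integer part of a real number $x$ (in exponents and index ranges), while $[\sigma_3,T]$ is the matrix commutator. $\sigma_3=\begin{pmatrix}1&0\\0&-1\end{pmatrix}$ and $\hat\sigma_3$ acts on a $2\times2$ matrix $A$ by $\hat\sigma_3A=[\sigma_3,A]$, so $e^{c\hat\sigma_3}A=e^{c\sigma_3}Ae^{-c\sigma_3}$. The domains are $D_1=\{\operatorname{Im}k<0\}\cap\{\operatorname{Im}k^3>0\}$, $D_2=\{\operatorname{Im}k<0\}\cap\{\operatorname{Im}k^3<0\}$, $D_3=\{\operatorname{Im}k>0\}\cap\{\operatorname{Im}k^3>0\}$, $D_4=\{\operatorname{Im}k>0\}\cap\{\operatorname{Im}k^3<0\}$, $D_+=D_1\cup D_3$, $D_-=D_2\cup D_4$; bars over domains denote closures. $\Gamma=\mathbb{R}\cup e^{i\pi/3}\mathbb{R}\cup e^{2i\pi/3}\mathbb{R}$ is the contour separating the $D_j$'s. ''$k\in(S_1,S_2)$'' means that the first column of a $2\times2$ matrix is considered for $k\in S_1$ and the second column for $k\in S_2$. Let $$\mathsf{V}(t,k)=\begin{pmatrix}-2i\lambda kg_0^2&-4k^2g_0+2ikg_1-2\lambda g_0^3+g_2\\-4\lambda k^2g_0-2i\lambda kg_1-2g_0^3+\lambda g_2&2i\lambda kg_0^2\end{pmatrix},\qquad g_j=g_j(t),$$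 and let $T(t,k)$, $t\ge0$, $k\in(\bar D_-,\bar D_+)$, be the $2\times2$-matrix valued solution of the Volterra integral equation $$T(t,k)=I+\int_\infty^te^{4ik^3(t'-t)\hat\sigma_3}(\mathsf{V}T)(t',k)\,dt',$$ which solves $T_t+4ik^3[\sigma_3,T]=\mathsf{V}T$. Let $S(k)=T(0,k)$. By the symmetries of $T$ under $k\mapsto\bar k$, the spectral functions $A(k)$ and $B(k)$ may be defined for $k\in\bar D_+$ by $$S(k)=\begin{pmatrix}\overline{A(\bar k)}&B(k)\\ \lambda\overline{B(\bar k)}&A(k)\end{pmatrix},\qquad k\in(\bar D_-,\bar D_+),$$ i.e. $(B(k),A(k))^T$ is the second column of $T(0,k)$. *)

(* Defs.v *)
From HB Require Import structures.
From mathcomp Require Import all_boot all_order all_algebra.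
From mathcomp Require Import complex.
From mathcomp Require Import all_classical all_reals all_analysis.

Set Implicit Arguments.
Unset Strict Implicit.
Unset Printing Implicit Defensive.

Import Order.TTheory GRing.Theory Num.Theory.
Import numFieldNormedType.Exports.

Local Open Scope classical_set_scope.
Local Open Scope ring_scope.
Local Open Scope complex_scope.

(* [complex] comes without a topology; give it the one of its norm, so that
   [derivable], [derive1n], [closure] etc. on R[i] are the complex notions. *)
HB.instance Definition _ (R : rcfType) := PseudoPointedMetric.copy R[i] R[i]^o.
HB.instance Definition _ (R : rcfType) := GRing.ComAlgebra.copy R[i] R[i]^o.
HB.instance Definition _ (R : rcfType) := Vector.copy R[i] R[i]^o.
HB.instance Definition _ (R : rcfType) := NormedModule.copy R[i] R[i]^o.

Section HalfLine.
Variable R : realType.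

Definition half_line : set R := `[0, +oo[.

Definition diff_quot_on (D : set R) (f : R -> R) (t : R) : set_system R :=
  (fun s => (s - t)^-1 * (f s - f t)) @ within D t^'.

(* Derivative relative to D: two-sided in the interior of D, one-sided at an
   endpoint, so on [half_line] the values of f at t < 0 play no role. *)
Definition derive_on (D : set R) (f : R -> R) (t : R) : R :=
  lim (diff_quot_on D f t).

Definition deriven_on (D : set R) (i : nat) (f : R -> R) : R -> R :=
  iter i (derive_on D) f.

Definition cont_diff_on (D : set R) (N : nat) (f : R -> R) : Prop :=
  (forall i, (i < N)%N ->
     forall t, D t -> cvg (diff_quot_on D (deriven_on D i f) t)) /\
  (forall i, (i <= N)%N -> {within D, continuous (deriven_on D i f)}).

Definition integrableC (D : set R) (f : R -> R[i]) : Prop :=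
  lebesgue_measure.-integrable D (EFin \o (fun s => complex.Re (f s))) /\
  lebesgue_measure.-integrable D (EFin \o (fun s => complex.Im (f s))).

Definition integralC (D : set R) (f : R -> R[i]) : R[i] :=
  (\int[lebesgue_measure]_(s in D) complex.Re (f s)) +i*
  (\int[lebesgue_measure]_(s in D) complex.Im (f s)).

End HalfLine.

Section Domains.
Variable R : realType.

Definition cexp (z : R[i]) : R[i] :=
  (expR (complex.Re z))%:C *
  (cos (complex.Im z) +i* sin (complex.Im z)).

Definition D1 : set R[i] := [set k | complex.Im k < 0 /\ 0 < complex.Im (k ^+ 3)].
Definition D2 : set R[i] := [set k | complex.Im k < 0 /\ complex.Im (k ^+ 3) < 0].
Definition D3 : set R[i] := [set k | 0 < complex.Im k /\ 0 < complex.Im (k ^+ 3)].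
Definition D4 : set R[i] := [set k | 0 < complex.Im k /\ complex.Im (k ^+ 3) < 0].
Definition Dplus : set R[i] := D1 `|` D3.
Definition Dminus : set R[i] := D2 `|` D4.

Definition contour : set R[i] :=
  range (fun x : R => x%:C) `|`
  range (fun x : R => cexp ('i%C * (pi / 3)%:C) * x%:C) `|`
  range (fun x : R => cexp ('i%C * (2 * pi / 3)%:C) * x%:C).

End Domains.
Arguments Dplus {R}.
Arguments Dminus {R}.
Arguments contour {R}.

Section Volterra.
Variable R : realType.

Definition mx2 (a b c d : R[i]) : 'M[R[i]]_2 :=
  \matrix_(i, j) if i == 0 then (if j == 0 then a else b)
                 else (if j == 0 then c else d).

Definition exp_sigma3 (c : R[i]) : 'M[R[i]]_2 := mx2 (cexp c) 0 0 (cexp (- c)).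

Definition exp_hat_sigma3 (c : R[i]) (M : 'M[R[i]]_2) : 'M[R[i]]_2 :=
  exp_sigma3 c *m M *m exp_sigma3 (- c).

Definition Vmx (lambda : R) (g : 'I_3 -> R -> R) (t : R) (k : R[i]) :
    'M[R[i]]_2 :=
  let l := lambda%:C in
  let g0 := (g 0 t)%:C in let g1 := (g 1 t)%:C in let g2 := (g 2 t)%:C in
  mx2 (- 2 * 'i%C * l * k * g0 ^+ 2)
      (- 4 * k ^+ 2 * g0 + 2 * 'i%C * k * g1 - 2 * l * g0 ^+ 3 + g2)
      (- 4 * l * k ^+ 2 * g0 - 2 * 'i%C * l * k * g1 - 2 * g0 ^+ 3 + l * g2)
      (2 * 'i%C * l * k * g0 ^+ 2).

(* "k in (closure of Dminus, closure of Dplus)", column by column. *)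
Definition column_domain (j : 'I_2) : set R[i] :=
  if j == 0 then closure Dminus else closure Dplus.

(* T(t,k) = I + int_oo^t exp(4ik^3(t'-t) hat sigma_3)(V T)(t',k) dt', t >= 0.
   The j-th column of the integrand only involves the j-th column of T. *)
Definition volterra_solution (lambda : R) (g : 'I_3 -> R -> R)
    (T : R -> R[i] -> 'M[R[i]]_2) : Prop :=
  forall (t : R) (k : R[i]) (i j : 'I_2), 0 <= t -> column_domain j k ->
    let integrand := fun s : R =>
      exp_hat_sigma3 (4 * 'i%C * k ^+ 3 * (s - t)%:C)
        (Vmx lambda g s k *m T s k) i j in
    integrableC `[t, +oo[ integrand /\
    T t k i j = (1%:M : 'M[R[i]]_2) i j - integralC `[t, +oo[ integrand.

(* (B, A)^T is the second column of S(k) = T(0,k). *)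
Definition spectralA (T : R -> R[i] -> 'M[R[i]]_2) (k : R[i]) : R[i] :=
  T 0 k 1 1.
Definition spectralB (T : R -> R[i] -> 'M[R[i]]_2) (k : R[i]) : R[i] :=
  T 0 k 0 1.

End Volterra.

Section Asymptotics.
Variable R : realType.

Definition holomorphic_on (D : set R[i]) (f : R[i] -> R[i]) : Prop :=
  forall k, D k -> derivable f k 1.

(* f(k) = O(1/k^p) uniformly as k -> oo in D; p may be negative. *)
Definition bigO_infty (D : set R[i]) (f : R[i] -> R[i]) (p : int) : Prop :=
  exists C K : R, 0 < K /\
    forall k, D k -> K%:C <= `|k| -> `|f k| <= C%:C * `|k| ^ (- p).

Definition expansion (c0 : R[i]) (c : nat -> R[i]) (m : nat) (k : R[i]) : R[i] :=
  c0 + \sum_(1 <= l < m.+1) c l / k ^+ l.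

(* On the open set D the j-th derivative of f is a genuine complex derivative;
   it extends continuously to the closure of D, and the extension differs from
   the j-th derivative of h by O(1/k^p). *)
Definition derivative_expansion (D : set R[i]) (f h : R[i] -> R[i]) (j : nat)
    (p : int) : Prop :=
  (forall i, (i < j)%N -> holomorphic_on D (derive1n i f)) /\
  exists fj : R[i] -> R[i],
    [/\ {within closure D, continuous fj},
        (forall k, D k -> fj k = derive1n j f k) &
        bigO_infty (closure D) (fun k => fj k - derive1n j h k) p].

End Asymptotics.

(* Main.v *)
Require Import Defs.
From HB Require Import structures.
From mathcomp Require Import all_boot all_order all_algebra.
From mathcomp Require Import complex.
From mathcomp Require Import all_classical all_reals all_analysis.
From mathcomp Require Import measurable_realfun.
From mathcomp Require Import ring lra zify.

Set Implicit Arguments.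
Unset Strict Implicit.
Unset Printing Implicit Defensive.

Import Order.TTheory GRing.Theory Num.Theory.
Import numFieldNormedType.Exports.

Local Open Scope classical_set_scope.
Local Open Scope ring_scope.
Local Open Scope complex_scope.

(** Put [kappa = - i k] and [z = 1 / kappa = i / k], and let [(u, v)] be the
    second column of [T]. It satisfies
[[
      u' = - theta u + kappa^2 (v12 v - v22 u),
      v' = kappa^2 (v21 u + v22 v),          theta = 8 i k^3 = 8 kappa^3,
]]
    where [v12], [v21], [v22] are polynomials in [z] whose coefficients are real
    functions of [t]. On the closure of the domain [Re theta <= 0], so the
    exponential [exp (theta (s - t))], [s >= t], obtained by integrating from
    infinity is bounded.

    Regularity in [k]. Consider a Volterra system [Y = L Y + F] on the
    half-line whose kernel is this exponential times integrable functions, with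
    coefficients that are bounded functions of [k]. In a sup norm with a
    suitable weight the operator [L] is a contraction of ratio one half
    ([opL_contraction]); existence, uniqueness and a bound uniform in [k] follow
    ([solution_exists], [apriori]). The derivative of [Y] in [k], taken relative
    to a possibly closed set of parameters, solves the same system with a source
    that involves only lower derivatives, and induction shows that [Y] is as
    often differentiable as the weight [(1 + t)^n] permits ([smooth_solution]):
    each derivative of the exponential produces a factor [s - t], paid for by the
    weight, and a factor [k^2], recorded by the gauge [rho] of the predicate
    [smooth]. On bounded sets of [k] this applies to the column itself
    ([smooth_inner]).

    Large [k]. The coefficients of the original system grow like [k^2] and have
    to be removed ([normal_form]). First, [u / v] satisfies a Riccati equation,
    which is solved formally by [W = w_1 z + w_2 z^2 + ...]; as the equation
    determines [w_l] from lower coefficients and from the derivative of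
    [w_(l - 3)], the differentiability of the data allows to reach order [m + 3]
    ([riccati_solution]). Then [q = u - W v] is decoupled from [v] up to
    [z^(m + 1)], and the diagonal coefficient [h = kappa^2 (v21 W + v22)] of the
    equation for [v] turns out to be [O(z)] ([leading_cancellation]). Secondly,
    the term [kappa^2 v21 q] left in the equation for [v] is removed by passing to
    [v - X q], where [X] is chosen so that [kappa^2 v21 + 8 kappa^3 X] is bounded.
    Thirdly, a polynomial [V] in [z] with [V = 1] at infinity solves [V' = h V]
    up to [z^(m + 1)] ([formal_exponential]). The rescaled remainders
    [z^-(m + 1) q] and [z^-(m + 1) (v - X q - V)] then satisfy a Volterra system
    whose coefficients and source are polynomials in [z], to which
    [smooth_solution] applies on [|k| > 1] with [rho = |k|^2]. Hence
    [A - V(0, z)] and [B - (W V)(0, z)] are, up to terms of the required order,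
    equal to [z^(m + 1)] times functions whose [j]-th derivatives are
    [O(|k|^(2 j))] ([smooth_remainder]): this is the asserted expansion, together
    with its derivatives, and shows where the loss [2 j] comes from.

    The derivatives constructed on bounded sets and near infinity are glued by
    uniqueness of relative derivatives on sets without isolated points
    ([rder_unique], [exists_global_tower]).

    Symmetries. The system is real in [kappa], so uniqueness gives the symmetry
    under [k -> - conj k] ([col_Nconj]). Where [Im k^3 = 0], both [k] and
    [conj k] lie in the closure of the domain, and the Wronskian of the column
    at [k] and the conjugate column at [conj k] does not depend on [t]; its limit
    at infinity is 1 ([col_wronskian]). *)

(** * Complex modulus and exponential *)

Section ComplexModulus.
Variable R : realType.
Implicit Types (z w k : R[i]) (x : R).

(** The norm of [R[i]] takes its values in [R[i]]; estimates are carried out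
    with its real part. *)
Definition nc z : R := complex.Re `|z|.

Lemma normrE_nc z : `|z| = (nc z)%:C.
Proof. by []. Qed.

Lemma nc_ge0 z : 0 <= nc z.
Proof. by rewrite -ler0c -normrE_nc. Qed.

Lemma nc_def z : nc z = Num.sqrt (complex.Re z ^+ 2 + complex.Im z ^+ 2).
Proof. by rewrite /nc normc_def. Qed.

Lemma nc_sqr z : nc z ^+ 2 = complex.Re z ^+ 2 + complex.Im z ^+ 2.
Proof. by rewrite nc_def sqr_sqrtr// addr_ge0// sqr_ge0. Qed.

Lemma nc0 : nc 0 = 0.
Proof. by rewrite /nc normr0. Qed.

Lemma nc1 : nc 1 = 1.
Proof. by rewrite /nc normr1. Qed.

Lemma nc_eq0 z : (nc z == 0) = (z == 0).
Proof. by rewrite -(normr_eq0 z) normrE_nc eq_complex /= eqxx andbT. Qed.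

Lemma nc_gt0 z : (0 < nc z) = (z != 0).
Proof. by rewrite lt_neqAle nc_ge0 andbT eq_sym nc_eq0. Qed.

Lemma ncM z w : nc (z * w) = nc z * nc w.
Proof. by apply: complexI; rewrite rmorphM -!normrE_nc normrM. Qed.

Lemma ncN z : nc (- z) = nc z.
Proof. by rewrite /nc normrN. Qed.

Lemma ncD z w : nc (z + w) <= nc z + nc w.
Proof. by rewrite -lecR rmorphD -!normrE_nc ler_normD. Qed.

Lemma ncB z w : nc (z - w) <= nc z + nc w.
Proof. by rewrite (le_trans (ncD _ _))// ncN. Qed.

Lemma ncC z w : nc (z - w) = nc (w - z).
Proof. by rewrite -ncN opprB. Qed.

Lemma ncV z : nc z^-1 = (nc z)^-1.
Proof. by apply: complexI; rewrite fmorphV -!normrE_nc normfV. Qed.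

Lemma ncX z n : nc (z ^+ n) = nc z ^+ n.
Proof. by apply: complexI; rewrite rmorphXn -!normrE_nc normrX. Qed.

Lemma nc_real x : nc x%:C = `|x|.
Proof. by rewrite nc_def /= expr0n addr0 sqrtr_sqr. Qed.

Lemma nc_conj z : nc (conjc z) = nc z.
Proof. by rewrite !nc_def; case: z => a b /=; rewrite sqrrN. Qed.

Lemma nc_sum (I : Type) (r : seq I) (P : pred I) (F : I -> R[i]) :
  nc (\sum_(i <- r | P i) F i) <= \sum_(i <- r | P i) nc (F i).
Proof.
elim/big_ind2 : _ => [|a b c d h1 h2|//]; first by rewrite nc0.
by rewrite (le_trans (ncD _ _))// lerD.
Qed.

Lemma Re_nc z : `|complex.Re z| <= nc z.
Proof. by rewrite nc_def -sqrtr_sqr ler_wsqrtr// lerDl sqr_ge0. Qed.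

Lemma Im_nc z : `|complex.Im z| <= nc z.
Proof. by rewrite nc_def -sqrtr_sqr ler_wsqrtr// lerDr sqr_ge0. Qed.

Lemma nc_ReIm z : nc z <= `|complex.Re z| + `|complex.Im z|.
Proof.
rewrite -(@ler_pXn2r _ 2)// ?nnegrE ?nc_ge0 ?addr_ge0//.
rewrite nc_sqr sqrrD !real_normK ?num_real// lerD2r lerDl.
by rewrite mulrn_wge0// mulr_ge0.
Qed.

Lemma ReD z w : complex.Re (z + w) = complex.Re z + complex.Re w.
Proof. by case: z w => a b []. Qed.
Lemma ImD z w : complex.Im (z + w) = complex.Im z + complex.Im w.
Proof. by case: z w => a b []. Qed.
Lemma ReN z : complex.Re (- z) = - complex.Re z.
Proof. by case: z. Qed.
Lemma ImN z : complex.Im (- z) = - complex.Im z.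
Proof. by case: z. Qed.
Lemma ReM z w : complex.Re (z * w) =
  complex.Re z * complex.Re w - complex.Im z * complex.Im w.
Proof. by case: z w => a b []. Qed.
Lemma ImM z w : complex.Im (z * w) =
  complex.Re z * complex.Im w + complex.Im z * complex.Re w.
Proof. by case: z w => a b [] c d; rewrite /= addrC. Qed.

Lemma Re_conj z : complex.Re (conjc z) = complex.Re z.
Proof. by case: z. Qed.
Lemma Im_conj z : complex.Im (conjc z) = - complex.Im z.
Proof. by case: z. Qed.

Definition ReImE := (ReD, ImD, ReN, ImN, ReM, ImM).

Lemma complex_ext z w : complex.Re z = complex.Re w ->
  complex.Im z = complex.Im w -> z = w.
Proof. by case: z w => a b [] c d /= -> ->. Qed.

Lemma nbhs_nc (U : set R[i]) k : nbhs k U <->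
  exists2 d : R, 0 < d & forall k', nc (k' - k) < d -> U k'.
Proof.
split.
- move/nbhs_normP=> -[e /= e0 H].
  have [e' e'0 ee'] : exists2 e' : R, 0 < e' & e = e'%:C.
    move: (e0); rewrite ltcE /= => /andP[/eqP ie re]; exists (complex.Re e) => //.
    by apply: complex_ext.
  exists e' => // k' h; apply: H.
  by rewrite /ball_ /= ee' normrE_nc ltcR ncC.
- case=> d d0 H; apply/nbhs_normP; exists d%:C => /=; first by rewrite ltcR.
  move=> k'; rewrite /ball_ /= normrE_nc ltcR ncC; exact: H.
Qed.

Lemma near_nc (P : set R[i]) k :
  (\forall k' \near k, P k') <->
  exists2 d : R, 0 < d & forall k', nc (k' - k) < d -> P k'.
Proof. exact: nbhs_nc. Qed.

Lemma cvg_nc (F : set_system R[i]) (FF : Filter F) (f : R[i] -> R[i]) (l : R[i]) :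
  f @ F --> l <-> forall e : R, 0 < e -> \forall k \near F, nc (f k - l) < e.
Proof.
split=> [fl e e0|H].
  have fU : nbhs l [set y | nc (y - l) < e] by apply/nbhs_nc; exists e.
  exact: (fl _ fU).
move=> U /nbhs_nc[e e0 He].
by apply: filterS (H _ e0) => k; exact: He.
Qed.

Lemma closure_nc (D : set R[i]) k : closure D k <->
  forall d : R, 0 < d -> exists2 k', D k' & nc (k' - k) < d.
Proof.
split=> [h d d0|h U /nbhs_nc[d d0 dU]].
  have /h[k' [Dk' ?]] : nbhs k [set k' | nc (k' - k) < d].
    by apply/nbhs_nc; exists d.
  by exists k'.
by have [k' Dk' kd] := h _ d0; exists k'; split => //; exact: dU.
Qed.

Lemma open_nc (D : set R[i]) : open D <->
  forall k, D k -> exists2 d : R, 0 < d & forall k', nc (k' - k) < d -> D k'.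
Proof.
rewrite openE; split=> h k Dk; first by apply/nbhs_nc; exact: h.
by apply/nbhs_nc; exact: h.
Qed.

Lemma within_continuous_nc (D : set R[i]) (f : R[i] -> R[i]) :
  (forall k, D k -> forall e : R, 0 < e -> exists2 d : R, 0 < d &
     forall k', D k' -> nc (k' - k) < d -> nc (f k' - f k) < e) ->
  {within D, continuous f}.
Proof.
move=> H; apply/subspace_continuousP => k Dk.
apply/cvg_nc => e e0; have [d d0 h] := H _ Dk _ e0.
by apply/near_nc; exists d => // k' kd Dk'; exact: h.
Qed.

End ComplexModulus.

Section ComplexExponential.
Variable R : realType.
Implicit Types (z w : R[i]) (x y : R).

Lemma cexpD z w : cexp (z + w) = cexp z * cexp w.
Proof.
rewrite /cexp ReD ImD expRD cosD sinD; apply: complex_ext;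
  rewrite !ReImE /=; ring.
Qed.

Lemma cexp0 : cexp (0 : R[i]) = 1.
Proof. by rewrite /cexp /= expR0 cos0 sin0 mul1r. Qed.

Lemma Re_cexp z : complex.Re (cexp z) = expR (complex.Re z) * cos (complex.Im z).
Proof. by rewrite /cexp ReM /= mul0r subr0. Qed.

Lemma Im_cexp z : complex.Im (cexp z) = expR (complex.Re z) * sin (complex.Im z).
Proof. by rewrite /cexp ImM /= mul0r addr0. Qed.

Lemma nc_cexp z : nc (cexp z) = expR (complex.Re z).
Proof.
rewrite nc_def Re_cexp Im_cexp !exprMn -mulrDr cos2Dsin2 mulr1 sqrtr_sqr.
by rewrite ger0_norm// expR_ge0.
Qed.

Lemma nc_cexp_le1 z : complex.Re z <= 0 -> nc (cexp z) <= 1.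
Proof. by move=> h; rewrite nc_cexp expR_le1. Qed.

Lemma cexpNK z : cexp (- z) * cexp z = 1.
Proof. by rewrite -cexpD addNr cexp0. Qed.

Lemma cexp_conj z : cexp (conjc z) = conjc (cexp z).
Proof.
apply: complex_ext.
  by rewrite Re_conj !Re_cexp Re_conj Im_conj cosN.
by rewrite Im_conj !Im_cexp Re_conj Im_conj sinN mulrN.
Qed.

Lemma sin_le_norm x : `|sin x| <= `|x|.
Proof.
wlog x0 : x / 0 <= x.
  move=> h; case: (leP 0 x) => [|x0]; first exact: h.
  by rewrite -normrN -sinN -(normrN x); apply: h; rewrite oppr_ge0 ltW.
case: (ltgtP 0 x) x0 => // [x0 _|<- _]; last by rewrite sin0.
have [c _] := @MVT R sin cos 0 x x0 (fun c _ => is_derive_sin c)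
  (@continuous_subspaceT _ _ _ _ (@continuous_sin R)).
rewrite sin0 !subr0 => ->.
by rewrite normrM ler_piMl// cos_max.
Qed.

Lemma cosB1_le_norm x : `|cos x - 1| <= `|x|.
Proof.
wlog x0 : x / 0 <= x.
  move=> h; case: (leP 0 x) => [|x0]; first exact: h.
  by rewrite -cosN -(normrN x); apply: h; rewrite oppr_ge0 ltW.
case: (ltgtP 0 x) x0 => // [x0 _|<- _]; last by rewrite cos0 subrr !normr0.
have [c _] := @MVT R cos (fun c => - sin c) 0 x x0 (fun c _ => is_derive_cos c)
  (@continuous_subspaceT _ _ _ _ (@continuous_cos R)).
rewrite cos0 !subr0 => ->.
by rewrite normrM normrN ler_piMl// sin_max.
Qed.

Lemma cosB1_le_sqr x : `|cos x - 1| <= x ^+ 2.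
Proof.
have -> : cos x - 1 = - (2 * sin (x / 2) ^+ 2).
  by rewrite {1}[x](splitr x) -mulr2n cos_mulr2n cos2sin2; ring.
rewrite normrN normrM normrX.
have h := sin_le_norm (x / 2).
have : `|sin (x / 2)| ^+ 2 <= `|x / 2| ^+ 2 by rewrite ler_pXn2r// nnegrE.
rewrite (real_normK (num_real (x / 2))) ger0_norm//; nra.
Qed.

Lemma sinB_le_sqr x : `|sin x - x| <= x ^+ 2.
Proof.
wlog x0 : x / 0 <= x.
  move=> h; case: (leP 0 x) => [|x0]; first exact: h.
  rewrite -normrN opprD -sinN -(sqrrN x); apply: h; by rewrite oppr_ge0 ltW.
case: (ltgtP 0 x) x0 => // [x0 _|<- _]; last first.
  by rewrite sin0 subrr normr0 sqr_ge0.
have [c /[!in_itv]/= /andP[c0 cx]] :=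
  @MVT R sin cos 0 x x0 (fun c _ => is_derive_sin c)
  (@continuous_subspaceT _ _ _ _ (@continuous_sin R)).
rewrite sin0 !subr0 => ->.
rewrite -{2}[x]mul1r -mulrBl normrM (gtr0_norm x0) expr2 ler_pM2r//.
by rewrite (le_trans (cosB1_le_norm c))// gtr0_norm// ltW.
Qed.

Lemma expRB1_le_norm x : x <= 0 -> `|expR x - 1| <= `|x|.
Proof.
move=> x0; rewrite ler0_norm ?subr_le0 ?expR_le1// ler0_norm//.
have := expR_ge1Dx x; lra.
Qed.

Lemma expRB1B_le_sqr x : x <= 0 -> `|expR x - 1 - x| <= x ^+ 2.
Proof.
move=> x0; have h1 := expR_ge1Dx x; rewrite ger0_norm; last by lra.
have h2 := expR_ge1Dx (- x); have h3 := expRxMexpNx_1 x.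
have h4 : expR x * (1 - x) <= 1.
  by rewrite -[leRHS]h3 ler_wpM2l// expR_ge0.
nra.
Qed.

Lemma cexpB1_le z : complex.Re z <= 0 -> nc (cexp z - 1) <= 2 * nc z.
Proof.
case: z => a b /= a0; set z := a +i* b.
have -> : cexp z - 1 = (expR a - 1)%:C * (cos b +i* sin b) +
    ((cos b - 1) +i* sin b).
  by apply: complex_ext; rewrite /cexp !ReImE /=; ring.
have h1 := expRB1_le_norm a0; have h2 := cosB1_le_norm b.
have h3 := sin_le_norm b.
have ha : `|a| <= nc z := Re_nc z; have hb : `|b| <= nc z := Im_nc z.
have n1 : nc (cos b +i* sin b) = 1 by rewrite nc_def /= cos2Dsin2 sqrtr1.
have n2 : nc ((cos b - 1) +i* sin b) <= `|b|.
  rewrite nc_def /= -sqrtr_sqr ler_wsqrtr//.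
  have := cos2Dsin2 b.
  have : `|cos b - 1| <= b ^+ 2 / 2.
    have -> : cos b - 1 = - (2 * sin (b / 2) ^+ 2).
      by rewrite {1}[b](splitr b) -mulr2n cos_mulr2n cos2sin2; ring.
    rewrite normrN normrM normrX.
    have h := sin_le_norm (b / 2).
    have : `|sin (b / 2)| ^+ 2 <= `|b / 2| ^+ 2 by rewrite ler_pXn2r// nnegrE.
    rewrite (real_normK (num_real (b / 2))) ger0_norm//; nra.
  rewrite ler_norml => /andP[p1 p2] p3; nra.
rewrite (le_trans (ncD _ _))// ncM n1 mulr1 nc_real.
by move: ha hb h1 n2; lra.
Qed.

Lemma cexpB1B_le z : complex.Re z <= 0 ->
  nc (cexp z - 1 - z) <= 4 * nc z ^+ 2.
Proof.
case: z => a b /= a0; set z := a +i* b.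
have -> : cexp z - 1 - z =
   ((expR a - 1 - a) + expR a * (cos b - 1)) +i*
   (expR a * (sin b - b) + (expR a - 1) * b).
  by apply: complex_ext; rewrite /cexp !ReImE /=; ring.
apply: (le_trans (nc_ReIm _)) => /=.
have h1 := expRB1B_le_sqr a0; have h2 := cosB1_le_sqr b.
have h3 := sinB_le_sqr b; have h4 := expRB1_le_norm a0.
have e1 : expR a <= 1 by rewrite expR_le1.
have e0 := expR_ge0 a.
have h5 : `|expR a - 1 - a + expR a * (cos b - 1)| <= a ^+ 2 + b ^+ 2.
  rewrite (le_trans (ler_normD _ _))// lerD// normrM (ger0_norm e0).
  by rewrite -[leRHS]mul1r ler_pM.
have h6 : `|expR a * (sin b - b) + (expR a - 1) * b| <= b ^+ 2 + `|a| * `|b|.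
  rewrite (le_trans (ler_normD _ _))// !normrM (ger0_norm e0) lerD//.
    by rewrite -[leRHS]mul1r ler_pM.
  by rewrite ler_wpM2r.
rewrite nc_sqr /=.
have := sqr_ge0 (`|a| - `|b|); rewrite sqrrB !real_normK ?num_real//.
move: h5 h6 (sqr_ge0 a) (sqr_ge0 b); move: (`|a| * `|b|) => ab; lra.
Qed.

(** Whichever of the two exponentials is the smaller one can be factored out,
    so these estimates hold on a whole half plane, with constants that do not
    depend on the real parts. *)
Lemma cexp_lipschitz z w : complex.Re z <= 0 -> complex.Re w <= 0 ->
  nc (cexp w - cexp z) <= 2 * Num.min 1 (nc (w - z)).
Proof.
have bnd (a b : R[i]) : complex.Re a <= 0 -> complex.Re b <= 0 ->
    nc (cexp a - cexp b) <= 2.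
  move=> ha hb; rewrite (le_trans (ncB _ _))//.
  by have := nc_cexp_le1 ha; have := nc_cexp_le1 hb; lra.
have half (a b : R[i]) : complex.Re a <= 0 -> complex.Re b <= complex.Re a ->
    nc (cexp b - cexp a) <= 2 * nc (b - a).
  move=> ha hb.
  have -> : cexp b - cexp a = cexp a * (cexp (b - a) - 1).
    by rewrite mulrBr -cexpD mulr1 subrKC.
  rewrite ncM -[leRHS]mul1r ler_pM ?nc_ge0 ?nc_cexp_le1//.
  by apply: cexpB1_le; rewrite ReD ReN subr_le0.
move=> hz hw; rewrite minr_pMr// le_min mulr1 bnd//=.
case: (lerP (complex.Re w) (complex.Re z)) => h; first exact: half.
by rewrite ncC (ncC w); apply: half => //; exact: ltW.
Qed.

Lemma cexp_taylor1 z w : complex.Re z <= 0 -> complex.Re w <= 0 ->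
  nc (cexp w - cexp z - (w - z) * cexp z) <=
  6 * (nc (w - z) * Num.min 1 (nc (w - z))).
Proof.
move=> hz hw.
have lin : nc (cexp w - cexp z - (w - z) * cexp z) <= 6 * nc (w - z).
  rewrite (le_trans (ncB _ _))// ncM.
  have := cexp_lipschitz hz hw; rewrite minr_pMr// le_min mulr1 => /andP[_].
  have := nc_cexp_le1 hz; have := nc_ge0 (w - z); have := nc_ge0 (cexp z); nra.
rewrite minr_pMr ?nc_ge0// mulr1 minr_pMr// le_min lin /= -expr2.
case: (lerP (complex.Re w) (complex.Re z)) => h.
  have -> : cexp w - cexp z - (w - z) * cexp z =
      cexp z * (cexp (w - z) - 1 - (w - z)).
    by rewrite !mulrBr -cexpD mulr1 subrKC; ring.
  rewrite ncM -[leRHS]mul1r ler_pM ?nc_ge0 ?nc_cexp_le1//.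
  apply: le_trans (cexpB1B_le _) _; first by rewrite ReD ReN subr_le0.
  by rewrite ler_wpM2r ?sqr_ge0// ler_nat.
have -> : cexp w - cexp z - (w - z) * cexp z =
    cexp w * (- (cexp (z - w) - 1 - (z - w)) + (z - w) * (cexp (z - w) - 1)).
  have -> : cexp z = cexp w * cexp (z - w) by rewrite -cexpD subrKC.
  ring.
have zw : complex.Re (z - w) <= 0 by rewrite ReD ReN subr_le0 ltW.
rewrite ncM -[leRHS]mul1r ler_pM ?nc_ge0 ?nc_cexp_le1//.
rewrite (le_trans (ncD _ _))// ncN ncM (ncC w).
have := cexpB1B_le zw; have := cexpB1_le zw; have := nc_ge0 (z - w); nra.
Qed.

End ComplexExponential.

(** * Tail integrals of real functions *)

Section RealTails.
Variable R : realType.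
Notation mu := (@lebesgue_measure R).
Implicit Types (f g F : R -> R) (t : R).

(** Regularity on the closed half-line is formulated for real functions and
    applied to real and imaginary parts. *)
Definition conth f := {within `[(0 : R), +oo[, continuous f}.

Definition rlim f (l : R) :=
  forall e : R, 0 < e -> exists2 L : R, 0 <= L & forall t, L <= t -> `|f t - l| <= e.

Definition inth f := mu.-integrable `[(0 : R), +oo[ (EFin \o f).

Lemma sub_tail t : 0 <= t -> `[t, +oo[ `<=` `[(0 : R), +oo[.
Proof. by move=> t0 s /=; rewrite !in_itv /= !andbT; exact: le_trans. Qed.

Lemma inth_tail f t : 0 <= t -> inth f -> mu.-integrable `[t, +oo[ (EFin \o f).
Proof. by move=> t0; apply: integrableS => //; exact: sub_tail. Qed.

Lemma conth_measurable f : conth f -> measurable_fun `[(0 : R), +oo[ f.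
Proof. by move=> cf; apply: subspace_continuous_measurable_fun. Qed.

Lemma conth_for f t : conth f -> 0 < t -> {for t, continuous f}.
Proof.
move=> /continuous_within_itvcyP[cf _] t0; apply: cf.
by rewrite in_itv /= t0.
Qed.

Lemma conth_seg f a b : conth f -> 0 <= a -> {within `[a, b], continuous f}.
Proof.
move=> cf a0; apply: continuous_subspaceW cf => s /=.
by rewrite !in_itv /= andbT => /andP[+ _]; exact: le_trans.
Qed.

Lemma conth_eps f : (forall t, 0 <= t -> forall e : R, 0 < e ->
    exists2 d : R, 0 < d & forall s, 0 <= s -> `|s - t| < d -> `|f s - f t| <= e) ->
  conth f.
Proof.
move=> H; apply/subspace_continuousP => t; rewrite /= in_itv /= andbT => t0.
apply/cvgrPdist_le => e e0; have [d d0 h] := H _ t0 _ e0.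
rewrite /within /=; apply/nbhs_normP; exists d => //= s; rewrite /ball_ /= => sd.
by rewrite in_itv /= andbT => s0; rewrite distrC; apply: h => //; rewrite distrC.
Qed.

Lemma conth_epsP f t : conth f -> 0 <= t -> forall e : R, 0 < e ->
    exists2 d : R, 0 < d & forall s, 0 <= s -> `|s - t| < d -> `|f s - f t| <= e.
Proof.
move=> /subspace_continuousP cf t0 e e0.
have /cf /cvgrPdist_le /(_ e e0) : `[(0:R), +oo[%classic t.
  by rewrite /= in_itv /= t0.
rewrite /within /= => /nbhs_normP[d /= d0 h]; exists d => // s s0 st.
by rewrite distrC; apply: h; rewrite /ball_ /= ?in_itv /= ?s0// distrC.
Qed.

Lemma eq_conth f g : (forall t, 0 <= t -> f t = g t) -> conth f -> conth g.
Proof.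
move=> fg cf; apply: conth_eps => t t0 e e0.
have [d d0 h] := conth_epsP cf t0 e0; exists d => // s s0 st.
by rewrite -!fg//; exact: h.
Qed.

Lemma conth_cst (c : R) : conth (fun=> c).
Proof. by apply: continuous_subspaceT => x; exact: cst_continuous. Qed.

Lemma conthD f g : conth f -> conth g -> conth (fun t => f t + g t).
Proof. by move=> cf cg x; apply: cvgD; [exact: cf|exact: cg]. Qed.

Lemma conthN f : conth f -> conth (fun t => - f t).
Proof. by move=> cf x; apply: cvgN; exact: cf. Qed.

Lemma conthM f g : conth f -> conth g -> conth (fun t => f t * g t).
Proof. by move=> cf cg x; apply: cvgM; [exact: cf|exact: cg]. Qed.

Lemma conth_norm f : conth f -> conth (fun t => `|f t|).
Proof. by move=> cf x; apply: cvg_norm; exact: cf. Qed.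

Lemma conth_comp f (h : R -> R) : continuous h -> conth f -> conth (h \o f).
Proof.
move=> ch cf x; apply: (@continuous_comp (subspace _) _ _ f h); first exact: cf.
exact: ch.
Qed.

Lemma conth_id : conth id.
Proof. by apply: continuous_subspaceT => x; exact: cvg_id. Qed.

Lemma conth_exp f j : conth f -> conth (fun t => f t ^+ j).
Proof.
move=> cf; elim: j => [|j IH]; first exact: conth_cst.
by under eq_fun do rewrite exprS; exact: conthM.
Qed.

Lemma tail_split f t : 0 <= t -> inth f ->
  \int[mu]_(s in `[t, +oo[) f s =
  \int[mu]_(s in `[0, +oo[) f s - \int[mu]_(s in `[0, t]) f s.
Proof.
move=> t0 fi.
rewrite (@Rintegral_itvB _ _ (BLeft 0) +oo%O)//.
rewrite Rintegral_itv_obnd_cbnd//.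
apply: integrableS fi => //; apply: subset_itvr; by rewrite bnd_simp.
Qed.

Lemma le_tail f t : (forall s, 0 <= s -> 0 <= f s) -> inth f -> 0 <= t ->
  \int[mu]_(s in `[t, +oo[) f s <= \int[mu]_(s in `[0, +oo[) f s.
Proof.
move=> f0 fi t0; rewrite tail_split// gerBl Rintegral_ge0// => s /=.
by rewrite in_itv /= => /andP[/f0].
Qed.

Lemma tail_cvg0 f : (forall s, 0 <= s -> 0 <= f s) -> inth f ->
  forall e : R, 0 < e -> exists2 L : R, 0 <= L &
    forall t, L <= t -> \int[mu]_(s in `[t, +oo[) f s <= e.
Proof.
move=> f0 fi e e0.
have mf := measurable_int mu fi.
have : (\int[mu]_(x in `[0%R, n%:R]) (f x)%:E @[n --> \oo] -->
    \int[mu]_(x in `[0%R, +oo[) (f x)%:E)%E.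
  rewrite itv_bndy_bigcup_BRight.
  have -> : \bigcup_i `[(0:R), 0 + i%:R]%classic = \bigcup_i `[(0:R), i%:R]%classic.
    by apply: eq_bigcup => // i _; rewrite add0r.
  apply: ge0_nondecreasing_set_cvg_integral => //.
  - by move=> i j ij; apply/subsetPset; apply: subset_itvl; rewrite bnd_simp ler_nat.
  - move=> i; apply: measurable_funS mf => //; exact: subset_itvl.
  - by move=> i x /=; rewrite in_itv /= lee_fin => /andP[/f0].
have -> : (\int[mu]_(x in `[0%R, +oo[) (f x)%:E =
    (\int[mu]_(x in `[0, +oo[) f x)%:E)%E.
  by rewrite /Rintegral fineK//; exact: integrable_fin_num.
move=> /fine_cvgP[_ /cvgrPdist_le /(_ e e0)[N _ /(_ N (leqnn _))]].
set a := (X in `|X - _|); set b := (X in `|_ - X|) => abe.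
exists N%:R; first exact: ler0n.
move=> t Nt.
have t0 : 0 <= t by rewrite (le_trans _ Nt)// ler0n.
have : a - b <= e by apply: le_trans abe; exact: ler_norm.
apply: le_trans.
have fiN : mu.-integrable `[N%:R, +oo[ (EFin \o f) by apply: inth_tail => //; exact: ler0n.
rewrite tail_split// lerD2l lerN2.
have i2 : mu.-integrable `[0, t] (EFin \o f).
  by apply: integrableS fi => //; exact: subset_itvl.
rewrite /b /Rintegral fine_le//.
- by apply: integrable_fin_num => //; apply: integrableS fi => //; exact: subset_itvl.
- exact: integrable_fin_num.
apply: ge0_subset_integral => //.
- by apply: measurable_funS mf => //; exact: subset_itvl.
- by move=> x /=; rewrite in_itv /= lee_fin => /andP[/f0].
- by apply: subset_itvl; rewrite bnd_simp.
Qed.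

Lemma norm_tail_cvg0 f : inth f ->
  forall e : R, 0 < e -> exists2 L : R, 0 <= L &
    forall t, L <= t -> `|\int[mu]_(s in `[t, +oo[) f s| <= e.
Proof.
move=> fi e e0.
have [L L0 h] := @tail_cvg0 (fun s => `|f s|) (fun s _ => normr_ge0 _)
  (integrable_norm fi) e e0.
exists L => // t Lt; apply: le_trans (h _ Lt).
by apply: le_normr_Rintegral => //; apply: inth_tail => //; exact: le_trans Lt.
Qed.

Lemma conth_tail f : inth f -> conth (fun t => \int[mu]_(s in `[t, +oo[) f s).
Proof.
move=> fi.
apply: (@eq_conth (fun t => \int[mu]_(s in `[0, +oo[) f s -
    parameterized_integral mu 0 t f)).
  by move=> t t0; rewrite tail_split.
apply: conthD; first exact: conth_cst.
apply: conthN; apply: conth_eps => t t0 e e0.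
have t1 : 0 <= t + 1 by rewrite addr_ge0.
have fit : mu.-integrable `[0, t + 1] (EFin \o f).
  by apply: integrableS fi => //; exact: subset_itvl.
have /subspace_continuousP h := parameterized_integral_continuous t1 fit.
have /h /cvgrPdist_le /(_ e e0) : `[(0:R), t + 1]%classic t.
  by rewrite /= in_itv /= t0 lerDl ler01.
rewrite /within /= => /nbhs_normP[d /= d0 H]; exists (Num.min d 1).
  by rewrite lt_min d0 ltr01.
move=> s s0; rewrite lt_min => /andP[sd s1].
rewrite distrC; apply: H; rewrite /ball_ /= 1?distrC// in_itv /= s0 /=.
by move: s1; rewrite ltr_norml => /andP[_]; lra.
Qed.

Lemma is_derive_tail f t : inth f -> 0 < t -> {for t, continuous f} ->
  is_derive t 1 (fun t => \int[mu]_(s in `[t, +oo[) f s) (- f t).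
Proof.
move=> fi t0 ct.
have tt : t < t + 1 by rewrite ltrDl.
have fit : mu.-integrable `[0, t + 1] (EFin \o f).
  by apply: integrableS fi => //; exact: subset_itvl.
have [d1 d2] := continuous_FTC1_closed tt fit t0 ct.
have D : is_derive t 1 (fun t => \int[mu]_(s in `[0, +oo[) f s -
    \int[mu]_(s in `[0, t]) f s) (0 - f t).
  by apply: is_deriveB; apply: DeriveDef => //; rewrite -derive1E.
rewrite sub0r in D.
apply: near_eq_is_derive D.
exists t => //= s; rewrite /ball_ /= ltr_norml => /andP[_].
by rewrite ltrBlDr ltrDl => s0; rewrite [RHS]tail_split// ltW.
Qed.

(** The sum of a function and of the tail integral of its derivative is
    constant, whatever the sign of the derivative. *)
Lemma FTC_tail F f (l : R) : conth F -> conth f -> inth f ->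
  (forall t, 0 < t -> is_derive t 1 F (f t)) -> rlim F l ->
  forall t, 0 <= t -> F t = l - \int[mu]_(s in `[t, +oo[) f s.
Proof.
move=> cF cf fi dF Fl t t0.
pose G t := F t + \int[mu]_(s in `[t, +oo[) f s.
have cG : conth G by apply: conthD => //; exact: conth_tail.
have dG (s : R) : 0 < s -> is_derive s 1 G 0.
  move=> s0; rewrite -(subrr (f s)); apply: is_deriveD; first exact: dF.
  by apply: is_derive_tail => //; exact: conth_for.
have cst (s : R) : t <= s -> G s = G t.
  move=> ts.
  have [//||c _] := @MVT_segment _ G (fun=> 0) t s ts.
  - by move=> x; rewrite in_itv /= => /andP[tx _]; apply: dG; exact: le_lt_trans tx.
  - exact: conth_seg.
  by rewrite mul0r => /eqP; rewrite subr_eq0 => /eqP.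
have Gl : G t = l.
  apply/eqP; rewrite -subr_eq0 -normr_eq0; apply/negPn/negP => ne.
  have e0 : 0 < `|G t - l| / 4 by rewrite divr_gt0// lt_neqAle eq_sym ne normr_ge0.
  have [L1 _ h1] := Fl _ e0.
  have [L2 _ h2] := norm_tail_cvg0 fi e0.
  pose s := Num.max t (Num.max L1 L2).
  have ts : t <= s by rewrite /s le_max lexx.
  have Ls1 : L1 <= s by rewrite /s !le_max lexx orbT.
  have Ls2 : L2 <= s by rewrite /s !le_max lexx !orbT.
  have := ler_normD (F s - l) (\int[mu]_(s in `[s, +oo[) f s).
  rewrite addrAC -/(G s) cst//.
  have := h1 _ Ls1; have := h2 _ Ls2; move: e0; lra.
by rewrite -Gl /G addrK.
Qed.

End RealTails.

(** * Complex functions of a real variable *)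

Section ComplexIntegral.
Variable R : realType.
Notation mu := (@lebesgue_measure R).
(* the Borel structure carried by the Lebesgue measure *)
Local Notation mset D := (@measurable _ (measurableTypeR R) D).
Local Notation mfun D f := (@measurable_fun _ _ (measurableTypeR R) R D f).
Implicit Types (f g : R -> R[i]) (D : set R).

Definition cmeas D f :=
  mfun D (fun s => complex.Re (f s)) /\
  mfun D (fun s => complex.Im (f s)).

Lemma cmeasS D E f : mset E -> D `<=` E -> cmeas E f -> cmeas D f.
Proof. by move=> mE DE [h1 h2]; split; exact: measurable_funS DE _. Qed.

Lemma cmeas_cst D (c : R[i]) : cmeas D (fun=> c).
Proof. by split; exact: measurable_cst. Qed.

Lemma cmeas_real D (h : R -> R) : mfun D h -> cmeas D (fun s => (h s)%:C).
Proof. by move=> mh; split => //=; exact: measurable_cst. Qed.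

Lemma cmeasD D f g : cmeas D f -> cmeas D g -> cmeas D (fun s => f s + g s).
Proof.
move=> [f1 f2] [g1 g2]; split.
  by under eq_fun do rewrite ReD; exact: measurable_funD.
by under eq_fun do rewrite ImD; exact: measurable_funD.
Qed.

Lemma cmeasN D f : cmeas D f -> cmeas D (fun s => - f s).
Proof.
move=> [f1 f2]; split.
  by under eq_fun do rewrite ReN; exact: measurableT_comp.
by under eq_fun do rewrite ImN; exact: measurableT_comp.
Qed.

Lemma cmeasM D f g : cmeas D f -> cmeas D g -> cmeas D (fun s => f s * g s).
Proof.
move=> [f1 f2] [g1 g2]; split.
  under eq_fun do rewrite ReM.
  by apply: measurable_funB; exact: measurable_funM.
under eq_fun do rewrite ImM.
by apply: measurable_funD; exact: measurable_funM.
Qed.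

Lemma cmeas_sum D (I : Type) (r : seq I) (P : pred I) (F : I -> R -> R[i]) :
  (forall i, P i -> cmeas D (F i)) -> cmeas D (fun s => \sum_(i <- r | P i) F i s).
Proof.
move=> h; elim: r => [|i r IH].
  by under eq_fun do rewrite big_nil; exact: cmeas_cst.
have [Pi|Pi] := boolP (P i); last first.
  by under eq_fun do rewrite big_cons (negbTE Pi).
by under eq_fun do rewrite big_cons Pi; apply: cmeasD => //; exact: h.
Qed.

Lemma eq_cmeas D f g : (forall s, D s -> f s = g s) -> cmeas D f -> cmeas D g.
Proof.
move=> fg [h1 h2]; split.
  by apply: eq_measurable_fun h1 => s /set_mem Ds; rewrite fg.
by apply: eq_measurable_fun h2 => s /set_mem Ds; rewrite fg.
Qed.

Lemma integrableC_le D f (G : R -> R) : mset D -> cmeas D f ->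
  mu.-integrable D (EFin \o G) -> (forall s, D s -> nc (f s) <= G s) ->
  integrableC D f.
Proof.
move=> mD [f1 f2] iG fG; split.
  apply: le_integrable iG => //; first exact/measurable_EFinP.
  move=> s Ds /=; rewrite lee_fin (le_trans (Re_nc _))// (le_trans (fG _ Ds))//.
  exact: ler_norm.
apply: le_integrable iG => //; first exact/measurable_EFinP.
move=> s Ds /=; rewrite lee_fin (le_trans (Im_nc _))// (le_trans (fG _ Ds))//.
exact: ler_norm.
Qed.

Lemma integrableCS D E f : mset D -> mset E -> D `<=` E ->
  integrableC E f -> integrableC D f.
Proof. by move=> mD mE DE [h1 h2]; split; [exact: integrableS h1|exact: integrableS h2]. Qed.

Lemma eq_integrableC D f g : mset D -> (forall s, D s -> f s = g s) ->
  integrableC D f -> integrableC D g.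
Proof.
move=> mD fg [h1 h2]; split.
  by apply: eq_integrable h1 => // s /set_mem Ds /=; rewrite fg.
by apply: eq_integrable h2 => // s /set_mem Ds /=; rewrite fg.
Qed.

Lemma eq_integralC D f g : (forall s, D s -> f s = g s) ->
  integralC D f = integralC D g.
Proof.
move=> fg; rewrite /integralC; congr Complex.
  by apply: eq_Rintegral => s /set_mem Ds; rewrite fg.
by apply: eq_Rintegral => s /set_mem Ds; rewrite fg.
Qed.

Lemma integrableCD D f g : mset D -> integrableC D f -> integrableC D g ->
  integrableC D (fun s => f s + g s).
Proof.
move=> mD [f1 f2] [g1 g2]; split.
  apply: eq_integrable (integrableD mD f1 g1) => // s _ /=.
  by rewrite ReD EFinD.
apply: eq_integrable (integrableD mD f2 g2) => // s _ /=.
by rewrite ImD EFinD.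
Qed.

Lemma integralCD D f g : mset D -> integrableC D f -> integrableC D g ->
  integralC D (fun s => f s + g s) = integralC D f + integralC D g.
Proof.
move=> mD [f1 f2] [g1 g2]; apply: complex_ext; rewrite ?ReD ?ImD /=.
  rewrite -RintegralD//; apply: eq_Rintegral => s _; exact: ReD.
rewrite -RintegralD//; apply: eq_Rintegral => s _; exact: ImD.
Qed.

Lemma integrableRZ D (c : R) (h : R -> R) : mset D ->
  mu.-integrable D (EFin \o h) -> mu.-integrable D (EFin \o (fun s => c * h s)).
Proof.
move=> mD ih; by apply: eq_integrable (integrableZl mD c ih) => // s _ /=; rewrite EFinM.
Qed.

Lemma integrableRD D (h1 h2 : R -> R) : mset D ->
  mu.-integrable D (EFin \o h1) -> mu.-integrable D (EFin \o h2) ->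
  mu.-integrable D (EFin \o (fun s => h1 s + h2 s)).
Proof.
by move=> mD i1 i2; exact: (integrableD mD i1 i2).
Qed.

Lemma integrableRB D (h1 h2 : R -> R) : mset D ->
  mu.-integrable D (EFin \o h1) -> mu.-integrable D (EFin \o h2) ->
  mu.-integrable D (EFin \o (fun s => h1 s - h2 s)).
Proof.
by move=> mD i1 i2; exact: (integrableB mD i1 i2).
Qed.

Lemma inthD (h1 h2 : R -> R) : inth h1 -> inth h2 -> inth (fun s => h1 s + h2 s).
Proof. by move=> i1 i2; exact: (integrableRD _ i1 i2). Qed.

Lemma inthZ (c : R) (h : R -> R) : inth h -> inth (fun s => c * h s).
Proof. by move=> i1; exact: (integrableRZ c _ i1). Qed.

Lemma integrableCZ D (c : R[i]) f : mset D -> integrableC D f ->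
  integrableC D (fun s => c * f s).
Proof.
move=> mD [f1 f2]; split.
  have := integrableRB mD (integrableRZ (complex.Re c) mD f1)
    (integrableRZ (complex.Im c) mD f2).
  by apply: eq_integrable => // s _ /=; rewrite ReM.
have := integrableRD mD (integrableRZ (complex.Re c) mD f2)
  (integrableRZ (complex.Im c) mD f1).
by apply: eq_integrable => // s _ /=; rewrite ImM.
Qed.

Lemma integralCZ D (c : R[i]) f : mset D -> integrableC D f ->
  integralC D (fun s => c * f s) = c * integralC D f.
Proof.
move=> mD [f1 f2]; apply: complex_ext; rewrite ?ReM ?ImM /=.
  rewrite -!RintegralZl// -RintegralB//; do ?exact: integrableRZ.
  by apply: eq_Rintegral => s _; rewrite ReM.
rewrite -!RintegralZl// -RintegralD//; do ?exact: integrableRZ.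
by apply: eq_Rintegral => s _; rewrite ImM.
Qed.

Lemma integrableCN D f : mset D -> integrableC D f ->
  integrableC D (fun s => - f s).
Proof.
move=> mD h; apply: eq_integrableC (integrableCZ (-1) mD h) => // s _.
by rewrite mulN1r.
Qed.

Lemma integralCN D f : mset D -> integrableC D f ->
  integralC D (fun s => - f s) = - integralC D f.
Proof.
move=> mD h; rewrite -[RHS]mulN1r -integralCZ//; apply: eq_integralC => s _.
by rewrite mulN1r.
Qed.

Lemma integralCB D f g : mset D -> integrableC D f -> integrableC D g ->
  integralC D (fun s => f s - g s) = integralC D f - integralC D g.
Proof.
by move=> mD h1 h2; rewrite integralCD// ?integralCN//; exact: integrableCN.
Qed.

Lemma integrableC0 D : mset D -> integrableC D (fun=> 0).
Proof. by move=> mD; split; exact: integrable0. Qed.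

Lemma integralC0 D : mset D -> integralC D (fun=> 0) = 0.
Proof.
move=> mD; rewrite -[RHS](mul0r (integralC D (fun=> 0))).
rewrite -(integralCZ 0 mD (integrableC0 mD)).
by apply: eq_integralC => s _; rewrite mul0r.
Qed.

Lemma integrableC_sum D (I : Type) (r : seq I) (F : I -> R -> R[i]) :
  mset D -> (forall i, integrableC D (F i)) ->
  integrableC D (fun s => \sum_(i <- r) F i s).
Proof.
move=> mD h; elim: r => [|i r IH].
  by apply: eq_integrableC (integrableC0 mD) => // s _; rewrite big_nil.
apply: eq_integrableC (integrableCD mD (h i) IH) => // s _.
by rewrite big_cons.
Qed.

Lemma integralC_sum D (I : Type) (r : seq I) (F : I -> R -> R[i]) :
  mset D -> (forall i, integrableC D (F i)) ->
  integralC D (fun s => \sum_(i <- r) F i s) = \sum_(i <- r) integralC D (F i).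
Proof.
move=> mD h; elim: r => [|i r IH].
  rewrite big_nil -[RHS](integralC0 mD).
  by apply: eq_integralC => s _; rewrite big_nil.
rewrite big_cons -IH -integralCD//; last exact: integrableC_sum.
by apply: eq_integralC => s _; rewrite big_cons.
Qed.

Lemma integralC_conj D f : mset D -> integrableC D f ->
  integralC D (fun s => conjc (f s)) = conjc (integralC D f).
Proof.
move=> mD [f1 f2]; apply: complex_ext; rewrite ?Re_conj ?Im_conj /=.
  by apply: eq_Rintegral => s _; rewrite Re_conj.
rewrite -mulN1r -RintegralZl//.
by apply: eq_Rintegral => s _; rewrite Im_conj mulN1r.
Qed.

(** Rotating the integral onto the positive real axis reduces the modulus
    bound to the monotonicity of real integrals. *)
Lemma nc_integralC_le D f (G : R -> R) : mset D -> integrableC D f ->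
  mu.-integrable D (EFin \o G) -> (forall s, D s -> nc (f s) <= G s) ->
  nc (integralC D f) <= \int[mu]_(s in D) G s.
Proof.
move=> mD fi iG fG; set I := integralC D f.
have [I0|I0] := eqVneq I 0.
  rewrite I0 nc0; apply: Rintegral_ge0 => s Ds; apply: le_trans (fG _ Ds).
  exact: nc_ge0.
pose c := conjc I / (nc I)%:C.
have nI : (nc I)%:C != 0 :> R[i] by rewrite -normrE_nc normr_eq0.
have cI : c * I = (nc I)%:C.
  by rewrite /c mulrAC [conjc I * I]mulrC -sqr_normc normrE_nc expr2 mulfK.
have c1 : nc c = 1.
  by rewrite /c ncM nc_conj ncV nc_real ger0_norm ?nc_ge0// divff// nc_eq0.
have [h1 _] := integrableCZ c mD fi.
have -> : nc I = \int[mu]_(s in D) complex.Re (c * f s).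
  have : complex.Re (c * I) = nc I by rewrite cI.
  by rewrite /I -integralCZ//= => <-.
apply: le_Rintegral => // s Ds.
by rewrite (le_trans (ler_norm _))// (le_trans (Re_nc _))// ncM c1 mul1r fG.
Qed.

End ComplexIntegral.

Section ComplexCalculus.
Variable R : realType.
Notation mu := (@lebesgue_measure R).
Implicit Types (f g : R -> R[i]).

Definition cconth f :=
  conth (fun s => complex.Re (f s)) /\ conth (fun s => complex.Im (f s)).

(** At the endpoint [t = 0] continuity suffices for the fundamental theorem of
    calculus, and no derivative is required there. *)
Definition cder f g := forall t : R, 0 < t ->
  is_derive t 1 (fun s => complex.Re (f s)) (complex.Re (g t)) /\
  is_derive t 1 (fun s => complex.Im (f s)) (complex.Im (g t)).

Definition clim f (l : R[i]) := forall e : R, 0 < e ->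
  exists2 L : R, 0 <= L & forall t, L <= t -> nc (f t - l) <= e.

Lemma cconth_cst (c : R[i]) : cconth (fun=> c).
Proof. by split; exact: conth_cst. Qed.

Lemma cconth_real (h : R -> R) : conth h -> cconth (fun s => (h s)%:C).
Proof. by move=> ch; split => //=; exact: conth_cst. Qed.

Lemma cconthD f g : cconth f -> cconth g -> cconth (fun s => f s + g s).
Proof.
move=> [f1 f2] [g1 g2]; split.
  by under eq_fun do rewrite ReD; exact: conthD.
by under eq_fun do rewrite ImD; exact: conthD.
Qed.

Lemma cconthN f : cconth f -> cconth (fun s => - f s).
Proof.
move=> [f1 f2]; split.
  by under eq_fun do rewrite ReN; exact: conthN.
by under eq_fun do rewrite ImN; exact: conthN.
Qed.

Lemma cconthM f g : cconth f -> cconth g -> cconth (fun s => f s * g s).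
Proof.
move=> [f1 f2] [g1 g2]; split.
  by under eq_fun do rewrite ReM; apply: conthD; [|apply: conthN]; exact: conthM.
by under eq_fun do rewrite ImM; apply: conthD; exact: conthM.
Qed.

Lemma cconth_sum (I : Type) (r : seq I) (P : pred I) (F : I -> R -> R[i]) :
  (forall i, P i -> cconth (F i)) -> cconth (fun s => \sum_(i <- r | P i) F i s).
Proof.
move=> h; elim: r => [|i r IH].
  by under eq_fun do rewrite big_nil; exact: cconth_cst.
have [Pi|Pi] := boolP (P i); last first.
  by under eq_fun do rewrite big_cons (negbTE Pi).
by under eq_fun do rewrite big_cons Pi; apply: cconthD => //; exact: h.
Qed.

Lemma cconth_cexp f : cconth f -> cconth (fun s => cexp (f s)).
Proof.
move=> [f1 f2]; split.
  under eq_fun do rewrite Re_cexp.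
  apply: conthM.
    exact: (conth_comp (@continuous_expR R) f1).
  exact: (conth_comp (@continuous_cos R) f2).
under eq_fun do rewrite Im_cexp.
apply: conthM.
  exact: (conth_comp (@continuous_expR R) f1).
exact: (conth_comp (@continuous_sin R) f2).
Qed.

Lemma cconth_cexp_lin (c : R[i]) (a : R) :
  cconth (fun s => cexp (c * (s - a)%:C)).
Proof.
apply: cconth_cexp; apply: cconthM; first exact: cconth_cst.
apply: cconth_real; apply: conthD; [exact: conth_id|exact: conth_cst].
Qed.

Lemma cconth_cmeas f : cconth f -> cmeas `[(0 : R), +oo[ f.
Proof. by move=> [f1 f2]; split; exact: conth_measurable. Qed.

Lemma eq_cconth f g : (forall t, 0 <= t -> f t = g t) -> cconth f -> cconth g.
Proof.
move=> fg [h1 h2]; split.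
  by apply: eq_conth h1 => t t0; rewrite fg.
by apply: eq_conth h2 => t t0; rewrite fg.
Qed.

Lemma cconth_nc f : cconth f -> conth (fun s => nc (f s)).
Proof.
move=> [f1 f2]; under eq_fun do rewrite nc_def !expr2.
apply: (conth_comp (@sqrt_continuous R)).
by apply: conthD; exact: conthM.
Qed.

Lemma eq_cder f g g' : (forall t, 0 < t -> g t = g' t) -> cder f g -> cder f g'.
Proof. by move=> gg h t t0; rewrite -gg//; exact: h. Qed.

Lemma cder_cst (c : R[i]) : cder (fun=> c) (fun=> 0).
Proof. by move=> t t0; split; exact: is_derive_cst. Qed.

Lemma cder_real (h h' : R -> R) : (forall t : R, 0 < t -> is_derive t 1 h (h' t)) ->
  cder (fun s => (h s)%:C) (fun s => (h' s)%:C).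
Proof. by move=> H t t0; split; [exact: H|exact: is_derive_cst]. Qed.

Lemma cderD f g f' g' : cder f f' -> cder g g' ->
  cder (fun s => f s + g s) (fun s => f' s + g' s).
Proof.
move=> hf hg t t0; have [f1 f2] := hf t t0; have [g1 g2] := hg t t0; split.
  by under eq_fun do rewrite ReD; rewrite ReD; exact: is_deriveD.
by under eq_fun do rewrite ImD; rewrite ImD; exact: is_deriveD.
Qed.

Lemma cderN f f' : cder f f' -> cder (fun s => - f s) (fun s => - f' s).
Proof.
move=> hf t t0; have [f1 f2] := hf t t0; split.
  by under eq_fun do rewrite ReN; rewrite ReN; exact: is_deriveN.
by under eq_fun do rewrite ImN; rewrite ImN; exact: is_deriveN.
Qed.

Lemma cderM f g f' g' : cder f f' -> cder g g' ->
  cder (fun s => f s * g s) (fun s => f' s * g s + f s * g' s).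
Proof.
move=> hf hg t t0; have [f1 f2] := hf t t0; have [g1 g2] := hg t t0; split.
  under eq_fun do rewrite ReM.
  apply: (is_derive_eq (is_deriveB (is_deriveM f1 g1) (is_deriveM f2 g2))).
  by rewrite !ReImE /GRing.scale /=; ring.
under eq_fun do rewrite ImM.
apply: (is_derive_eq (is_deriveD (is_deriveM f1 g2) (is_deriveM f2 g1))).
by rewrite !ReImE /GRing.scale /=; ring.
Qed.

Lemma cder_sum (I : Type) (r : seq I) (F F' : I -> R -> R[i]) :
  (forall i, cder (F i) (F' i)) ->
  cder (fun s => \sum_(i <- r) F i s) (fun s => \sum_(i <- r) F' i s).
Proof.
move=> h; elim: r => [|i r IH].
  under eq_fun do rewrite big_nil; apply: eq_cder (cder_cst 0) => t _.
  by rewrite big_nil.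
under eq_fun do rewrite big_cons.
by apply: eq_cder (cderD (h i) IH) => t _; rewrite big_cons.
Qed.

Lemma cder_cexp_lin (c : R[i]) (a : R) :
  cder (fun s => cexp (c * (s - a)%:C)) (fun s => c * cexp (c * (s - a)%:C)).
Proof.
case: c => x y t t0.
have dl (b : R) : is_derive t 1 (fun s : R => b * (s - a)) b.
  apply: (is_derive_eq (is_deriveZ b (is_deriveB (is_derive_id t 1) (is_derive_cst a t 1)))).
  by rewrite /GRing.scale /= subr0 mulr1.
have e1 := @is_derive1_comp R expR (fun s => x * (s - a)) t _ _
  (is_derive_expR _) (dl x).
have e2 := @is_derive1_comp R cos (fun s => y * (s - a)) t _ _
  (is_derive_cos _) (dl y).
have e3 := @is_derive1_comp R sin (fun s => y * (s - a)) t _ _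
  (is_derive_sin _) (dl y).
split.
  under eq_fun do rewrite Re_cexp ReM ImM /= !mulr0 subr0 add0r.
  apply: (is_derive_eq (is_deriveM e1 e2)).
  by rewrite ReM Re_cexp Im_cexp ReM ImM /= /GRing.scale /= !mulr0 subr0 add0r; ring.
under eq_fun do rewrite Im_cexp ReM ImM /= !mulr0 subr0 add0r.
apply: (is_derive_eq (is_deriveM e1 e3)).
by rewrite ImM Re_cexp Im_cexp ReM ImM /= /GRing.scale /= !mulr0 subr0 add0r; ring.
Qed.

Lemma clim_cst (c : R[i]) : clim (fun=> c) c.
Proof. by move=> e e0; exists 0 => // t _; rewrite subrr nc0 ltW. Qed.

Lemma clim_eq f g l : (forall t, 0 <= t -> f t = g t) -> clim f l -> clim g l.
Proof.
move=> fg h e e0; have [L L0 H] := h e e0; exists L => // t Lt.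
by rewrite -fg ?H//; exact: le_trans Lt.
Qed.

Lemma clim0_real (h : R -> R) : rlim h 0 -> clim (fun t => (h t)%:C) 0.
Proof.
move=> hh e e0; have [L L0 H] := hh e e0; exists L => // t Lt.
by rewrite subr0 nc_real; have := H t Lt; rewrite subr0.
Qed.

Lemma climD f g l l' : clim f l -> clim g l' -> clim (fun t => f t + g t) (l + l').
Proof.
move=> hf hg e e0; have e2 : 0 < e / 2 by rewrite divr_gt0.
have [L L0 H] := hf _ e2; have [L' L'0 H'] := hg _ e2.
exists (Num.max L L'); first by rewrite le_max L0.
move=> t; rewrite ge_max => /andP[/H h1 /H' h2].
rewrite opprD addrACA (le_trans (ncD _ _))//; move: h1 h2; lra.
Qed.

Lemma clim0M f g (M : R) : (forall t, 0 <= t -> nc (f t) <= M) -> clim g 0 ->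
  clim (fun t => f t * g t) 0.
Proof.
move=> hf hg e e0.
have M1 : 0 < `|M| + 1 by rewrite ltr_wpDl.
have [|L L0 H] := hg (e / (`|M| + 1)); first by rewrite divr_gt0.
exists L => // t Lt; rewrite subr0 ncM.
have := H t Lt; rewrite subr0 ler_pdivlMr// => h.
apply: le_trans h; rewrite mulrC ler_wpM2l ?nc_ge0//.
rewrite (le_trans (hf t _))//; first exact: le_trans Lt.
by rewrite (le_trans (ler_norm _))// lerDl.
Qed.

Lemma clim0Z (c : R[i]) g : clim g 0 -> clim (fun t => c * g t) 0.
Proof. by exact: (@clim0M (fun=> c) g (nc c) (fun _ _ => lexx _)). Qed.

Lemma FTC_ctail f g (l : R[i]) : cconth f -> cconth g ->
  integrableC `[(0 : R), +oo[ g -> cder f g -> clim f l ->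
  forall t, 0 <= t -> f t = l - integralC `[t, +oo[ g.
Proof.
move=> [f1 f2] [g1 g2] [i1 i2] fg fl t t0; apply: complex_ext.
  rewrite ReD ReN /=.
  apply: (@FTC_tail R (fun s => complex.Re (f s))) => //.
    by move=> s s0; have [] := fg s s0.
  move=> e e0; have [L L0 H] := fl e e0; exists L => // s Ls.
  by rewrite -ReN -ReD (le_trans (Re_nc _))// H.
rewrite ImD ImN /=.
apply: (@FTC_tail R (fun s => complex.Im (f s))) => //.
  by move=> s s0; have [] := fg s s0.
move=> e e0; have [L L0 H] := fl e e0; exists L => // s Ls.
by rewrite -ImN -ImD (le_trans (Im_nc _))// H.
Qed.

Lemma cconth_ctail g : integrableC `[(0 : R), +oo[ g ->
  cconth (fun t => integralC `[t, +oo[ g).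
Proof. by move=> [i1 i2]; split => /=; exact: conth_tail. Qed.

Lemma cder_ctail g : cconth g -> integrableC `[(0 : R), +oo[ g ->
  cder (fun t => integralC `[t, +oo[ g) (fun t => - g t).
Proof.
move=> [c1 c2] [i1 i2] t t0; rewrite ReN ImN.
by split; apply: is_derive_tail => //; exact: conth_for.
Qed.

Lemma clim_ctail g : integrableC `[(0 : R), +oo[ g ->
  clim (fun t => integralC `[t, +oo[ g) 0.
Proof.
move=> [i1 i2] e e0; have e2 : 0 < e / 2 by rewrite divr_gt0.
have [L L0 H] := norm_tail_cvg0 i1 e2; have [L' L'0 H'] := norm_tail_cvg0 i2 e2.
exists (Num.max L L'); first by rewrite le_max L0.
move=> t; rewrite ge_max => /andP[/H h1 /H' h2].
rewrite subr0 (le_trans (nc_ReIm _))//=; move: h1 h2; lra.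
Qed.

Lemma cconth_clim_bounded f l : cconth f -> clim f l ->
  exists M : R, forall t, 0 <= t -> nc (f t) <= M.
Proof.
move=> cf fl; have [L L0 H] := fl 1 ltr01.
have cn := conth_seg (b := L) (cconth_nc cf) (lexx 0).
have [c _ hc] := EVT_max L0 cn.
exists (Num.max (nc (f c)) (1 + nc l)) => t t0; rewrite le_max.
case: (leP t L) => tL; first by rewrite hc// in_itv /= t0.
apply/orP; right; rewrite -[f t](subrK l) (le_trans (ncD _ _))// lerD2r.
by apply: H; exact: ltW.
Qed.

End ComplexCalculus.

(** * Families differentiable up to the boundary of the parameter set *)

Section SmoothFamilies.
Variable R : realType.
Implicit Types (k : R[i]) (Y Z : bool -> R -> R[i]).

Definition adm Y := forall b, cmeas `[(0 : R), +oo[ (Y b).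
Definition bnd Y (c : R) := forall b t, 0 <= t -> nc (Y b t) <= c.

Lemma bndW Y c c' : c <= c' -> bnd Y c -> bnd Y c'.
Proof. by move=> cc h b t t0; rewrite (le_trans (h b t t0)). Qed.

Lemma eq_bnd Y Z c : (forall b t, 0 <= t -> Y b t = Z b t) -> bnd Y c -> bnd Z c.
Proof. by move=> YZ h b t t0; rewrite -YZ// h. Qed.

Lemma bndD Y Z c c' : bnd Y c -> bnd Z c' -> bnd (fun b t => Y b t + Z b t) (c + c').
Proof. by move=> h h' b t t0; rewrite (le_trans (ncD _ _))// lerD ?h ?h'. Qed.

Lemma bndN Y c : bnd Y c -> bnd (fun b t => - Y b t) c.
Proof. by move=> h b t t0; rewrite ncN h. Qed.

Lemma bndB Y Z c c' : bnd Y c -> bnd Z c' -> bnd (fun b t => Y b t - Z b t) (c + c').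
Proof. by move=> h h'; apply: bndD => //; exact: bndN. Qed.

Lemma bndM Y Z c c' : bnd Y c -> bnd Z c' -> bnd (fun b t => Y b t * Z b t) (c * c').
Proof. by move=> h h' b t t0; rewrite ncM ler_pM ?nc_ge0 ?h ?h'. Qed.

Lemma bndZ (a : R[i]) Y c : bnd Y c -> bnd (fun b t => a * Y b t) (nc a * c).
Proof. by move=> h b t t0; rewrite ncM ler_wpM2l ?nc_ge0 ?h. Qed.

Lemma bnd_ge0 Y c : bnd Y c -> 0 <= c.
Proof. by move=> h; apply: le_trans (h true 0 (lexx 0)); exact: nc_ge0. Qed.

Lemma eq_adm Y Z : (forall b t, 0 <= t -> Y b t = Z b t) -> adm Y -> adm Z.
Proof.
move=> YZ h b; apply: eq_cmeas (h b) => s /=; rewrite in_itv /= andbT.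
exact: YZ.
Qed.

Lemma admD Y Z : adm Y -> adm Z -> adm (fun b t => Y b t + Z b t).
Proof. by move=> h h' b; exact: cmeasD. Qed.
Lemma admN Y : adm Y -> adm (fun b t => - Y b t).
Proof. by move=> h b; exact: cmeasN. Qed.
Lemma admB Y Z : adm Y -> adm Z -> adm (fun b t => Y b t - Z b t).
Proof. by move=> h h'; apply: admD => //; exact: admN. Qed.
Lemma admM Y Z : adm Y -> adm Z -> adm (fun b t => Y b t * Z b t).
Proof. by move=> h h' b; exact: cmeasM. Qed.
Lemma adm_cst (c : bool -> R[i]) : adm (fun b _ => c b).
Proof. by move=> b; exact: cmeas_cst. Qed.
Lemma admZ (a : R[i]) Y : adm Y -> adm (fun b t => a * Y b t).
Proof. by move=> h; apply: admM => //; exact: (adm_cst (fun=> a)). Qed.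

Variables (Om : set R[i]) (rho : R[i] -> R).
Hypothesis rho_ge0 : forall k, Om k -> 0 <= rho k.
Implicit Types (f g : R[i] -> bool -> R -> R[i]) (w : R[i] -> R).

Definition fam_cont f := forall k, Om k -> forall e : R, 0 < e ->
  exists2 d : R, 0 < d & forall k', Om k' -> nc (k' - k) < d ->
    bnd (fun b t => f k' b t - f k b t) e.

(** The derivative is taken relative to [Om], so that on a closed set it makes
    sense up to the boundary. *)
Definition fam_der f f' := forall k, Om k -> forall e : R, 0 < e ->
  exists2 d : R, 0 < d & forall k', Om k' -> nc (k' - k) < d ->
    bnd (fun b t => f k' b t - f k b t - (k' - k) * f' k b t) (e * nc (k' - k)).

Definition fam_bounded w f :=
  exists2 C : R, 0 <= C & forall k, Om k -> bnd (f k) (C * w k).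

(** Each derivative costs a factor [rho]. Taking [rho] to be [|k|^2] accounts
    for the loss of two powers of [k] per derivative caused by
    differentiating [exp (8 i k^3 s)]. *)
Fixpoint smooth (n : nat) w f : Prop :=
  [/\ forall k, Om k -> adm (f k), fam_cont f, fam_bounded w f &
   match n with
   | 0%N => True
   | n'.+1 => exists2 f', fam_der f f' & smooth n' (fun k => w k * rho k) f'
   end].

Lemma smoothE n w f : smooth n w f ->
  [/\ forall k, Om k -> adm (f k), fam_cont f & fam_bounded w f].
Proof. by case: n => [|n] []. Qed.

Lemma eq_smooth n w f g : (forall k b t, Om k -> 0 <= t -> f k b t = g k b t) ->
  smooth n w f -> smooth n w g.
Proof.
move=> fg sf; have h0 : [/\ forall k, Om k -> adm (g k), fam_cont g & fam_bounded w g].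
  have [h1 h2 [C C0 h3]] := smoothE sf; split.
  - by move=> k Ok; apply: eq_adm (h1 _ Ok) => b t t0; exact: fg.
  - move=> k Ok e e0; have [d d0 H] := h2 _ Ok _ e0; exists d => // k' Ok' kd.
    by apply: eq_bnd (H _ Ok' kd) => b t t0; rewrite !fg.
  - by exists C => // k Ok; apply: eq_bnd (h3 _ Ok) => b t t0; rewrite fg.
case: n sf h0 => [|n]; first by move=> _ [].
move=> [_ _ _ [f' df sf']] [h1 h2 h3]; split => //; exists f' => //.
move=> k Ok e e0; have [d d0 H] := df _ Ok _ e0; exists d => // k' Ok' kd.
by apply: eq_bnd (H _ Ok' kd) => b t t0; rewrite !fg.
Qed.

Lemma smoothW n w w' f (C : R) : 0 <= C -> (forall k, Om k -> w k <= C * w' k) ->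
  smooth n w f -> smooth n w' f.
Proof.
move=> C0; elim: n w w' f => [|n IH] w w' f ww.
  move=> [h1 h2 [D D0 h3] _]; split => //; exists (D * C); first exact: mulr_ge0.
  move=> k Ok; apply: bndW (h3 _ Ok); rewrite -mulrA ler_wpM2l//; exact: ww.
move=> [h1 h2 [D D0 h3] [f' df sf]]; split => //.
  exists (D * C); first exact: mulr_ge0.
  move=> k Ok; apply: bndW (h3 _ Ok); rewrite -mulrA ler_wpM2l//; exact: ww.
exists f' => //; apply: IH sf => k Ok.
by rewrite mulrA ler_wpM2r ?rho_ge0// ww.
Qed.

Lemma smooth_pred n w f : smooth n.+1 w f -> smooth n w f.
Proof.
elim: n w f => [|n IH] w f [h1 h2 h3 [f' df sf]]; split => //.
by exists f' => //; exact: IH.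
Qed.

Lemma fam_pbounded w f : fam_bounded w f -> forall k, Om k ->
  exists2 B : R, 0 < B & bnd (f k) B.
Proof.
move=> [C C0 h] k Ok; exists (`|C * w k| + 1); first by rewrite ltr_wpDl.
by apply: bndW (h _ Ok); rewrite (le_trans (ler_norm _))// lerDl.
Qed.

Lemma fam_contD f g : fam_cont f -> fam_cont g ->
  fam_cont (fun k b t => f k b t + g k b t).
Proof.
move=> hf hg k Ok e e0; have e2 : 0 < e / 2 by rewrite divr_gt0.
have [d d0 H] := hf _ Ok _ e2; have [d' d'0 H'] := hg _ Ok _ e2.
exists (Num.min d d'); first by rewrite lt_min d0.
move=> k' Ok'; rewrite lt_min => /andP[kd kd'].
rewrite [e]splitr; apply: eq_bnd (bndD (H _ Ok' kd) (H' _ Ok' kd')) => b t _ /=.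
by rewrite opprD addrACA.
Qed.

Lemma fam_contM w w' f g : fam_cont f -> fam_cont g ->
  fam_bounded w f -> fam_bounded w' g ->
  fam_cont (fun k b t => f k b t * g k b t).
Proof.
move=> hf hg bf bg k Ok e e0.
have [B B0 hB] := fam_pbounded bf Ok; have [B' B'0 hB'] := fam_pbounded bg Ok.
have [d d0 H] : exists2 d : R, 0 < d & forall k', Om k' -> nc (k' - k) < d ->
    bnd (fun b t => f k' b t - f k b t) (e / 2 / (B' + 1)).
  by apply: hf => //; rewrite !divr_gt0// addr_gt0.
have [d' d'0 H'] : exists2 d : R, 0 < d & forall k', Om k' -> nc (k' - k) < d ->
    bnd (fun b t => g k' b t - g k b t) (Num.min 1 (e / 2 / B)).
  by apply: hg => //; rewrite lt_min ltr01 !divr_gt0.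
exists (Num.min d d'); first by rewrite lt_min d0.
move=> k' Ok'; rewrite lt_min => /andP[/(H _ Ok') h /(H' _ Ok') h'].
have hB1 : bnd (g k') (B' + 1).
  have h1 : bnd (fun b t => g k' b t - g k b t) 1.
    by apply: bndW h'; rewrite ge_min lexx.
  by rewrite addrC; apply: eq_bnd (bndD h1 hB') => b t _; rewrite subrK.
apply: (@eq_bnd (fun b t => (f k' b t - f k b t) * g k' b t +
    f k b t * (g k' b t - g k b t))) => [b t _|]; first by ring.
rewrite [e]splitr; apply: bndD.
  apply: bndW (bndM h hB1); rewrite divfK// gt_eqF// addr_gt0//.
apply: bndW (bndM hB h'); apply: (@le_trans _ _ (B * (e / 2 / B))).
  by rewrite ler_pM2l// ge_min lexx orbT.
by rewrite mulrC divfK// gt_eqF.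
Qed.

Lemma fam_derD f g f' g' : fam_der f f' -> fam_der g g' ->
  fam_der (fun k b t => f k b t + g k b t) (fun k b t => f' k b t + g' k b t).
Proof.
move=> hf hg k Ok e e0; have e2 : 0 < e / 2 by rewrite divr_gt0.
have [d d0 H] := hf _ Ok _ e2; have [d' d'0 H'] := hg _ Ok _ e2.
exists (Num.min d d'); first by rewrite lt_min d0.
move=> k' Ok'; rewrite lt_min => /andP[kd kd'].
rewrite [e]splitr mulrDl.
by apply: eq_bnd (bndD (H _ Ok' kd) (H' _ Ok' kd')) => b t _ /=; ring.
Qed.

Lemma fam_derM w w1 w' f g f' g' : fam_der f f' -> fam_der g g' ->
  fam_cont g -> fam_bounded w f -> fam_bounded w1 f' -> fam_bounded w' g ->
  fam_der (fun k b t => f k b t * g k b t)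
          (fun k b t => f' k b t * g k b t + f k b t * g' k b t).
Proof.
move=> df dg hg bf bf' bg k Ok e e0.
have [B B0 hB] := fam_pbounded bf Ok; have [B' B'0 hB'] := fam_pbounded bg Ok.
have [B1 B10 hB1] := fam_pbounded bf' Ok.
have e3 : 0 < e / 3 by rewrite divr_gt0.
have [d d0 H] : exists2 d : R, 0 < d & forall k', Om k' -> nc (k' - k) < d ->
    bnd (fun b t => f k' b t - f k b t - (k' - k) * f' k b t)
        (e / 3 / (B' + 1) * nc (k' - k)).
  by apply: df => //; rewrite divr_gt0// addr_gt0.
have [d1 d10 H1] : exists2 d : R, 0 < d & forall k', Om k' -> nc (k' - k) < d ->
    bnd (fun b t => g k' b t - g k b t - (k' - k) * g' k b t)
        (e / 3 / B * nc (k' - k)).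
  by apply: dg => //; rewrite divr_gt0.
have [d2 d20 H2] : exists2 d : R, 0 < d & forall k', Om k' -> nc (k' - k) < d ->
    bnd (fun b t => g k' b t - g k b t) (Num.min 1 (e / 3 / B1)).
  by apply: hg => //; rewrite lt_min ltr01 divr_gt0.
exists (Num.min d (Num.min d1 d2)); first by rewrite !lt_min d0 d10.
move=> k' Ok'; rewrite !lt_min => /and3P[/(H _ Ok') h /(H1 _ Ok') h1 /(H2 _ Ok') h2].
have hg1 : bnd (g k') (B' + 1).
  have h3 : bnd (fun b t => g k' b t - g k b t) 1.
    by apply: bndW h2; rewrite ge_min lexx.
  by rewrite addrC; apply: eq_bnd (bndD h3 hB') => b t _; rewrite subrK.
have h2' : bnd (fun b t => g k' b t - g k b t) (e / 3 / B1).
  by apply: bndW h2; rewrite ge_min lexx orbT.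
have := bndD (bndD (bndM h hg1) (bndM hB h1)) (bndZ (k' - k) (bndM hB1 h2')).
rewrite [e / 3 / (B' + 1) * _ * _]mulrAC divfK ?gt_eqF ?addr_gt0//.
have -> : B * (e / 3 / B * nc (k' - k)) = e / 3 * nc (k' - k).
  by rewrite mulrA [B * _]mulrC divfK// gt_eqF.
have -> : nc (k' - k) * (B1 * (e / 3 / B1)) = e / 3 * nc (k' - k).
  by rewrite mulrC [B1 * _]mulrC divfK// gt_eqF.
have -> : e / 3 * nc (k' - k) + e / 3 * nc (k' - k) + e / 3 * nc (k' - k) =
    e * nc (k' - k) by field.
by apply: eq_bnd => b t _ /=; ring.
Qed.

Lemma smoothD n w f g : smooth n w f -> smooth n w g ->
  smooth n w (fun k b t => f k b t + g k b t).
Proof.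
elim: n w f g => [|n IH] w f g [f1 f2 [C C0 f3] f4] [g1 g2 [C' C'0 g3] g4].
  split => //; first by move=> k Ok; apply: admD; [exact: f1|exact: g1].
    exact: fam_contD.
  exists (C + C'); first exact: addr_ge0.
  by move=> k Ok; rewrite mulrDl; apply: bndD; [exact: f3|exact: g3].
split; first by move=> k Ok; apply: admD; [exact: f1|exact: g1].
- exact: fam_contD.
- exists (C + C'); first exact: addr_ge0.
  by move=> k Ok; rewrite mulrDl; apply: bndD; [exact: f3|exact: g3].
- have [f' df sf] := f4; have [g' dg sg] := g4.
  exists (fun k b t => f' k b t + g' k b t); first exact: fam_derD.
  exact: IH.
Qed.

Lemma fam_boundedM w w' f g : fam_bounded w f -> fam_bounded w' g ->
  fam_bounded (fun k => w k * w' k) (fun k b t => f k b t * g k b t).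
Proof.
move=> [C C0 f3] [C' C'0 g3]; exists (C * C'); first exact: mulr_ge0.
move=> k Ok; rewrite mulrACA; apply: bndM; [exact: f3|exact: g3].
Qed.

Lemma smoothM n w w' f g : smooth n w f -> smooth n w' g ->
  smooth n (fun k => w k * w' k) (fun k b t => f k b t * g k b t).
Proof.
elim: n w w' f g => [|n IH] w w' f g sf sg; have [f1 f2 f3] := smoothE sf;
  have [g1 g2 g3] := smoothE sg.
  split => //; first by move=> k Ok; apply: admM; [exact: f1|exact: g1].
    exact: (fam_contM f2 g2 f3 g3).
  exact: fam_boundedM.
split; first by move=> k Ok; apply: admM; [exact: f1|exact: g1].
- exact: (fam_contM f2 g2 f3 g3).
- exact: fam_boundedM.
- move: (sf) (sg) => [_ _ _ [f' df sf']] [_ _ _ [g' dg sg']].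
  have [_ _ f3'] := smoothE sf'; have [_ _ g3'] := smoothE sg'.
  exists (fun k b t => f' k b t * g k b t + f k b t * g' k b t).
    exact: (fam_derM df dg g2 f3 f3' g3).
  apply: smoothD.
    apply: (smoothW ler01 _ (IH _ _ _ _ sf' (smooth_pred sg))) => k Ok.
    by rewrite mul1r mulrAC.
  apply: (smoothW ler01 _ (IH _ _ _ _ (smooth_pred sf) sg')) => k Ok.
  by rewrite mul1r mulrA.
Qed.

Lemma smooth0 n w : (forall k, Om k -> 0 <= w k) -> smooth n w (fun _ _ _ => 0).
Proof.
elim: n w => [|n IH] w w0; split => //.
- by move=> k Ok e e0; exists 1 => // k' _ _ b t _; rewrite subrr nc0 ltW.
- by exists 0 => // k _ b t _; rewrite nc0 mul0r.
- by move=> k Ok e e0; exists 1 => // k' _ _ b t _; rewrite subrr nc0 ltW.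
- by exists 0 => // k _ b t _; rewrite nc0 mul0r.
- exists (fun _ _ _ => 0); last by apply: IH => k Ok; rewrite mulr_ge0// ?w0 ?rho_ge0.
  move=> k Ok e e0; exists 1 => // k' _ _ b t _.
  by rewrite mulr0 subrr subr0 nc0 mulr_ge0 ?nc_ge0// ltW.
Qed.

Lemma smooth_cst n w (Y : bool -> R -> R[i]) (c : R) : adm Y -> bnd Y c ->
  (forall k, Om k -> 1 <= w k) -> smooth n w (fun=> Y).
Proof.
move=> aY bY w1; have c0 := bnd_ge0 bY.
have h0 : fam_cont (fun=> Y).
  move=> k Ok e e0; exists 1 => // k' _ _ b t _; rewrite subrr nc0; exact: ltW.
have h1 : fam_bounded w (fun=> Y).
  by exists c => // k Ok; apply: bndW bY; rewrite ler_peMr// w1.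
case: n => [|n]; split => //; exists (fun _ _ _ => 0).
  move=> k Ok e e0; exists 1 => // k' _ _ b t _.
  by rewrite mulr0 subrr subr0 nc0 mulr_ge0 ?nc_ge0// ltW.
apply: smooth0 => k Ok; rewrite mulr_ge0 ?rho_ge0//.
by rewrite (le_trans ler01)// w1.
Qed.

Lemma smoothZ n w (a : R[i]) f : smooth n w f ->
  smooth n w (fun k b t => a * f k b t).
Proof.
move=> sf; have sa : smooth n (fun=> 1) (fun _ _ _ => a).
  apply: (@smooth_cst _ _ _ (nc a)) => //; exact: (adm_cst (fun=> a)).
by apply: (smoothW ler01 _ (smoothM sa sf)) => k Ok.
Qed.

Lemma smoothN n w f : smooth n w f -> smooth n w (fun k b t => - f k b t).
Proof.
move=> /(smoothZ (-1)); apply: eq_smooth => k b t _ _; exact: mulN1r.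
Qed.

Lemma smooth_sum n w (I : Type) (r : seq I) (F : I -> R[i] -> bool -> R -> R[i]) :
  (forall k, Om k -> 0 <= w k) -> (forall i, smooth n w (F i)) ->
  smooth n w (fun k b t => \sum_(i <- r) F i k b t).
Proof.
move=> w0 h; elim: r => [|i r IH].
  by apply: eq_smooth (smooth0 n w0) => k b t _ _; rewrite big_nil.
by apply: eq_smooth (smoothD (h i) IH) => k b t _ _; rewrite big_cons.
Qed.

Lemma smoothX n w f j : smooth n w f -> smooth n (fun k => w k ^+ j) (fun k b t => f k b t ^+ j).
Proof.
move=> sf; elim: j => [|j IH].
  apply: (@eq_smooth n _ (fun _ _ _ => 1)) => [k b t _ _|]; first by rewrite expr0.
  apply: (@smooth_cst n (fun k => w k ^+ 0) (fun _ _ => 1) 1) => [|b t _|k _].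
  - exact: (adm_cst (fun=> 1)).
  - by rewrite nc1.
  - by rewrite expr0.
apply: (smoothW ler01 _ (_ : smooth n (fun k => w k * w k ^+ j) _)).
  by move=> k _; rewrite mul1r exprS.
by apply: eq_smooth (smoothM sf IH) => k b t _ _; rewrite exprS.
Qed.

End SmoothFamilies.

(** * Volterra operators with an exponential kernel *)

Section Majorants.
Variable R : realType.
Notation mu := (@lebesgue_measure R).

(** A quantitative form of dominated convergence: differences of exponentials
    are bounded by the factors [min 1 (x (1 + s))], which tend to 0 with [x]
    but not uniformly in [s]. Cutting the integral at a large [L] gives a
    modulus that depends only on [G]. *)
Lemma small_majorant (G : R -> R) : inth G -> (forall s, 0 <= s -> 0 <= G s) ->
  forall e : R, 0 < e -> exists2 d : R, 0 < d & forall x, 0 <= x -> x <= d ->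
  exists H : R -> R, [/\ inth H,
    forall s, 0 <= s -> G s * Num.min 1 (x * (1 + s)) <= H s,
    forall s, 0 <= s -> 0 <= H s &
    \int[mu]_(s in `[0, +oo[) H s <= e].
Proof.
move=> iG G0 e e0; have e2 : 0 < e / 2 by rewrite divr_gt0.
have [L L0 hL] := tail_cvg0 G0 iG e2.
pose I := \int[mu]_(s in `[0, +oo[) G s.
have I0 : 0 <= I by apply: Rintegral_ge0 => s /=; rewrite in_itv /= andbT; exact: G0.
have LI : 0 < (1 + L) * (I + 1) by apply: mulr_gt0; lra.
exists (e / 2 / ((1 + L) * (I + 1))); first by rewrite divr_gt0.
move=> x x0 xd; pose GL := G \_ `[L, +oo[.
have iGL : inth GL.
  have : mu.-integrable `[(0:R), +oo[ ((EFin \o G) \_ `[L, +oo[).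
    apply/integrable_restrict => //; apply: integrableS iG => //.
    exact: measurableI.
  by rewrite restrict_EFin.
have GL0 s : 0 <= s -> 0 <= GL s.
  by move=> s0; rewrite /GL patchE; case: ifP => // _; exact: G0.
exists (fun s => x * (1 + L) * G s + GL s); split.
- by apply: inthD => //; exact: inthZ.
- move=> s s0; rewrite /GL patchE.
  case: ifPn => [_|].
    rewrite -[leLHS]add0r lerD//; first by rewrite !mulr_ge0 ?G0// addr_ge0.
    by rewrite -[leRHS]mulr1 ler_wpM2l ?G0// ge_min lexx.
  rewrite notin_setE /= in_itv /= andbT => /negP; rewrite -ltNge => sL.
  rewrite addr0 mulrC ler_wpM2r ?G0// ge_min; apply/orP; right.
  by rewrite ler_wpM2l// lerD2l ltW.
- by move=> s s0; rewrite addr_ge0 ?GL0// !mulr_ge0 ?G0// addr_ge0.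
- rewrite RintegralD//; last exact: integrableRZ.
  rewrite RintegralZl// [e]splitr lerD//.
    rewrite -/I; apply: (@le_trans _ _ (x * ((1 + L) * (I + 1)))).
      by rewrite -mulrA ler_wpM2l// ler_wpM2l ?addr_ge0// lerDl.
    by rewrite -ler_pdivlMr.
  rewrite /GL -Rintegral_mkcondr.
  have -> : `[(0:R), +oo[ `&` `[L, +oo[ = `[L, +oo[%classic.
    by apply/seteqP; split=> [s []//|s sL]; split => //; exact: sub_tail sL.
  exact: hL.
Qed.

End Majorants.

Section VolterraOperator.
Variable R : realType.
Notation mu := (@lebesgue_measure R).
Implicit Types (k : R[i]) (Y Z : bool -> R -> R[i]) (phi : bool -> bool -> R -> R).

(** Row [true] belongs to the first entry of the column of [T], which carries
    the oscillating exponential; row [false] belongs to the second entry,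
    which carries none. *)
Definition theta (b : bool) k : R[i] := if b then 8 * 'i%C * k ^+ 3 else 0.
Definition dtheta (b : bool) k : R[i] := if b then 24 * 'i%C * k ^+ 2 else 0.

Definition src phi Y (b : bool) (s : R) : R[i] :=
  (phi b true s)%:C * Y true s + (phi b false s)%:C * Y false s.

Definition total phi (s : R) : R :=
  `|phi true true s| + `|phi true false s| + (`|phi false true s| + `|phi false false s|).

Definition weighted_L1 (N : nat) phi :=
  forall b b', conth (phi b b') /\ inth (fun s => (1 + s) ^+ N * phi b b' s).

Definition genop (K : bool -> R -> R[i]) phi Y b (t : R) : R[i] :=
  integralC `[t, +oo[ (fun s => K b (s - t) * src phi Y b s).

(** The powers of [tau] are those produced by [j] differentiations of the
    exponential in [k]. *)
Definition expker (j : nat) k (b : bool) (tau : R) : R[i] :=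
  (tau ^+ j)%:C * cexp (theta b k * tau%:C).

Definition opM j phi k Y := genop (expker j k) phi Y.

Lemma total_ge0 phi s : 0 <= total phi s.
Proof. by rewrite /total !addr_ge0. Qed.

Lemma total_cont N phi : weighted_L1 N phi -> conth (total phi).
Proof.
move=> h; have c b b' : conth (fun s => `|phi b b' s|).
  by apply: conth_norm; have [] := h b b'.
by rewrite /total; do ! apply: conthD.
Qed.

Lemma total_inth N phi j : weighted_L1 N phi -> (j <= N)%N ->
  inth (fun s => (1 + s) ^+ j * total phi s).
Proof.
move=> h jN.
have i b b' : inth (fun s => (1 + s) ^+ j * `|phi b b' s|).
  have [c i] := h b b'; have := integrable_norm i.
  apply: le_integrable => //.
    apply/measurable_EFinP; apply: conth_measurable.
    apply: conthM; last exact: conth_norm.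
    by apply: conth_exp; apply: conthD; [exact: conth_cst|exact: conth_id].
  move=> s; rewrite /= in_itv /= andbT => s0.
  rewrite lee_fin !normrM !normr_id ler_wpM2r//.
  have s1 : 0 <= 1 + s by rewrite addr_ge0.
  rewrite !ger0_norm ?exprn_ge0// ler_weXn2l// lerDl//.
have -> : (fun s => (1 + s) ^+ j * total phi s) = (fun s =>
  ((1 + s) ^+ j * `|phi true true s| + (1 + s) ^+ j * `|phi true false s|) +
  ((1 + s) ^+ j * `|phi false true s| + (1 + s) ^+ j * `|phi false false s|)).
  by apply/funext => s; rewrite /total !mulrDr.
by apply: inthD; apply: inthD; exact: i.
Qed.

Lemma nc_src phi Y b s c : bnd Y c -> 0 <= s -> nc (src phi Y b s) <= total phi s * c.
Proof.
move=> hY s0; have c0 := bnd_ge0 hY.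
have h1 := hY true _ s0; have h2 := hY false _ s0.
rewrite (le_trans (ncD _ _))// !ncM !nc_real.
apply: (@le_trans _ _ ((`|phi b true s| + `|phi b false s|) * c)).
  by rewrite mulrDl lerD// ler_wpM2l.
rewrite ler_wpM2r// /total; case: b; first by rewrite lerDl addr_ge0.
by rewrite lerDr addr_ge0.
Qed.

Lemma src_meas N phi Y b : weighted_L1 N phi -> adm Y ->
  cmeas `[(0 : R), +oo[ (src phi Y b).
Proof.
move=> h aY.
have m b' : cmeas `[(0 : R), +oo[ (fun s => (phi b b' s)%:C).
  by apply: cmeas_real; apply: conth_measurable; exact: (h b b').1.
by apply: cmeasD; apply: cmeasM; [exact: m|exact: aY|exact: m|exact: aY].
Qed.

(** Abstract convolution kernels: differences and difference quotients of the
    exponential kernel in the parameter are treated by the same bound as the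
    kernel. *)
Definition kercont (K : bool -> R -> R[i]) :=
  forall b t, 0 <= t -> cconth (fun s => K b (s - t)).

Section Bound.
Variables (N : nat) (phi : bool -> bool -> R -> R) (hphi : weighted_L1 N phi).
Variables (K : bool -> R -> R[i]) (cK : kercont K).
Variables (H : R -> R) (iH : inth H).
Hypothesis KH : forall b t s, 0 <= t -> t <= s ->
  nc (K b (s - t)) * total phi s <= H s.

Lemma genop_majorant Y c b t s : bnd Y c -> 0 <= t -> t <= s ->
  nc (K b (s - t) * src phi Y b s) <= c * H s.
Proof.
move=> hY t0 ts; have c0 := bnd_ge0 hY; rewrite ncM.
apply: (@le_trans _ _ (nc (K b (s - t)) * (total phi s * c))).
  by rewrite ler_wpM2l ?nc_ge0 ?nc_src// (le_trans t0).
by rewrite mulrA mulrC ler_wpM2l// KH.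
Qed.

Lemma genop_integrable Y c b t : adm Y -> bnd Y c -> 0 <= t ->
  integrableC `[t, +oo[ (fun s => K b (s - t) * src phi Y b s).
Proof.
move=> aY hY t0; apply: (@integrableC_le _ _ _ (fun s => c * H s)) => //.
- apply: cmeasM; apply: (@cmeasS _ _ `[(0 : R), +oo[) => //; try exact: sub_tail.
    by apply: cconth_cmeas; exact: cK.
  exact: src_meas.
- by apply: inth_tail => //; exact: inthZ.
- by move=> s /=; rewrite in_itv /= andbT => ts; exact: genop_majorant.
Qed.

Lemma genop_bnd Y c : adm Y -> bnd Y c -> (forall s, 0 <= s -> 0 <= H s) ->
  bnd (genop K phi Y) (\int[mu]_(s in `[0, +oo[) H s * c).
Proof.
move=> aY hY H0 b t t0; have c0 := bnd_ge0 hY.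
have iHc : inth (fun s => c * H s) by exact: inthZ.
apply: (@le_trans _ _ (\int[mu]_(s in `[t, +oo[) (c * H s))).
  apply: nc_integralC_le => //; first exact: (genop_integrable _ aY hY).
    exact: inth_tail.
  by move=> s /=; rewrite in_itv /= andbT => ts; exact: genop_majorant.
rewrite (le_trans (le_tail _ _ _))//; last by rewrite RintegralZl// mulrC.
by move=> s s0; rewrite mulr_ge0 ?H0.
Qed.

End Bound.

Lemma kercont_expker j k : kercont (expker j k).
Proof.
move=> b t t0; apply: cconthM; last exact: cconth_cexp_lin.
apply: cconth_real; apply: conth_exp.
by apply: conthD; [exact: conth_id|exact: conth_cst].
Qed.

Lemma Re_theta_le0 b k (tau : R) : complex.Re (theta true k) <= 0 -> 0 <= tau ->
  complex.Re (theta b k * tau%:C) <= 0.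
Proof.
move=> h t0; rewrite ReM /= mulr0 subr0; case: b; first by rewrite mulr_le0_ge0.
by rewrite /= mul0r.
Qed.

Lemma expker_majorant j k phi b t s : complex.Re (theta true k) <= 0 ->
  0 <= t -> t <= s ->
  nc (expker j k b (s - t)) * total phi s <= (1 + s) ^+ j * total phi s.
Proof.
move=> hk t0 ts; rewrite ler_wpM2r ?total_ge0//.
have st : 0 <= s - t by rewrite subr_ge0.
rewrite /expker ncM nc_real ger0_norm ?exprn_ge0// -[leRHS]mulr1 ler_pM ?nc_ge0 ?exprn_ge0//.
  by rewrite lerXn2r ?nnegrE//; lra.
by apply: nc_cexp_le1; exact: Re_theta_le0.
Qed.

Section OpM.
Variables (N : nat) (phi : bool -> bool -> R -> R) (hphi : weighted_L1 N phi).
Variables (j : nat) (jN : (j <= N)%N).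
Let I := \int[mu]_(s in `[0, +oo[) ((1 + s) ^+ j * total phi s).

Lemma opM_integrable k Y c b t : complex.Re (theta true k) <= 0 ->
  adm Y -> bnd Y c -> 0 <= t ->
  integrableC `[t, +oo[ (fun s => expker j k b (s - t) * src phi Y b s).
Proof.
move=> hk aY hY t0; apply: (genop_integrable hphi (@kercont_expker j k)
  (total_inth hphi jN)) => //; last exact: hY.
by move=> b' t' s' t'0 ts; exact: expker_majorant.
Qed.

Lemma opM_bnd k Y c : complex.Re (theta true k) <= 0 -> adm Y -> bnd Y c ->
  bnd (opM j phi k Y) (I * c).
Proof.
move=> hk aY hY; apply: (genop_bnd hphi (@kercont_expker j k)
  (total_inth hphi jN)) => //.
  by move=> b' t' s' t'0 ts; exact: expker_majorant.
by move=> s s0; rewrite mulr_ge0 ?total_ge0// exprn_ge0// addr_ge0.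
Qed.

Lemma opMD k Y Z c c' b t : complex.Re (theta true k) <= 0 -> 0 <= t ->
  adm Y -> bnd Y c -> adm Z -> bnd Z c' ->
  opM j phi k (fun b t => Y b t + Z b t) b t =
  opM j phi k Y b t + opM j phi k Z b t.
Proof.
move=> hk t0 aY hY aZ hZ; rewrite /opM /genop -integralCD//.
- by apply: eq_integralC => s _; rewrite /src; ring.
- exact: (opM_integrable _ hk aY hY).
- exact: (opM_integrable _ hk aZ hZ).
Qed.

Lemma opMZ k (a : R[i]) Y c b t : complex.Re (theta true k) <= 0 -> 0 <= t ->
  adm Y -> bnd Y c ->
  opM j phi k (fun b t => a * Y b t) b t = a * opM j phi k Y b t.
Proof.
move=> hk t0 aY hY; rewrite /opM /genop -integralCZ//.
- by apply: eq_integralC => s _; rewrite /src; ring.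
- exact: (opM_integrable _ hk aY hY).
Qed.

Lemma opMB k Y Z c c' b t : complex.Re (theta true k) <= 0 -> 0 <= t ->
  adm Y -> bnd Y c -> adm Z -> bnd Z c' ->
  opM j phi k (fun b t => Y b t - Z b t) b t =
  opM j phi k Y b t - opM j phi k Z b t.
Proof.
move=> hk t0 aY hY aZ hZ.
rewrite -[- opM j phi k Z b t]mulN1r -(opMZ (-1) b hk t0 aZ hZ).
rewrite -(opMD b hk t0 aY hY (admZ (-1) aZ) (bndZ (-1) hZ)).
apply: eq_integralC => s _; rewrite /src; ring.
Qed.

(** Expanding [(s - t) ^ j] and factoring out [exp (- theta t)] expresses the
    operator through tail integrals, which are continuous. *)
Lemma opM_cconth k Y c b : complex.Re (theta true k) <= 0 -> adm Y -> bnd Y c ->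
  cconth (opM j phi k Y b).
Proof.
move=> hk aY hY.
pose F (i : 'I_j.+1) (s : R) : R[i] :=
  (s ^+ (j - i))%:C * cexp (theta b k * s%:C) * src phi Y b s.
have iF i : integrableC `[(0 : R), +oo[ (F i).
  have ji : (j - i <= N)%N by rewrite (leq_trans (leq_subr _ _)).
  have := genop_integrable hphi (@kercont_expker (j - i) k) (total_inth hphi ji)
    (fun b t s => @expker_majorant (j - i) k phi b t s hk) b aY hY (lexx 0).
  by apply: eq_integrableC => // s _; rewrite /expker subr0.
pose G t := \sum_(i < j.+1) (cexp (- theta b k * (t - 0)%:C) *
    (((- t) ^+ i *+ 'C(j, i))%:C * integralC `[t, +oo[ (F i))).
apply: (@eq_cconth _ G) => [t t0|].
  rewrite /G /opM /genop.
  transitivity (integralC `[t, +oo[ (fun s => \sum_(i < j.+1)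
      (cexp (- theta b k * (t - 0)%:C) * ((- t) ^+ i *+ 'C(j, i))%:C) * F i s)).
    rewrite integralC_sum//.
      apply: eq_bigr => i _; rewrite integralCZ ?mulrA//.
      by apply: integrableCS (iF i) => //; exact: sub_tail.
    move=> i; apply: integrableCZ => //.
    by apply: integrableCS (iF i) => //; exact: sub_tail.
  apply: eq_integralC => s _; rewrite /expker exprDn rmorph_sum /=.
  rewrite -mulrA mulr_suml; apply: eq_bigr => i _.
  have -> : theta b k * (s - t)%:C = - theta b k * (t - 0)%:C + theta b k * s%:C.
    by rewrite subr0 rmorphB /=; ring.
  rewrite cexpD /F -mulrnAr rmorphM /=; ring.
apply: cconth_sum => i _; apply: cconthM; first exact: cconth_cexp_lin.
apply: cconthM; last exact: cconth_ctail.
apply: cconth_real; under eq_fun do rewrite -mulr_natr; apply: conthM.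
  by apply: conth_exp; apply: conthN; exact: conth_id.
exact: conth_cst.
Qed.

Lemma opM_adm k Y c : complex.Re (theta true k) <= 0 -> adm Y -> bnd Y c ->
  adm (opM j phi k Y).
Proof. by move=> hk aY hY b; apply: cconth_cmeas; exact: (opM_cconth _ hk aY hY). Qed.

End OpM.

End VolterraOperator.

Section OperatorDerivative.
Variable R : realType.
Notation mu := (@lebesgue_measure R).
Implicit Types (k : R[i]) (Y Z : bool -> R -> R[i]).

Lemma nc_nat (n : nat) : nc (n%:R : R[i]) = n%:R.
Proof. by rewrite -(rmorph_nat (real_complex R)) nc_real ger0_norm. Qed.

Lemma nc_i : nc ('i%C : R[i]) = 1.
Proof. by rewrite nc_def /= expr0n expr1n add0r sqrtr1. Qed.

Lemma theta_lipschitz k : exists2 C : R, 0 < C & forall b k', nc (k' - k) <= 1 ->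
  nc (theta b k' - theta b k) <= C * nc (k' - k).
Proof.
exists (8 * (1 + 3 * nc k + 3 * nc k ^+ 2)).
  by rewrite mulr_gt0// !ltr_pwDl// ?mulr_ge0 ?exprn_ge0 ?nc_ge0.
move=> [] k' h1; rewrite /theta; last first.
  by rewrite subrr nc0 !mulr_ge0 ?nc_ge0// !addr_ge0// ?mulr_ge0 ?exprn_ge0 ?nc_ge0.
have -> : 8 * 'i%C * k' ^+ 3 - 8 * 'i%C * k ^+ 3 =
   8 * 'i%C * (k' - k) * ((k' - k) ^+ 2 + 3 * k * (k' - k) + 3 * k ^+ 2) by ring.
rewrite !ncM nc_nat nc_i mulr1 -!mulrA ler_pM2l// [leRHS]mulrC ler_wpM2l ?nc_ge0//.
rewrite (le_trans (ncD _ _))// [nc (3 * k ^+ 2)]ncM nc_nat ncX lerD2r.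
rewrite (le_trans (ncD _ _))// ncX 2!ncM nc_nat lerD//.
  by rewrite exprn_ile1// nc_ge0.
by rewrite ler_pM2l// ler_piMr// nc_ge0.
Qed.

Lemma theta_derivative k : exists2 C : R, 0 < C & forall b k', nc (k' - k) <= 1 ->
  nc (theta b k' - theta b k - (k' - k) * dtheta b k) <= C * nc (k' - k) ^+ 2.
Proof.
exists (8 * (1 + 3 * nc k)).
  by rewrite mulr_gt0// !ltr_pwDl// ?mulr_ge0 ?nc_ge0.
move=> [] k' h1; rewrite /theta /dtheta; last first.
  by rewrite mulr0 subr0 subrr nc0 !mulr_ge0 ?exprn_ge0 ?nc_ge0// addr_ge0// mulr_ge0// nc_ge0.
have -> : 8 * 'i%C * k' ^+ 3 - 8 * 'i%C * k ^+ 3 - (k' - k) * (24 * 'i%C * k ^+ 2) =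
   8 * 'i%C * (k' - k) ^+ 2 * ((k' - k) + 3 * k) by ring.
rewrite 2!ncM ncX ncM nc_nat nc_i mulr1 -[leLHS]mulrA -[leRHS]mulrA.
rewrite ler_pM2l// [leRHS]mulrC.
rewrite ler_wpM2l ?exprn_ge0 ?nc_ge0//.
by rewrite (le_trans (ncD _ _))// ncM nc_nat lerD2r.
Qed.

Lemma genopB N phi K K' Hm Hm' Y c b t : weighted_L1 N phi ->
  kercont K -> kercont K' -> inth Hm -> inth Hm' ->
  (forall b t s, 0 <= t -> t <= s -> nc (K b (s - t)) * total phi s <= Hm s) ->
  (forall b t s, 0 <= t -> t <= s -> nc (K' b (s - t)) * total phi s <= Hm' s) ->
  adm Y -> bnd Y c -> 0 <= t ->
  genop (fun b tau => K b tau - K' b tau) phi Y b t =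
  genop K phi Y b t - genop K' phi Y b t.
Proof.
move=> hp cK cK' iH iH' KH KH' aY hY t0; rewrite /genop -integralCB//.
- by apply: eq_integralC => s _; rewrite mulrBl.
- exact: (genop_integrable hp cK iH KH b aY hY t0).
- exact: (genop_integrable hp cK' iH' KH' b aY hY t0).
Qed.

Section Estimates.
Variables (N : nat) (phi : bool -> bool -> R -> R) (hphi : weighted_L1 N phi).

(** The modulus of continuity does not depend on [Y]: this is continuity in
    operator norm, and is what makes estimates uniform in [t]. *)
Lemma opM_continuous j k : (j <= N)%N -> complex.Re (theta true k) <= 0 ->
  forall e : R, 0 < e -> exists2 d : R, 0 < d & forall k',
    complex.Re (theta true k') <= 0 -> nc (k' - k) < d -> forall Y c,
    adm Y -> bnd Y c ->
    bnd (fun b t => opM j phi k' Y b t - opM j phi k Y b t) (e * c).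
Proof.
move=> jN hk e e0; have [C C0 hC] := theta_lipschitz k.
have e2 : 0 < e / 2 by rewrite divr_gt0.
have [d d0 hd] := small_majorant (total_inth hphi jN)
  (fun s s0 => mulr_ge0 (exprn_ge0 j (addr_ge0 ler01 s0)) (total_ge0 phi s)) e2.
exists (Num.min 1 (d / C)); first by rewrite lt_min ltr01 divr_gt0.
move=> k' hk'; rewrite lt_min => /andP[k1 kd] Y c aY hY.
have c0 := bnd_ge0 hY.
have [||H [iH GH H0 He]] := hd (C * nc (k' - k)).
- by rewrite mulr_ge0 ?nc_ge0// ltW.
- by rewrite mulrC -ler_pdivlMr// ltW.
have KH b (t s : R) : 0 <= t -> t <= s ->
    nc (expker j k' b (s - t) - expker j k b (s - t)) * total phi s <= 2 * H s.
  move=> t0 ts; have st : 0 <= s - t by rewrite subr_ge0.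
  have s0 : 0 <= s := le_trans t0 ts.
  apply: (@le_trans _ _ (2 * ((1 + s) ^+ j * total phi s *
      Num.min 1 (C * nc (k' - k) * (1 + s))))); last by rewrite ler_pM2l// GH.
  rewrite /expker -mulrBr ncM nc_real ger0_norm ?exprn_ge0//.
  set mn := Num.min _ _.
  have -> : 2 * ((1 + s) ^+ j * total phi s * mn) =
      (1 + s) ^+ j * (2 * mn) * total phi s by ring.
  rewrite ler_wpM2r ?total_ge0// ler_pM ?exprn_ge0 ?nc_ge0//.
    by rewrite lerXn2r// ?nnegrE; lra.
  apply: le_trans (cexp_lipschitz _ _) _; try exact: Re_theta_le0.
  rewrite ler_pM2l// le_min !ge_min lexx /=; apply/orP; right.
  rewrite -mulrBl ncM nc_real ger0_norm// ler_pM ?nc_ge0//.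
    by apply: hC; exact: ltW.
  lra.
have cB : kercont (fun b tau => expker j k' b tau - expker j k b tau).
  move=> b t t0; apply: cconthD; first exact: kercont_expker.
  by apply: cconthN; exact: kercont_expker.
have iH2 : inth (fun s => 2 * H s) by exact: inthZ.
have H20 (s : R) : 0 <= s -> 0 <= 2 * H s by move=> s0; rewrite mulr_ge0 ?H0.
have := genop_bnd hphi cB iH2 KH aY hY H20.
rewrite RintegralZl// => hb.
have : bnd (genop (fun b tau => expker j k' b tau - expker j k b tau) phi Y) (e * c).
  by apply: bndW hb; rewrite ler_wpM2r// mulrC -ler_pdivlMr.
apply: eq_bnd => b t t0.
apply: (genopB b hphi (@kercont_expker _ j k') (@kercont_expker _ j k)
  (total_inth hphi jN) (total_inth hphi jN) _ _ aY hY t0).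
- by move=> ? ? ? ? ?; exact: expker_majorant.
- by move=> ? ? ? ? ?; exact: expker_majorant.
Qed.

(** Differentiability in operator norm; the extra power of [s - t] in [opM
    j.+1] comes from the exponent. *)
Lemma opM_derivative j k : (j < N)%N -> complex.Re (theta true k) <= 0 ->
  forall e : R, 0 < e -> exists2 d : R, 0 < d & forall k',
    complex.Re (theta true k') <= 0 -> nc (k' - k) < d -> forall Y c,
    adm Y -> bnd Y c ->
    bnd (fun b t => opM j phi k' Y b t - opM j phi k Y b t -
      (k' - k) * (dtheta b k * opM j.+1 phi k Y b t)) (e * c * nc (k' - k)).
Proof.
move=> jN hk e e0; have [C1 C10 hC1] := theta_lipschitz k.
have [C2 C20 hC2] := theta_derivative k.
pose G s := (1 + s) ^+ j.+1 * total phi s.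
have iG : inth G := total_inth hphi jN.
have G0 s : 0 <= s -> 0 <= G s.
  by move=> s0; rewrite mulr_ge0 ?total_ge0// exprn_ge0// addr_ge0.
pose I := \int[mu]_(s in `[0, +oo[) G s.
have I0 : 0 <= I by apply: Rintegral_ge0 => s /=; rewrite in_itv /= andbT; exact: G0.
have [d d0 hd] : exists2 d : R, 0 < d & forall x, 0 <= x -> x <= d ->
  exists H : R -> R, [/\ inth H,
    forall s, 0 <= s -> G s * Num.min 1 (x * (1 + s)) <= H s,
    forall s, 0 <= s -> 0 <= H s &
    \int[mu]_(s in `[0, +oo[) H s <= e / 2 / (6 * C1)].
  by apply: small_majorant => //; rewrite !divr_gt0// mulr_gt0.
pose d' := e / 2 / (C2 * (I + 1)).
have CI : 0 < C2 * (I + 1) by rewrite mulr_gt0// ltr_wpDl.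
have d'0 : 0 < d' by rewrite !divr_gt0.
exists (Num.min 1 (Num.min (d / C1) d')).
  by rewrite !lt_min ltr01 divr_gt0.
move=> k' hk'; rewrite !lt_min => /and3P[k1 kd kd'] Y c aY hY.
have c0 := bnd_ge0 hY.
set h := nc (k' - k); have h0 : 0 <= h := nc_ge0 _.
have [||H [iH GH H0 He]] := hd (C1 * h).
- by rewrite mulr_ge0// ltW.
- by rewrite mulrC -ler_pdivlMr// ltW.
pose D b tau := expker j k' b tau - expker j k b tau -
  (k' - k) * (dtheta b k * expker j.+1 k b tau).
have KH b (t s : R) : 0 <= t -> t <= s ->
    nc (D b (s - t)) * total phi s <= 6 * C1 * h * H s + C2 * h ^+ 2 * G s.
  move=> t0 ts; have st : 0 <= s - t by rewrite subr_ge0.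
  have s0 : 0 <= s := le_trans t0 ts.
  have s1 : s - t <= 1 + s by lra.
  set tau := s - t in st s1 *.
  set z := theta b k * tau%:C; set z' := theta b k' * tau%:C.
  have hz : complex.Re z <= 0 by exact: Re_theta_le0.
  have hz' : complex.Re z' <= 0 by exact: Re_theta_le0.
  (* second order Taylor remainders of the exponential and of its exponent *)
  have -> : D b tau = (tau ^+ j)%:C * ((cexp z' - cexp z - (z' - z) * cexp z) +
     (theta b k' - theta b k - (k' - k) * dtheta b k) * tau%:C * cexp z).
    rewrite /D /expker -/z -/z' exprS rmorphM /= /z' /z; ring.
  have zz : nc (z' - z) <= C1 * h * (1 + s).
    rewrite /z /z' -mulrBl ncM nc_real ger0_norm// ler_pM ?nc_ge0//.
    by apply: hC1; exact: ltW.
  have zz1 : nc (z' - z) <= C1 * h * tau.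
    rewrite /z /z' -mulrBl ncM nc_real ger0_norm// ler_wpM2r//.
    by apply: hC1; exact: ltW.
  rewrite ncM nc_real ger0_norm ?exprn_ge0//.
  have b1 : nc (cexp z' - cexp z - (z' - z) * cexp z) <=
      6 * C1 * h * (1 + s) * Num.min 1 (C1 * h * (1 + s)).
    apply: le_trans (cexp_taylor1 hz hz') _.
    rewrite -!mulrA ler_pM2l// !mulrA ler_pM ?nc_ge0//.
      by rewrite le_min ler01 nc_ge0.
    by rewrite le_min !ge_min lexx /=; apply/orP; right.
  have b2 : nc ((theta b k' - theta b k - (k' - k) * dtheta b k) * tau%:C * cexp z) <=
      C2 * h ^+ 2 * (1 + s).
    rewrite 2!ncM nc_real ger0_norm// -[leRHS]mulr1 ler_pM ?mulr_ge0 ?nc_ge0//.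
      by rewrite ler_pM ?nc_ge0//; apply: hC2; exact: ltW.
    exact: nc_cexp_le1.
  have b3 := le_trans (ncD _ _) (lerD b1 b2).
  apply: (@le_trans _ _ ((1 + s) ^+ j * (6 * C1 * h * (1 + s) *
      Num.min 1 (C1 * h * (1 + s)) + C2 * h ^+ 2 * (1 + s)) * total phi s)).
    rewrite ler_wpM2r ?total_ge0// ler_pM ?exprn_ge0 ?nc_ge0//.
    by rewrite lerXn2r ?nnegrE// addr_ge0.
  have -> : (1 + s) ^+ j * (6 * C1 * h * (1 + s) *
      Num.min 1 (C1 * h * (1 + s)) + C2 * h ^+ 2 * (1 + s)) * total phi s =
      6 * C1 * h * (G s * Num.min 1 (C1 * h * (1 + s))) + C2 * h ^+ 2 * G s.
    by rewrite /G [(1 + s) ^+ j.+1]exprS; ring.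
  by rewrite lerD2r ler_wpM2l ?GH// !mulr_ge0// ltW.
have cD : kercont D.
  move=> b t t0; apply: cconthD.
    by apply: cconthD; [|apply: cconthN]; exact: kercont_expker.
  apply: cconthN; apply: cconthM; first exact: cconth_cst.
  by apply: cconthM; [exact: cconth_cst|exact: kercont_expker].
have iM : inth (fun s => 6 * C1 * h * H s + C2 * h ^+ 2 * G s).
  exact: (inthD (inthZ (6 * C1 * h) iH) (inthZ (C2 * h ^+ 2) iG)).
have M0 s : 0 <= s -> 0 <= 6 * C1 * h * H s + C2 * h ^+ 2 * G s.
  have c1 : 0 <= 6 * C1 * h by rewrite !mulr_ge0// ltW.
  have c2 : 0 <= C2 * h ^+ 2 by rewrite mulr_ge0 ?sqr_ge0// ltW.
  by move=> s0; apply: addr_ge0; apply: mulr_ge0 => //; [exact: H0|exact: G0].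
have := genop_bnd hphi cD iM KH aY hY M0.
rewrite RintegralD//; [|exact: (integrableRZ _ _ iH)|exact: (integrableRZ _ _ iG)].
rewrite !RintegralZl// -/I => hb.
have : bnd (genop D phi Y) (e * c * h).
  have i1 : 6 * C1 * h * \int[mu]_(s in `[0, +oo[) H s <= e / 2 * h.
    rewrite mulrAC ler_wpM2r// mulrC -ler_pdivlMr//.
    by rewrite mulr_gt0.
  have i2 : C2 * h ^+ 2 * I <= e / 2 * h.
    apply: (@le_trans _ _ (h * (C2 * (I + 1)) * h)).
      have -> : C2 * h ^+ 2 * I = h * (C2 * I) * h by ring.
      by rewrite ler_wpM2r// ler_wpM2l// ler_pM2l// lerDl.
    by rewrite ler_wpM2r// -ler_pdivlMr// ltW.
  apply: bndW hb.
  have -> : e * c * h = (e / 2 * h + e / 2 * h) * c by field.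
  by rewrite ler_wpM2r// lerD.
apply: eq_bnd => b t t0.
rewrite /D (@genopB N phi (fun b tau => expker j k' b tau - expker j k b tau)
  (fun b tau => (k' - k) * (dtheta b k * expker j.+1 k b tau))
  (fun s => (1 + s) ^+ j * total phi s + (1 + s) ^+ j * total phi s)
  (fun s => (nc (k' - k) * (nc (dtheta true k) + nc (dtheta false k))) * G s) Y c)//.
- congr (_ - _).
    apply: (genopB b hphi (@kercont_expker _ j k') (@kercont_expker _ j k)
      (total_inth hphi (ltnW jN)) (total_inth hphi (ltnW jN)) _ _ aY hY t0).
    + by move=> ? ? ? ? ?; exact: expker_majorant.
    + by move=> ? ? ? ? ?; exact: expker_majorant.
  rewrite /opM /genop -integralCZ//; last first.
    by exact: (opM_integrable hphi jN b hk aY hY t0).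
  rewrite -integralCZ//; last first.
    apply: integrableCZ => //.
    by exact: (opM_integrable hphi jN b hk aY hY t0).
  by apply: eq_integralC => s _; rewrite !mulrA.
- by move=> b' t' t'0; apply: cconthD; [|apply: cconthN]; exact: kercont_expker.
- move=> b' t' t'0; apply: cconthM; first exact: cconth_cst.
  by apply: cconthM; [exact: cconth_cst|exact: kercont_expker].
- by apply: inthD; exact: (total_inth hphi (ltnW jN)).
- exact: inthZ.
- move=> b' t' s t'0 ts.
  apply: (@le_trans _ _ ((nc (expker j k' b' (s - t')) + nc (expker j k b' (s - t'))) * total phi s)).
    by rewrite ler_wpM2r ?total_ge0 ?ncB.
  by rewrite mulrDl lerD//; exact: expker_majorant.
- move=> b' t' s t'0 ts; rewrite ncM -mulrA -[leRHS]mulrA ler_wpM2l ?nc_ge0//.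
  rewrite ncM -mulrA ler_pM ?nc_ge0 ?mulr_ge0 ?nc_ge0 ?total_ge0//.
    by case: b'; rewrite ?lerDl ?lerDr nc_ge0.
  exact: expker_majorant.
Qed.

End Estimates.

Section SmoothOp.
Variables (N : nat) (phi : bool -> bool -> R -> R) (hphi : weighted_L1 N phi).
Variables (Om : set R[i]) (rho : R[i] -> R).
Hypothesis rho_ge0 : forall k, Om k -> 0 <= rho k.
Hypothesis Om_theta : forall k, Om k -> complex.Re (theta true k) <= 0.
Hypothesis dtheta_smooth : forall n,
  smooth Om rho n rho (fun k b _ => dtheta b k).

Lemma opM_fam_cont j w f : (j <= N)%N -> (forall k, Om k -> adm (f k)) ->
  fam_cont Om f -> fam_bounded Om w f ->
  fam_cont Om (fun k => opM j phi k (f k)).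
Proof.
move=> jN af cf bf k Ok e e0; have [B B0 hB] := fam_pbounded bf Ok.
set I := \int[mu]_(s in `[0, +oo[) ((1 + s) ^+ j * total phi s).
have I0 : 0 <= I.
  apply: Rintegral_ge0 => s /=; rewrite in_itv /= andbT => s0.
  by rewrite mulr_ge0 ?total_ge0// exprn_ge0// addr_ge0.
have B1 : 0 < B + 1 by rewrite addr_gt0.
have I1 : 0 < I + 1 by rewrite ltr_wpDl.
have [|d d0 hd] := opM_continuous hphi jN (Om_theta Ok) (_ : 0 < e / 2 / (B + 1)).
  by rewrite !divr_gt0.
have [|d' d'0 hd'] := cf _ Ok (Num.min 1 (e / 2 / (I + 1))).
  by rewrite lt_min ltr01 !divr_gt0.
exists (Num.min d d'); first by rewrite lt_min d0.
move=> k' Ok'; rewrite lt_min => /andP[kd /(hd' _ Ok') kd'].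
have h1 : bnd (fun b t => f k' b t - f k b t) 1.
  by apply: bndW kd'; rewrite ge_min lexx.
have h2 : bnd (fun b t => f k' b t - f k b t) (e / 2 / (I + 1)).
  by apply: bndW kd'; rewrite ge_min lexx orbT.
have h3 : bnd (f k') (B + 1).
  by rewrite addrC; apply: eq_bnd (bndD h1 hB) => b t _; rewrite subrK.
have g1 := hd _ (Om_theta Ok') kd _ _ (af _ Ok') h3.
have g2 := opM_bnd hphi jN (Om_theta Ok) (admB (af _ Ok') (af _ Ok)) h2.
rewrite divfK ?gt_eqF// in g1.
have g3 : bnd (opM j phi k (fun b t => f k' b t - f k b t)) (e / 2).
  apply: bndW g2; rewrite -/I mulrC mulrAC ler_pdivrMr// ler_wpM2l//.
    by rewrite ltW// divr_gt0.
  by rewrite lerDl.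
rewrite [e]splitr; apply: eq_bnd (bndD g1 g3) => b t t0.
rewrite (opMB hphi jN b (Om_theta Ok) t0 (af _ Ok') h3 (af _ Ok) hB).
exact: subrKA.
Qed.

Lemma opM_fam_der j w w' f f' : (j < N)%N -> (forall k, Om k -> adm (f k)) ->
  (forall k, Om k -> adm (f' k)) ->
  fam_der Om f f' -> fam_bounded Om w f -> fam_bounded Om w' f' ->
  fam_der Om (fun k => opM j phi k (f k))
    (fun k b t => dtheta b k * opM j.+1 phi k (f k) b t + opM j phi k (f' k) b t).
Proof.
move=> jN af af' df bf bf' k Ok e e0; have [B B0 hB] := fam_pbounded bf Ok.
have [B' B'0 hB'] := fam_pbounded bf' Ok; have jN' := ltnW jN.
set I := \int[mu]_(s in `[0, +oo[) ((1 + s) ^+ j * total phi s).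
have I0 : 0 <= I.
  apply: Rintegral_ge0 => s /=; rewrite in_itv /= andbT => s0.
  by rewrite mulr_ge0 ?total_ge0// exprn_ge0// addr_ge0.
have I1 : 0 < I + 1 by rewrite ltr_wpDl.
have e3 : 0 < e / 3 by rewrite divr_gt0.
have [|d d0 hd] := opM_derivative hphi jN (Om_theta Ok) (_ : 0 < e / 3 / B).
  by rewrite divr_gt0.
have [|d1 d10 hd1] := opM_continuous hphi jN' (Om_theta Ok) (_ : 0 < e / 3 / B').
  by rewrite divr_gt0.
have [|d2 d20 hd2] := df _ Ok (e / 3 / (I + 1)); first by rewrite divr_gt0.
exists (Num.min d (Num.min d1 d2)); first by rewrite !lt_min d0 d10.
move=> k' Ok'; rewrite !lt_min => /and3P[kd kd1 /(hd2 _ Ok') g2].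
have {hd}g := hd _ (Om_theta Ok') kd _ _ (af _ Ok) hB.
have {hd1}g1 := hd1 _ (Om_theta Ok') kd1 _ _ (af' _ Ok) hB'.
rewrite divfK ?gt_eqF// in g; rewrite divfK ?gt_eqF// in g1.
set h := nc (k' - k) in g g2 *.
have a2 : adm (fun b t => f k' b t - f k b t - (k' - k) * f' k b t).
  by apply: admB; [apply: admB; exact: af|apply: admZ; exact: af'].
have g3 : bnd (opM j phi k' (fun b t => f k' b t - f k b t - (k' - k) * f' k b t))
    (e / 3 * h).
  apply: bndW (opM_bnd hphi jN' (Om_theta Ok') a2 g2); rewrite -/I mulrA.
  rewrite ler_wpM2r ?nc_ge0// mulrC mulrAC ler_pdivrMr// ler_wpM2l ?ltW//.
  by rewrite ltrDl.
have := bndD (bndD g3 (bndZ (k' - k) g1)) g; rewrite -/h.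
have -> : e / 3 * h + h * (e / 3) + e / 3 * h = e * h by field.
have [B2 B20 hB2] : exists2 B2 : R, 0 < B2 & bnd (f k') B2.
  exists (B + (nc (k' - k) * B' + e / 3 / (I + 1) * h)).
    by rewrite ltr_pwDl// addr_ge0// mulr_ge0 ?nc_ge0 ?ltW// divr_gt0.
  apply: eq_bnd (bndD hB (bndD (bndZ (k' - k) hB') g2)) => b t _; ring.
apply: eq_bnd => b t t0.
have aZ := admZ (k' - k) (af' _ Ok); have bZ := bndZ (k' - k) hB'.
rewrite (opMB hphi jN' b (Om_theta Ok') t0 (admB (af _ Ok') (af _ Ok)) (bndB hB2 hB) aZ bZ).
rewrite (opMB hphi jN' b (Om_theta Ok') t0 (af _ Ok') hB2 (af _ Ok) hB).
rewrite (opMZ hphi jN' (k' - k) b (Om_theta Ok') t0 (af' _ Ok) hB').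
have E (x y1 y2 y3 y4 y5 y6 : R[i]) :
    y1 - y2 - x * y3 + x * (y3 - y4) + (y2 - y5 - x * y6) = y1 - y5 - x * (y6 + y4) by ring.
exact: E.
Qed.

(** Each differentiation of the kernel produces one more factor [s - t], which
    the weight [(1 + s) ^ N] absorbs up to order [N]. *)
Lemma smooth_opM n j w f : (j + n <= N)%N -> smooth Om rho n w f ->
  smooth Om rho n w (fun k => opM j phi k (f k)).
Proof.
elim: n j w f => [|n IH] j w f jn sf; have [f1 f2 f3] := smoothE sf;
  have jN : (j <= N)%N by rewrite (leq_trans _ jn)// leq_addr.
all: have A1 k : Om k -> adm (opM j phi k (f k)) by
  move=> Ok; have [B _ hB] := fam_pbounded f3 Ok;
  exact: (opM_adm hphi jN (Om_theta Ok) (f1 _ Ok) hB).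
all: have A2 := opM_fam_cont jN f1 f2 f3.
all: have A3 : fam_bounded Om w (fun k => opM j phi k (f k)) by
  have [C C0 hC] := f3;
  exists (\int[mu]_(s in `[0, +oo[) ((1 + s) ^+ j * total phi s) * C);
  [rewrite mulr_ge0//; apply: Rintegral_ge0 => s /=; rewrite in_itv /= andbT => s0;
   rewrite mulr_ge0 ?total_ge0// exprn_ge0// addr_ge0|
   move=> k Ok; rewrite -mulrA; exact: (opM_bnd hphi jN (Om_theta Ok) (f1 _ Ok) (hC _ Ok))].
  by split.
split => //; have [_ _ _ [f' df sf']] := sf; have [g1 g2 g3] := smoothE sf'.
have jN1 : (j < N)%N by rewrite (leq_trans _ jn)// -addn1 leq_add2l.
exists (fun k b t => dtheta b k * opM j.+1 phi k (f k) b t + opM j phi k (f' k) b t).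
  exact: (opM_fam_der jN1 f1 g1 df f3 g3).
apply: smoothD.
  have := smoothM rho_ge0 (dtheta_smooth n) (IH j.+1 w f _ (smooth_pred sf)).
  rewrite addSnnS => /(_ jn); apply: (smoothW rho_ge0 ler01) => k Ok.
  by rewrite mul1r mulrC.
by apply: IH => //; rewrite (leq_trans _ jn)// leq_add2l.
Qed.

End SmoothOp.

End OperatorDerivative.

(** * Volterra systems depending on a parameter *)

Section RealSequences.
Variable R : realType.

Lemma geometric_bound (u : nat -> R) (C : R) :
  (forall n, `|u n.+1 - u n| <= C / 2 ^+ n) ->
  forall n m, `|u (n + m)%N - u n| <= 2 * C / 2 ^+ n - C / 2 ^+ n * 2 / 2 ^+ m.
Proof.
move=> h n; elim=> [|m IH].
  by rewrite addn0 subrr normr0 expr0 divr1 -mulrA mulrC mulrAC subrr.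
have -> : u (n + m.+1)%N - u n = (u (n + m).+1 - u (n + m)%N) + (u (n + m)%N - u n).
  by rewrite addnS subrKA.
apply: (le_trans (ler_normD _ _)).
apply: (le_trans (lerD (h _) IH)).
rewrite exprD exprS.
have p2 (i : nat) : (2 : R) ^+ i != 0 by rewrite expf_neq0.
rewrite le_eqVlt; apply/orP; left; apply/eqP; field.
by rewrite !p2.
Qed.

(** Completeness of the reals with an explicit rate, by comparison with the
    nondecreasing sequence [u n - 2 C / 2 ^ n]. *)
Lemma geometric_limit (u : nat -> R) (C : R) :
  (forall n, `|u n.+1 - u n| <= C / 2 ^+ n) ->
  u @ \oo --> lim (u @ \oo) /\ forall n, `|lim (u @ \oo) - u n| <= 2 * C / 2 ^+ n.
Proof.
move=> h; have gb := geometric_bound h.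
have C0 : 0 <= C by have := h 0%N; rewrite expr0 divr1; exact: le_trans.
have h2 n m : `|u (n + m)%N - u n| <= 2 * C / 2 ^+ n.
  by apply: le_trans (gb n m) _; rewrite gerBl !mulr_ge0 ?invr_ge0 ?exprn_ge0.
have c2 : (fun n => 2 * C / 2 ^+ n : R) @ \oo --> (0 : R).
  have := @cvg_geometric R (2 * C) 2^-1.
  rewrite ger0_norm ?invr_ge0// invf_lt1// ltr1n => /(_ isT).
  by apply: cvg_trans; apply: near_eq_cvg; apply: nearW => n; rewrite /geometric /= exprVn.
pose v n := u n - 2 * C / 2 ^+ n.
have cv : cvgn v.
  apply: nondecreasing_is_cvgn.
    apply/nondecreasing_seqP => n; rewrite /v.
    have := h n; rewrite ler_norml => /andP[+ _].
    have -> : 2 * C / 2 ^+ n.+1 = C / 2 ^+ n.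
      by rewrite exprS invfM mulrACA divff// mul1r.
    have -> : 2 * C / 2 ^+ n = C / 2 ^+ n + C / 2 ^+ n by rewrite -mulrA mulr_natl mulr2n.
    lra.
  exists (u 0%N + 2 * C) => _ [n _ <-]; rewrite /v.
  have := h2 0%N n; rewrite add0n expr0 divr1 => /(le_trans (ler_norm _)).
  have : 0 <= 2 * C / 2 ^+ n by rewrite !mulr_ge0 ?invr_ge0 ?exprn_ge0.
  lra.
have cu : u @ \oo --> lim (v @ \oo).
  rewrite -[X in _ --> X]addr0.
  have -> : u = (fun n => v n + 2 * C / 2 ^+ n) by apply/funext => n; rewrite /v subrK.
  exact: cvgD.
have -> : lim (u @ \oo) = lim (v @ \oo) by apply/cvg_lim.
split => // n.
have cd : (fun m => `|u (n + m)%N - u n|) @ \oo --> `|lim (v @ \oo) - u n|.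
  apply: cvg_norm; apply: cvgB; last exact: cvg_cst.
  by under eq_fun do rewrite addnC; move: cu; rewrite -(cvg_shiftn n).
by apply: (cvgr_to_le cd); apply: nearW => m; exact: h2.
Qed.

End RealSequences.

Section VolterraSystem.
Variable R : realType.
Notation mu := (@lebesgue_measure R).
Local Notation mset D := (@measurable _ (measurableTypeR R) D).
Implicit Types (k : R[i]) (Y Z F : bool -> R -> R[i]).

Variables (N d : nat) (phi : nat -> bool -> bool -> R -> R) (c : nat -> R[i] -> R[i]).
Hypothesis hphi : forall l, weighted_L1 N (phi l).

Definition opL k Y b t : R[i] := - \sum_(l < d) (c l k * opM 0 (phi l) k Y b t).

Section FixedParameter.
Variables (C : R) (k : R[i]).
Hypotheses (C0 : 0 <= C) (hk : complex.Re (theta true k) <= 0).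
Hypothesis hC : forall l, (l < d)%N -> nc (c l k) <= C.

Let Phi s := C * \sum_(l < d) total (phi l) s.
Definition mass := \int[mu]_(s in `[0, +oo[) (\sum_(l < d) total (phi l) s).

Let total0 l : inth (total (phi l)).
Proof.
have := total_inth (hphi l) (leq0n N).
by under eq_fun do rewrite expr0 mul1r.
Qed.

Lemma sum_total_inth (r : seq nat) : inth (fun s => \sum_(l <- r) total (phi l) s).
Proof.
elim: r => [|l r IH].
  by under eq_fun do rewrite big_nil; exact: integrable0.
by under eq_fun do rewrite big_cons; exact: inthD.
Qed.

Lemma sum_total_cont (r : seq nat) : conth (fun s => \sum_(l <- r) total (phi l) s).
Proof.
elim: r => [|l r IH].
  by under eq_fun do rewrite big_nil; exact: conth_cst.
by under eq_fun do rewrite big_cons; apply: conthD => //; exact: total_cont (hphi l).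
Qed.

Let sumE s : \sum_(l < d) total (phi l) s = \sum_(l <- iota 0 d) total (phi l) s.
Proof. by rewrite -(big_mkord xpredT (fun l => total (phi l) s)) /index_iota subn0. Qed.

Let sum_inth : inth (fun s => \sum_(l < d) total (phi l) s).
Proof. by under eq_fun do rewrite sumE; exact: sum_total_inth. Qed.

Let Phi_inth : inth Phi.
Proof. exact: (inthZ C sum_inth). Qed.

Let Phi_cont : conth Phi.
Proof.
apply: conthM; first exact: conth_cst.
by under eq_fun do rewrite sumE; exact: sum_total_cont.
Qed.

Let Phi0 s : 0 <= Phi s.
Proof. by rewrite mulr_ge0// sumr_ge0// => l _; exact: total_ge0. Qed.

Let tailPhi t := \int[mu]_(s in `[t, +oo[) Phi s.

(** Since the derivative of [omega] is [- 2 Phi omega], integrating [Phi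
    omega] from [t] to infinity gives at most [omega t / 2]: in the norm
    weighted by [omega] the Volterra operator is a contraction of ratio one
    half, whatever the size of the coefficients. *)
Definition omega t := expR (2 * tailPhi t).

Lemma omega_ge1 t : 1 <= omega t.
Proof.
rewrite /omega -[leLHS]expR0 ler_expR mulr_ge0//.
by apply: Rintegral_ge0 => s _; exact: Phi0.
Qed.

Lemma omega_le t : 0 <= t -> omega t <= expR (2 * (C * mass)).
Proof.
move=> t0; rewrite /omega ler_expR ler_pM2l//.
apply: le_trans (le_tail _ Phi_inth t0) _ => //.
by rewrite /Phi RintegralZl//.
Qed.

Lemma omega_cont : conth omega.
Proof.
apply: (conth_comp (@continuous_expR R)); apply: conthM; first exact: conth_cst.
exact: conth_tail.
Qed.

Lemma Phi_omega_inth : inth (fun s => Phi s * omega s).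
Proof.
have := inthZ (expR (2 * (C * mass))) Phi_inth.
apply: le_integrable => //.
  apply/measurable_EFinP; apply: conth_measurable; apply: conthM => //.
  exact: omega_cont.
move=> s; rewrite /= in_itv /= andbT => s0; rewrite lee_fin !normrM mulrC.
by rewrite ler_wpM2r// !ger0_norm ?expR_ge0 ?omega_le.
Qed.

Lemma integral_Phi_omega t : 0 <= t ->
  \int[mu]_(s in `[t, +oo[) (Phi s * omega s) = (omega t - 1) / 2.
Proof.
move=> t0.
have := @FTC_tail R (fun t => - (omega t / 2)) (fun s => Phi s * omega s) (- (1 / 2)).
move=> /(_ _ _ Phi_omega_inth _ _ t t0) H.
suff : - (omega t / 2) = - (1 / 2) - \int[mu]_(s in `[t, +oo[) (Phi s * omega s) by lra.
apply: H.
- by apply: conthN; apply: conthM; [exact: omega_cont|exact: conth_cst].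
- by apply: conthM => //; exact: omega_cont.
- move=> s s0.
  have dt := is_derive_tail Phi_inth s0 (conth_for Phi_cont s0).
  have dz := is_deriveZ 2 dt.
  have de := @is_derive1_comp R expR (fun s => 2 * tailPhi s) s _ _ (is_derive_expR _) dz.
  have dd := is_deriveN (is_deriveZ 2^-1 de).
  have E : (fun t => - (omega t / 2)) = - (2^-1 \*: (expR \o (fun s => 2 * tailPhi s))).
    by apply/funext => x; rewrite /omega mulrC.
  by rewrite E; apply: (is_derive_eq dd); rewrite /GRing.scale /= /omega; field.
- move=> e e0.
  have /cvgrPdist_le /(_ e e0) := @continuous_expR R 0.
  rewrite expR0 => /nbhs_normP[x /= x0 hx].
  have [L L0 hL] := norm_tail_cvg0 Phi_inth (divr_gt0 x0 (ltr0n _ 4)).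
  exists L => // s Ls; have := hx (2 * tailPhi s).
  rewrite /ball_ /= sub0r normrN => h.
  have : `|1 - omega s| <= e.
    apply: h; rewrite normrM ger0_norm//; have := hL _ Ls; rewrite -/(tailPhi s); lra.
  have -> : - (omega s / 2) - - (1 / 2) = (1 - omega s) / 2 by field.
  rewrite normrM [`|2^-1|]ger0_norm// => h1.
  by rewrite ler_pdivrMr//; move: h1 e0; lra.
Qed.

Definition wbnd Y (a : R) := forall b t, 0 <= t -> nc (Y b t) <= a * omega t.

Lemma wbnd_ge0 Y a : wbnd Y a -> 0 <= a.
Proof.
move=> h; have := le_trans (nc_ge0 _) (h true 0 (lexx 0)).
by rewrite pmulr_lge0// (lt_le_trans ltr01)// omega_ge1.
Qed.

Lemma wbnd_bnd Y a : wbnd Y a -> bnd Y (a * expR (2 * (C * mass))).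
Proof.
move=> h b t t0; apply: le_trans (h b t t0) _.
by rewrite ler_wpM2l ?(wbnd_ge0 h)// omega_le.
Qed.

Lemma bnd_wbnd Y a : bnd Y a -> wbnd Y a.
Proof.
move=> h b t t0; apply: le_trans (h b t t0) _.
by rewrite ler_peMr ?(bnd_ge0 h)// omega_ge1.
Qed.

Lemma opL_adm Y a : adm Y -> bnd Y a -> adm (opL k Y).
Proof.
move=> aY hY b; apply: cmeasN; apply: cmeas_sum => l _.
apply: cmeasM; first exact: cmeas_cst.
exact: (opM_adm (hphi l) (leq0n N) hk aY hY).
Qed.

Lemma opL_bnd Y a : adm Y -> bnd Y a -> bnd (opL k Y) (C * mass * a).
Proof.
move=> aY hY b t t0; rewrite ncN (le_trans (nc_sum _ _ _))//.
have -> : C * mass * a = \sum_(l < d) C * \int[mu]_(s in `[0, +oo[) total (phi l) s * a.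
  rewrite -mulr_suml -mulr_sumr; congr (_ * _ * _); rewrite /mass.
  have : forall r, \int[mu]_(s in `[0, +oo[) (\sum_(l <- r) total (phi l) s) =
     \sum_(l <- r) \int[mu]_(s in `[0, +oo[) total (phi l) s.
    elim=> [|l r IH].
      by rewrite big_nil; under eq_Rintegral do rewrite big_nil; rewrite Rintegral_cst// mul0r.
    rewrite big_cons -IH -RintegralD//; last 2 first.
    - exact: total0.
    - exact: sum_total_inth.
    by apply: eq_Rintegral => s _; rewrite big_cons.
  move=> /(_ (iota 0 d)); under eq_Rintegral do rewrite -sumE.
  by move=> ->; rewrite -(big_mkord xpredT (fun l => \int[mu]_(s in _) total (phi l) s)) /index_iota subn0.
apply: ler_sum => l _; rewrite ncM -mulrA ler_pM ?nc_ge0 ?hC//.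
apply: le_trans (opM_bnd (hphi l) (leq0n N) hk aY hY b t0) _.
by under eq_Rintegral do rewrite expr0 mul1r.
Qed.

Lemma opL_contraction Y a a' : adm Y -> bnd Y a' -> wbnd Y a -> wbnd (opL k Y) (a / 2).
Proof.
move=> aY hY wY b t t0; have a0 := wbnd_ge0 wY.
have iO l : integrableC `[t, +oo[ (fun s => expker 0 k b (s - t) * src (phi l) Y b s).
  exact: (opM_integrable (hphi l) (leq0n N) b hk aY hY t0).
rewrite ncN; have -> : \sum_(l < d) (c l k * opM 0 (phi l) k Y b t) =
   integralC `[t, +oo[ (fun s => \sum_(l < d)
      c l k * (expker 0 k b (s - t) * src (phi l) Y b s)).
  rewrite integralC_sum//; last by move=> l; exact: integrableCZ.
  by apply: eq_bigr => l _; rewrite integralCZ.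
apply: (@le_trans _ _ (\int[mu]_(s in `[t, +oo[) (a * (Phi s * omega s)))).
  apply: nc_integralC_le => //.
  - by apply: integrableC_sum => // l; exact: integrableCZ.
  - exact: (integrableRZ a _ (inth_tail t0 Phi_omega_inth)).
  move=> s /=; rewrite in_itv /= andbT => ts; have s0 := le_trans t0 ts.
  have -> : a * (Phi s * omega s) = \sum_(l < d) C * (total (phi l) s * (a * omega s)).
    by rewrite /Phi -mulr_sumr -mulr_suml; ring.
  apply: le_trans (nc_sum _ _ _) _; apply: ler_sum => l _.
  rewrite 2!ncM ler_pM ?mulr_ge0 ?nc_ge0 ?hC// -[leRHS]mul1r ler_pM ?nc_ge0//.
    rewrite /expker ncM expr0 nc_real normr1 mul1r nc_cexp_le1//.
    by apply: Re_theta_le0; rewrite // subr_ge0.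
  have h1 := wY true _ s0; have h2 := wY false _ s0.
  have ao : 0 <= a * omega s by rewrite (le_trans _ h1)// nc_ge0.
  apply: (le_trans (ncD _ _)); rewrite !ncM !nc_real /total.
  apply: (@le_trans _ _ ((`|phi l b true s| + `|phi l b false s|) * (a * omega s))).
    by rewrite mulrDl lerD// ler_wpM2l.
  rewrite ler_wpM2r//; case: b {iO}; first by rewrite lerDl addr_ge0.
  by rewrite lerDr addr_ge0.
rewrite RintegralZl//; last exact: (inth_tail t0 Phi_omega_inth).
rewrite integral_Phi_omega//.
have := omega_ge1 t; nra.
Qed.

Lemma opLZ (x : R[i]) Y a b t : 0 <= t -> adm Y -> bnd Y a ->
  opL k (fun b t => x * Y b t) b t = x * opL k Y b t.
Proof.
move=> t0 aY hY; rewrite /opL mulrN mulr_sumr; congr (- _).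
apply: eq_bigr => l _ /=.
by rewrite (opMZ (hphi l) (leq0n N) x b hk t0 aY hY) mulrCA.
Qed.

Lemma opLB Y Z a a' b t : 0 <= t -> adm Y -> bnd Y a -> adm Z -> bnd Z a' ->
  opL k (fun b t => Y b t - Z b t) b t = opL k Y b t - opL k Z b t.
Proof.
move=> t0 aY hY aZ hZ; rewrite /opL -opprB opprK addrC -sumrB; congr (- _).
apply: eq_bigr => l _ /=.
by rewrite (opMB (hphi l) (leq0n N) b hk t0 aY hY aZ hZ) mulrBr.
Qed.

Definition solves Y F := forall b t, 0 <= t -> Y b t = opL k Y b t + F b t.

(** Iterating the contraction property starting from any bound [B] of [Y]
    improves it to one that only depends on the source. *)
Lemma apriori Y F a B : adm Y -> bnd Y B -> bnd F a -> solves Y F ->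
  bnd Y (2 * expR (2 * (C * mass)) * a).
Proof.
move=> aY hY hF sY; have a0 := bnd_ge0 hF; have B0 := bnd_ge0 hY.
have step n : wbnd Y (B / 2 ^+ n + 2 * a).
  elim: n => [|n IH].
    rewrite expr0 divr1; apply: bnd_wbnd; apply: bndW hY.
    by rewrite lerDl mulr_ge0.
  move=> b t t0; rewrite sY//; apply: le_trans (ncD _ _) _.
  have h1 := opL_contraction aY hY IH b t0.
  have h2 := bnd_wbnd hF b t0.
  apply: le_trans (lerD h1 h2) _; rewrite -mulrDl ler_wpM2r ?expR_ge0//.
  have p2 : (2 : R) ^+ n != 0 by rewrite expf_neq0.
  by rewrite exprS le_eqVlt; apply/orP; left; apply/eqP; field.
have w2 : wbnd Y (2 * a).
  move=> b t t0; apply/ler_addgt0Pr => e e0.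
  have o0 : 0 < omega t := expR_gt0 _.
  have [n hn] : exists n : nat, B * omega t / e < 2 ^+ n.
    exists (Num.truncn (B * omega t / e)).+1.
    have h0 : 0 <= B * omega t / e by rewrite divr_ge0 ?mulr_ge0// ltW.
    have /andP[_ h1] := truncn_itv h0.
    apply: (lt_trans h1); rewrite -natrX ltr_nat; exact: ltn_expl.
  apply: le_trans (step n b t t0) _; rewrite mulrDl addrC lerD2l.
  by rewrite mulrAC ler_pdivrMr ?exprn_gt0// [leRHS]mulrC -ler_pdivrMr// ltW.
by apply: bndW (wbnd_bnd w2); rewrite mulrAC.
Qed.

(** The Picard iterates differ by [a / 2 ^ n] in the weighted norm. Their
    limits are taken pointwise, which preserves measurability, and the rate
    allows to pass to the limit under the integral. *)
Lemma solution_exists F a : adm F -> bnd F a ->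
  exists Y, [/\ adm Y, exists B, bnd Y B & solves Y F].
Proof.
move=> aF hF; have a0 := bnd_ge0 hF.
pose U := fix U n := match n with
  | 0%N => fun _ _ => 0
  | n'.+1 => fun b t => opL k (U n') b t + F b t end.
have UP n : adm (U n) /\ exists B, bnd (U n) B.
  elim: n => [|n [aU [B hB]]]; split.
  - exact: (adm_cst (fun=> 0)).
  - by exists 0 => b t _; rewrite nc0.
  - by apply: admD => //; exact: opL_adm hB.
  - by exists (C * mass * B + a); apply: bndD => //; exact: opL_bnd.
have dU n : wbnd (fun b t => U n.+1 b t - U n b t) (a / 2 ^+ n).
  elim: n => [|n IH].
    have z0 : bnd (fun _ _ => 0 : R[i]) 0 by move=> b t _; rewrite nc0.
    have := bndD (opL_bnd (adm_cst (fun=> 0)) z0) hF.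
    rewrite mulr0 add0r expr0 divr1 => h; apply: bnd_wbnd.
    by apply: eq_bnd h => b t _; rewrite /= subr0.
  have [aU [B hB]] := UP n; have [aU1 [B1 hB1]] := UP n.+1.
  have := opL_contraction (admB aU1 aU) (bndB hB1 hB) IH.
  rewrite exprSr invfM mulrA => h b t t0; apply: le_trans (h b t t0).
  rewrite (opLB b t0 aU1 hB1 aU hB) [U n.+2]/= [X in _ - X]/=.
  by rewrite [X in nc X <= _](_ : _ = opL k (U n.+1) b t - opL k (U n) b t)//; ring.
pose K := expR (2 * (C * mass)).
have dUb n b t : 0 <= t -> nc (U n.+1 b t - U n b t) <= a * K / 2 ^+ n.
  by move=> t0; have := wbnd_bnd (dU n) b t0; rewrite mulrAC.
pose Y b t : R[i] := lim ((fun n => complex.Re (U n b t)) @ \oo) +i*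
  lim ((fun n => complex.Im (U n b t)) @ \oo).
have cR b t : 0 <= t -> _ := fun t0 => @geometric_limit R
  (fun n => complex.Re (U n b t)) (a * K) (fun n =>
   le_trans (eq_ind_r (fun x => `|x| <= _) (Re_nc (U n.+1 b t - U n b t))
     (esym (etrans (ReD _ _) (congr1 _ (ReN _))))) (dUb n b t t0)).
have cI b t : 0 <= t -> _ := fun t0 => @geometric_limit R
  (fun n => complex.Im (U n b t)) (a * K) (fun n =>
   le_trans (eq_ind_r (fun x => `|x| <= _) (Im_nc (U n.+1 b t - U n b t))
     (esym (etrans (ImD _ _) (congr1 _ (ImN _))))) (dUb n b t t0)).
have YU n : bnd (fun b t => Y b t - U n b t) (4 * (a * K) / 2 ^+ n).
  move=> b t t0; apply: le_trans (nc_ReIm _) _; rewrite ReD ReN ImD ImN.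
  have [_ h1] := cR b t t0; have [_ h2] := cI b t t0.
  by have := lerD (h1 n) (h2 n); rewrite /=; lra.
have aY : adm Y.
  move=> b; split => /=.
    apply: (@measurable_fun_cvg _ _ _ _ (fun n t => complex.Re (U n b t))).
      by move=> n; have [/(_ b)[]] := UP n.
    by move=> t /=; rewrite in_itv /= andbT => /(cR b)[].
  apply: (@measurable_fun_cvg _ _ _ _ (fun n t => complex.Im (U n b t))).
    by move=> n; have [/(_ b)[]] := UP n.
  by move=> t /=; rewrite in_itv /= andbT => /(cI b)[].
have bY : bnd Y (4 * (a * K)).
  apply: eq_bnd (bndW _ (YU 0%N)) => [b t _|]; first by rewrite subr0.
  by rewrite expr0 divr1.
exists Y; split => //; first by exists (4 * (a * K)).
move=> b t t0; apply/eqP; rewrite -subr_eq0 -nc_eq0 -normr_le0 ger0_norm ?nc_ge0//.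
apply/ler_addgt0Pr => e e0; rewrite add0r.
pose Q := 4 * (a * K) + C * mass * (4 * (a * K)).
have [n hn] : exists n : nat, Q / e < 2 ^+ n.
  exists (Num.truncn `|Q / e|).+1.
  have /andP[_ h1] := truncn_itv (normr_ge0 (Q / e)).
  apply: (le_lt_trans (ler_norm _)).
  apply: (lt_trans h1); rewrite -natrX ltr_nat; exact: ltn_expl.
have [aU [B hB]] := UP n.
have -> : Y b t - (opL k Y b t + F b t) = (Y b t - U n.+1 b t) -
    opL k (fun b t => Y b t - U n b t) b t.
  by rewrite (opLB b t0 aY bY aU hB) /=; ring.
apply: le_trans (ncB _ _) _.
have h1 := YU n.+1 b t t0; have h2 := opL_bnd (admB aY aU) (YU n) b t0.
apply: le_trans (lerD h1 h2) _.
apply: (@le_trans _ _ (Q / 2 ^+ n)).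
  have -> : Q / 2 ^+ n = 4 * (a * K) / 2 ^+ n + C * mass * (4 * (a * K) / 2 ^+ n).
    by rewrite /Q; ring.
  rewrite lerD2r ler_wpM2l ?mulr_ge0 ?expR_ge0// lef_pV2 ?posrE ?exprn_gt0//.
  by rewrite ler_eXn2l ?ltr1n.
by rewrite ler_pdivrMr ?exprn_gt0// [leRHS]mulrC -ler_pdivrMr// ltW.
Qed.

End FixedParameter.

End VolterraSystem.

Section SmoothSolution.
Variable R : realType.
Notation mu := (@lebesgue_measure R).
Implicit Types (k : R[i]) (Y Z F : bool -> R -> R[i]).

Variables (N d : nat) (phi : nat -> bool -> bool -> R -> R) (c c' : nat -> R[i] -> R[i]).
Hypothesis hphi : forall l, weighted_L1 N (phi l).
Variables (Om : set R[i]) (rho : R[i] -> R).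
Hypothesis rho_ge0 : forall k, Om k -> 0 <= rho k.
Hypothesis Om_theta : forall k, Om k -> complex.Re (theta true k) <= 0.
Hypothesis dtheta_smooth : forall n, smooth Om rho n rho (fun k b _ => dtheta b k).
Hypothesis c_smooth : forall n l, smooth Om rho n (fun=> 1) (fun k _ _ => c l k).
Hypothesis c'_smooth : forall n l, smooth Om rho n rho (fun k _ _ => c' l k).
Hypothesis c_der : forall l, fam_der Om (fun k _ _ => c l k) (fun k _ _ => c' l k).

Let L := opL d phi c.

(** The formal derivative of the operator in [k]; it acts on bounded functions
    because the weight absorbs one factor [s - t]. *)
Definition opdL k Y b t : R[i] := - \sum_(l < d) (c' l k * opM 0 (phi l) k Y b t +
  c l k * (dtheta b k * opM 1 (phi l) k Y b t)).

Lemma smooth_opL n w f : (n <= N)%N -> (forall k, Om k -> 0 <= w k) ->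
  smooth Om rho n w f -> smooth Om rho n w (fun k => L k (f k)).
Proof.
move=> nN w0 sf.
suff h : forall l : 'I_d, smooth Om rho n w
    (fun k b t => c l k * opM 0 (phi l) k (f k) b t).
  exact: (smoothN rho_ge0 (smooth_sum rho_ge0 _ w0 h)).
move=> l; have so := smooth_opM (hphi l) rho_ge0 Om_theta dtheta_smooth (j := 0) nN sf.
apply: (smoothW rho_ge0 ler01 _ (smoothM rho_ge0 (c_smooth n l) so)) => k Ok.
by rewrite mul1r.
Qed.

Lemma smooth_opdL n w f : (n < N)%N -> (forall k, Om k -> 0 <= w k) ->
  smooth Om rho n w f -> smooth Om rho n (fun k => w k * rho k) (fun k => opdL k (f k)).
Proof.
move=> nN w0 sf.
have w1 k : Om k -> 0 <= w k * rho k by move=> Ok; rewrite mulr_ge0 ?w0 ?rho_ge0.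
suff h : forall l : 'I_d, smooth Om rho n (fun k => w k * rho k)
    (fun k b t => c' l k * opM 0 (phi l) k (f k) b t +
       c l k * (dtheta b k * opM 1 (phi l) k (f k) b t)).
  exact: (smoothN rho_ge0 (smooth_sum rho_ge0 _ w1 h)).
move=> l; have so := smooth_opM (hphi l) rho_ge0 Om_theta dtheta_smooth (j := 0) (ltnW nN) sf.
have so1 := smooth_opM (hphi l) rho_ge0 Om_theta dtheta_smooth (j := 1) nN sf.
apply: (smoothD).
  apply: (smoothW rho_ge0 ler01 _ (smoothM rho_ge0 (c'_smooth n l) so)) => k Ok.
  by rewrite mul1r mulrC.
have := smoothM rho_ge0 (c_smooth n l) (smoothM rho_ge0 (dtheta_smooth n) so1).
apply: (smoothW rho_ge0 ler01) => k Ok.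
by rewrite !mul1r mulrC.
Qed.

Lemma fam_der_sum (r : seq nat) (g g' : nat -> R[i] -> bool -> R -> R[i]) :
  (forall l, fam_der Om (g l) (g' l)) ->
  fam_der Om (fun k b t => \sum_(l <- r) g l k b t)
    (fun k b t => \sum_(l <- r) g' l k b t).
Proof.
move=> h; elim: r => [|l r IH] k Ok e e0.
  exists 1 => // k' _ _ b t _; rewrite !big_nil mulr0 subrr subr0 nc0.
  by rewrite mulr_ge0 ?nc_ge0// ltW.
have [x x0 hx] := fam_derD (h l) IH Ok e0; exists x => // k' Ok' kd.
by apply: eq_bnd (hx _ Ok' kd) => b t _; rewrite !big_cons.
Qed.

Lemma opL_der Z B : (0 < N)%N -> adm Z -> bnd Z B ->
  fam_der Om (fun k => L k Z) (fun k => opdL k Z).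
Proof.
move=> N0 aZ hZ.
have sZ n : smooth Om rho n (fun=> 1) (fun=> Z) by exact: smooth_cst hZ _.
have z0 : adm (fun _ _ => 0 : R[i]) by exact: (adm_cst (fun=> 0)).
have b0 : bnd (fun _ _ => 0 : R[i]) 0 by move=> b t _; rewrite nc0.
have s0 n : smooth Om rho n (fun=> 1) (fun _ _ _ => 0 : R[i]) by exact: smooth0.
have dZ : fam_der Om (fun=> Z) (fun _ _ _ => 0).
  move=> k Ok e e0; exists 1 => // k' _ _ b t _.
  by rewrite mulr0 subrr subr0 nc0 mulr_ge0 ?nc_ge0// ltW.
have D l : fam_der Om (fun k b t => c l k * opM 0 (phi l) k Z b t)
   (fun k b t => c' l k * opM 0 (phi l) k Z b t +
     c l k * (dtheta b k * opM 1 (phi l) k Z b t)).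
  have dM := opM_fam_der (hphi l) Om_theta N0 (fun k _ => aZ) (fun k _ => z0) dZ
     (let: And4 _ _ h _ := sZ 0%N in h) (let: And4 _ _ h _ := s0 0%N in h).
  have so := smooth_opM (hphi l) rho_ge0 Om_theta dtheta_smooth (j := 0) (leq0n N) (sZ 0%N).
  have [_ cM bM] := smoothE so.
  have [_ _ bc] := smoothE (c_smooth 0 l).
  have [_ _ bc'] := smoothE (c'_smooth 0 l).
  have := fam_derM (c_der l) dM cM bc bc' bM.
  move=> h k Ok e e0; have [x x0 hx] := h _ Ok _ e0; exists x => // k' Ok' kd.
  apply: eq_bnd (hx _ Ok' kd) => b t t0.
  have z : opM 0 (phi l) k (fun _ _ => 0) b t = 0.
    have := opMZ (hphi l) (leq0n N) 0 b (Om_theta Ok) t0 z0 b0; rewrite [RHS]mul0r => E.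
    by rewrite -[RHS]E /opM /genop; apply: eq_integralC => s _; rewrite /src !mulr0.
  have -> : dtheta b k * opM 1 (phi l) k Z b t + opM 0 (phi l) k (fun _ _ => 0) b t =
      dtheta b k * opM 1 (phi l) k Z b t.
    by rewrite z; move: (dtheta b k * _) => y; exact: addr0.
  by [].
have := fam_der_sum (iota 0 d) D.
move=> h k Ok e e0; have [x x0 hx] := h _ Ok _ e0; exists x => // k' Ok' kd b t t0.
have := hx _ Ok' kd b t t0.
have E (g : nat -> R[i]) : \sum_(l <- iota 0 d) g l = \sum_(l < d) g l.
  by rewrite -(big_mkord xpredT g) /index_iota subn0.
rewrite !E /L /opL /opdL.
set S1 := \sum_(l < d) _; set S2 := \sum_(l < d) _; set S3 := \sum_(l < d) _.
have -> : - S1 - - S2 - (k' - k) * - S3 = - (S1 - S2 - (k' - k) * S3).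
  by move: S1 S2 S3 (k' - k) => x1 x2 x3 x4; ring.
by rewrite ncN.
Qed.

Lemma coef_bound : exists2 C : R, 0 <= C & forall k, Om k -> forall l, (l < d)%N ->
  nc (c l k) <= C.
Proof.
elim: d => [|d' [C C0 hC]]; first by exists 0.
have [_ _ [C1 C10 hC1]] := smoothE (c_smooth 0 d').
exists (C + C1); first exact: addr_ge0.
move=> k Ok l; rewrite ltnS leq_eqVlt => /orP[/eqP ->|ld].
  have := hC1 _ Ok true 0 (lexx 0); rewrite mulr1 => h; apply: (le_trans h).
  by rewrite lerDr.
by apply: (le_trans (hC _ Ok _ ld)); rewrite lerDl.
Qed.

(** The derivative of the solution has to solve the same system with the
    source [opdL Y + F'], which involves [Y] and not its derivative. Such a
    solution exists; the remainder of the difference quotient solves the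
    system with a small source, so the bound of [apriori] shows that it is the
    derivative, and induction applies to it. *)
Theorem smooth_solution n w (F Y : R[i] -> bool -> R -> R[i]) :
  (n <= N)%N -> (forall k, Om k -> 0 <= w k) -> smooth Om rho n w F ->
  (forall k, Om k -> adm (Y k)) -> (forall k, Om k -> exists B, bnd (Y k) B) ->
  (forall k, Om k -> solves d phi c k (Y k) (F k)) -> smooth Om rho n w Y.
Proof.
have [C C0 hC] := coef_bound.
pose M := 2 * expR (2 * (C * mass d phi)).
have M0 : 0 < M by rewrite mulr_gt0// expR_gt0.
have ap k (Ok : Om k) (Z G : bool -> R -> R[i]) a B : adm Z -> bnd Z B -> bnd G a ->
    solves d phi c k Z G -> bnd Z (M * a).
  by move=> aZ hZ hG sZ; exact: (apriori hphi C0 (Om_theta Ok) (hC k Ok) aZ hZ hG sZ).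
have E1 (x1 x2 x3 f1 f2 : R[i]) :
    x1 + f1 - (x2 + f2) = x1 - x3 + (x3 - x2 + (f1 - f2)) by ring.
have E2 (h x1 x2 x3 f1 f2 f3 y1 y2 y3 : R[i]) :
    x1 + f1 - (x2 + f2) - h * (y1 + (y2 + f3)) = x1 - x3 - h * y3 +
      (x3 - x2 - h * y2 + h * (y3 - y1) + (f1 - f2 - h * f3)) by ring.
elim: n w F Y => [|n IH] w F Y nN w0 sF aY hY sY.
all: have [aF cF [CF CF0 bF]] := smoothE sF.
all: have bY : fam_bounded Om w Y by
  exists (M * CF); [rewrite mulr_ge0// ltW|move=> k Ok; have [B hB] := hY _ Ok;
   rewrite -mulrA; exact: (ap k Ok _ _ _ _ (aY _ Ok) hB (bF _ Ok) (sY _ Ok))].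
all: have cY : fam_cont Om Y.
1,3: move=> k Ok e e0; have [B hB] := hY _ Ok;
  have eM : 0 < e / M / 2 by [rewrite !divr_gt0];
  have [_ cL _] := smoothE (smooth_opL (leq0n N) (fun _ _ => ler01)
    (smooth_cst rho_ge0 0 (w := fun=> 1) (aY _ Ok) hB (fun _ _ => lexx 1)));
  have [x x0 hx] := cL _ Ok _ eM; have [y y0 hy] := cF _ Ok _ eM;
  exists (Num.min x y); [by rewrite lt_min x0|];
  move=> k' Ok'; rewrite lt_min => /andP[kx ky];
  have [B' hB'] := hY _ Ok';
  have := ap k' Ok' _ (fun b t => (L k' (Y k) b t - L k (Y k) b t) + (F k' b t - F k b t)) _ _
    (admB (aY _ Ok') (aY _ Ok)) (bndB hB' hB) (bndD (hx _ Ok' kx) (hy _ Ok' ky));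
  rewrite -splitr mulrC divfK ?gt_eqF//; apply => b t t0;
  rewrite (opLB d c hphi (Om_theta Ok') b t0 (aY _ Ok') hB' (aY _ Ok) hB);
  apply: etrans (congr2 (fun x y => x - y) (sY _ Ok' b t t0) (sY _ Ok b t t0)) _;
  exact: E1.
  by split.
split => //.
have N0 : (0 < N)%N by exact: leq_ltn_trans nN.
move: (sF) => [_ _ _ [F' dF sF']]; have [aF' cF' bF'] := smoothE sF'.
have sYn : smooth Om rho n w Y.
  by apply: (IH w F Y (ltnW nN) w0 (smooth_pred sF)).
have sdL := smooth_opdL nN w0 sYn.
have sG := smoothD sdL sF'; have [aG _ bG] := smoothE sG.
have exZ k : exists Z, Om k -> [/\ adm Z, exists B, bnd Z B &
    solves d phi c k Z (fun b t => opdL k (Y k) b t + F' k b t)].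
  have [Ok|nOk] := pselect (Om k); last by exists (fun _ _ => 0).
  have [B _ hB] := fam_pbounded bG Ok.
  have [Z hZ] := solution_exists hphi C0 (Om_theta Ok) (hC k Ok) (aG _ Ok) hB.
  by exists Z.
pose Y' k := sval (cid (exZ k)).
have hY' k : Om k -> [/\ adm (Y' k), exists B, bnd (Y' k) B &
    solves d phi c k (Y' k) (fun b t => opdL k (Y k) b t + F' k b t)].
  by rewrite /Y'; case: cid.
exists Y'; last first.
  apply: (IH (fun k => w k * rho k) (fun k b t => opdL k (Y k) b t + F' k b t) Y') => //.
  - exact: ltnW.
  - by move=> k Ok; rewrite mulr_ge0 ?w0 ?rho_ge0.
  - by move=> k /hY'[].
  - by move=> k /hY'[].
  - by move=> k /hY'[].
move=> k Ok e e0; have [B hB] := hY _ Ok; have [aZ [B1 hB1] sZ] := hY' _ Ok.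
have eM : 0 < e / M / 3 by rewrite !divr_gt0.
have [x x0 hx] := opL_der N0 (aY _ Ok) hB Ok eM.
have [_ cL _] := smoothE (smooth_opL (leq0n N) (fun _ _ => ler01)
    (smooth_cst rho_ge0 0 (w := fun=> 1) aZ hB1 (fun _ _ => lexx 1))).
have [y y0 hy] := cL _ Ok _ eM; have [z z0 hz] := dF _ Ok _ eM.
exists (Num.min x (Num.min y z)); first by rewrite !lt_min x0 y0.
move=> k' Ok'; rewrite !lt_min => /and3P[kx ky kz].
have [B' hB'] := hY _ Ok'.
set h := k' - k.
(* the remainder solves the system at k', with a source that is o(h) *)
have aD : adm (fun b t => Y k' b t - Y k b t - h * Y' k b t).
  by apply: admB; [apply: admB; exact: aY|apply: admZ].
have := ap k' Ok' _ (fun b t => (L k' (Y k) b t - L k (Y k) b t - h * opdL k (Y k) b t) +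
    h * (L k' (Y' k) b t - L k (Y' k) b t) + (F k' b t - F k b t - h * F' k b t)) _ _
    aD (bndB (bndB hB' hB) (bndZ h hB1))
    (bndD (bndD (hx _ Ok' kx) (bndZ h (hy _ Ok' ky))) (hz _ Ok' kz)).
have -> : M * (e / M / 3 * nc (k' - k) + nc h * (e / M / 3) + e / M / 3 * nc (k' - k)) =
    e * nc (k' - k).
  by rewrite /h; field; rewrite gt_eqF.
apply => b t t0.
have bZ := bndZ h hB1; have aZ' := admZ h aZ.
rewrite (opLB d c hphi (Om_theta Ok') b t0 (admB (aY _ Ok') (aY _ Ok)) (bndB hB' hB) aZ' bZ).
rewrite (opLB d c hphi (Om_theta Ok') b t0 (aY _ Ok') hB' (aY _ Ok) hB).
rewrite (opLZ d c hphi (Om_theta Ok') h b t0 aZ hB1).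
apply: etrans (congr2 (fun x y => x - y) (congr2 (fun x y => x - y)
  (sY _ Ok' b t t0) (sY _ Ok b t t0)) (congr1 (fun x => h * x) (sZ b t t0))) _.
exact: E2.
Qed.

End SmoothSolution.

(** * Weighted differentiability classes on the half-line *)

Section WeightedClasses.
Variable R : realType.
Notation mu := (@lebesgue_measure R).
Variable N : nat.
Implicit Types (f g : R -> R).

(** Only derivatives at interior points enter, since each derivative is
    continuous up to the endpoint. *)
Fixpoint Kclass (s : nat) f : Prop :=
  [/\ conth f, inth (fun t => (1 + t) ^+ N * f t) &
   match s with
   | 0%N => True
   | s'.+1 => exists2 f', (forall t : R, 0 < t -> is_derive t 1 f (f' t)) & Kclass s' f'
   end].

Lemma KclassE s f : Kclass s f -> conth f /\ inth (fun t => (1 + t) ^+ N * f t).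
Proof. by case: s => [|s] []. Qed.

Lemma Kpred s f : Kclass s.+1 f -> Kclass s f.
Proof.
elim: s f => [|s IH] f [h1 h2 [f' h3 h4]]; split => //.
by exists f' => //; exact: IH.
Qed.

Lemma KS s s' f : (s <= s')%N -> Kclass s' f -> Kclass s f.
Proof.
elim: s' => [|s' IH]; first by rewrite leqn0 => /eqP ->.
rewrite leq_eqVlt ltnS => /orP[/eqP -> //|h /Kpred]; exact: IH.
Qed.

Lemma inth0 : inth (fun=> 0 : R).
Proof. exact: integrable0. Qed.

Lemma eq_inth f g : (forall t, 0 <= t -> f t = g t) -> inth f -> inth g.
Proof.
move=> fg; apply: eq_integrable => // t /set_mem /=.
by rewrite in_itv /= andbT => t0; rewrite fg.
Qed.

Lemma le_inth f g : conth f -> (forall t, 0 <= t -> `|f t| <= `|g t|) -> inth g -> inth f.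
Proof.
move=> cf fg; apply: le_integrable => //.
  by apply/measurable_EFinP; exact: conth_measurable.
by move=> t; rewrite /= in_itv /= andbT lee_fin => t0; exact: fg.
Qed.

Lemma K0 s : Kclass s (fun=> 0).
Proof.
elim: s => [|s IH]; split => //; try exact: conth_cst;
  try by apply: eq_inth inth0 => t _; rewrite mulr0.
by exists (fun=> 0) => // t t0; exact: is_derive_cst.
Qed.

Lemma KD s f g : Kclass s f -> Kclass s g -> Kclass s (fun t => f t + g t).
Proof.
elim: s f g => [|s IH] f g [f1 f2 f3] [g1 g2 g3].
  split => //; first exact: conthD.
  by apply: eq_inth (inthD f2 g2) => t _; rewrite mulrDr.
split; first exact: conthD.
  by apply: eq_inth (inthD f2 g2) => t _; rewrite mulrDr.
have [f' f4 f5] := f3; have [g' g4 g5] := g3.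
exists (fun t => f' t + g' t); last exact: IH.
by move=> t t0; apply: is_deriveD; [exact: f4|exact: g4].
Qed.

Lemma KZ s (a : R) f : Kclass s f -> Kclass s (fun t => a * f t).
Proof.
elim: s f => [|s IH] f [f1 f2 f3].
  split => //; first by apply: conthM => //; exact: conth_cst.
  by apply: eq_inth (inthZ a f2) => t _; rewrite mulrCA.
split; first by apply: conthM => //; exact: conth_cst.
  by apply: eq_inth (inthZ a f2) => t _; rewrite mulrCA.
have [f' f4 f5] := f3; exists (fun t => a * f' t); last exact: IH.
by move=> t t0; apply: is_deriveZ; exact: f4.
Qed.

Lemma KN s f : Kclass s f -> Kclass s (fun t => - f t).
Proof. by move=> /(KZ (-1)); under eq_fun do rewrite mulN1r. Qed.

Lemma K_sum s (I : Type) (r : seq I) (F : I -> R -> R) :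
  (forall i, Kclass s (F i)) -> Kclass s (fun t => \sum_(i <- r) F i t).
Proof.
move=> h; elim: r => [|i r IH]; first by under eq_fun do rewrite big_nil; exact: K0.
by under eq_fun do rewrite big_cons; apply: KD.
Qed.

(** The multipliers of [Kclass 0]: products of integrable functions need not
    be integrable. *)
Definition bcont f := conth f /\ exists M : R, forall t, 0 <= t -> `|f t| <= M.

Lemma bcont_cst (a : R) : bcont (fun=> a).
Proof. by split; [exact: conth_cst|exists `|a|]. Qed.

Lemma bcontD f g : bcont f -> bcont g -> bcont (fun t => f t + g t).
Proof.
move=> [f1 [M hM]] [g1 [M' hM']]; split; first exact: conthD.
exists (M + M') => t t0; apply: (le_trans (ler_normD _ _)).
by rewrite lerD ?hM ?hM'.
Qed.

Lemma bcontM f g : bcont f -> bcont g -> bcont (fun t => f t * g t).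
Proof.
move=> [f1 [M hM]] [g1 [M' hM']]; split; first exact: conthM.
by exists (M * M') => t t0; rewrite normrM ler_pM ?hM ?hM'.
Qed.

Lemma bcont_sum (I : Type) (r : seq I) (F : I -> R -> R) :
  (forall i, bcont (F i)) -> bcont (fun t => \sum_(i <- r) F i t).
Proof.
move=> h; elim: r => [|i r IH]; first by under eq_fun do rewrite big_nil; exact: bcont_cst.
by under eq_fun do rewrite big_cons; apply: bcontD.
Qed.

Lemma K0_bcont f g : Kclass 0 f -> bcont g -> Kclass 0 (fun t => f t * g t).
Proof.
move=> [f1 f2 _] [g1 [M hM]]; split => //; first exact: conthM.
have cw : conth (fun t : R => (1 + t) ^+ N).
  by apply: conth_exp; apply: conthD; [exact: conth_cst|exact: conth_id].
apply: le_inth (inthZ M f2); first by apply: conthM => //; exact: conthM.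
move=> t t0; have M0 : 0 <= M := le_trans (normr_ge0 _) (hM t t0).
rewrite mulrA !normrM [`|M|]ger0_norm// mulrC ler_wpM2r ?mulr_ge0//.
exact: hM.
Qed.

Lemma K0_inth f : Kclass 0 f -> inth f.
Proof.
move=> [f1 f2 _]; apply: le_inth f2 => // t t0; rewrite normrM ler_peMl//.
by rewrite ger0_norm ?exprn_ge0 ?addr_ge0// exprn_ege1// lerDl.
Qed.

(** A function with integrable derivative has a limit at infinity, which has
    to be zero for the function itself to be integrable. *)
Lemma K1_tail f f' : conth f -> inth f -> conth f' -> inth f' ->
  (forall t : R, 0 < t -> is_derive t 1 f (f' t)) ->
  forall t, 0 <= t -> f t = - \int[mu]_(s in `[t, +oo[) f' s.
Proof.
move=> cf fi cf' fi' df.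
pose l := f 0 + \int[mu]_(s in `[0, +oo[) f' s.
have fE t : 0 <= t -> f t = l - \int[mu]_(s in `[t, +oo[) f' s.
  move=> t0.
  have cG : conth (fun t => f t + \int[mu]_(s in `[t, +oo[) f' s).
    by apply: conthD => //; exact: conth_tail.
  have [//||c _] := @MVT_segment _ (fun t => f t + \int[mu]_(s in `[t, +oo[) f' s) (fun=> 0) 0 t t0.
  - move=> x; rewrite in_itv /= => /andP[x0 _]; rewrite -(subrr (f' x)).
    apply: is_deriveD; first exact: df.
    by apply: is_derive_tail => //; exact: conth_for.
  - exact: conth_seg.
  by rewrite mul0r -/l; lra.
(* otherwise |f| stays above |l| / 2 on intervals of length one far out *)
suff l0 : l = 0 by move=> t t0; rewrite fE// l0 sub0r.
apply/eqP; rewrite -normr_eq0; apply/negPn/negP => ne.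
have e0 : 0 < `|l| / 4 by rewrite divr_gt0// lt_neqAle eq_sym ne normr_ge0.
have [L L0 hL] := norm_tail_cvg0 fi' e0.
have [L1 L10 hL1] := tail_cvg0 (fun s _ => normr_ge0 (f s)) (integrable_norm fi) e0.
pose a := Num.max L L1.
have La : L <= a by rewrite le_max lexx.
have L1a : L1 <= a by rewrite le_max lexx orbT.
have a0 : 0 <= a by exact: le_trans La.
have i1 : mu.-integrable `[a, a + 1] (EFin \o (fun s => `|f s|)).
  apply: integrableS (integrable_norm fi) => //.
  move=> s /=; rewrite !in_itv /= andbT => /andP[+ _]; exact: le_trans.
have h1 : \int[mu]_(s in `[a, a + 1]) (`|l| / 2) <= \int[mu]_(s in `[a, a + 1]) `|f s|.
  apply: le_Rintegral => //.
    apply: (@continuous_compact_integrable _ (fun=> `|l| / 2)); first exact: segment_compact.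
    by apply: continuous_subspaceT => x; exact: cst_continuous.
  move=> s /=; rewrite in_itv /= => /andP[sa _]; rewrite fE ?(le_trans a0)//.
  have := hL s (le_trans La sa).
  have := ler_normD (\int[mu]_(s0 in `[s, +oo[) f' s0) (l - \int[mu]_(s0 in `[s, +oo[) f' s0).
  by rewrite subrKC; move: e0; lra.
have h2 : \int[mu]_(s in `[a, a + 1]) `|f s| <= \int[mu]_(s in `[a, +oo[) `|f s|.
  have fin : mu.-integrable `[a, +oo[ (EFin \o (fun s => `|f s|)).
    exact: inth_tail (integrable_norm fi).
  rewrite /Rintegral fine_le//; try exact: integrable_fin_num.
  apply: ge0_subset_integral => //.
  - by have /measurable_int := fin.
  - by apply: subset_itvl; rewrite bnd_simp.
have h3 := hL1 a L1a.
have h4 : \int[mu]_(s in `[a, a + 1]) (`|l| / 2) = `|l| / 2.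
  rewrite Rintegral_cst//.
  transitivity (`|l| / 2 * 1); last by rewrite mulr1.
  congr (_ * _); transitivity (fine (1%:E : \bar R)) => //; congr fine.
  apply: (etrans (lebesgue_measure_itv `[a, a + 1])).
  by rewrite /= lte_fin ltrDl ltr01 -EFinD addrAC subrr add0r.
by move: h1 h2 h3 e0; rewrite h4; lra.
Qed.

Lemma K1_bcont s f : Kclass s.+1 f -> bcont f /\ rlim f 0.
Proof.
move=> [f1 f2 [f' df /(KS (leq0n s)) f3]].
have fi : inth f by apply: (@K0_inth f); split.
have [cf' _ _] := f3; have fi' := K0_inth f3.
have E := K1_tail f1 fi cf' fi' df; split.
  split => //; exists (\int[mu]_(s in `[0, +oo[) `|f' s|) => t t0.
  rewrite E// normrN.
  apply: le_trans (le_normr_Rintegral _ _) _ => //; first exact: inth_tail.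
  by apply: (@le_tail _ (fun s => `|f' s|)) => //; exact: integrable_norm.
move=> e e0; have [L L0 hL] := norm_tail_cvg0 fi' e0; exists L => // t Lt.
by rewrite subr0 E ?(le_trans L0)// normrN hL.
Qed.

(** A product is integrable against the weight if one factor is and the other
    is bounded. Functions in the classes of positive order are bounded, and
    differentiating a product lowers the order of one factor at a time. *)
Lemma KM s s' f g : (s <= s')%N -> (0 < s')%N ->
  Kclass s f -> Kclass s' g -> Kclass s (fun t => f t * g t).
Proof.
elim: s s' f g => [|s IH] [//|s'] f g ss _ hf hg.
  by apply: K0_bcont => //; have [] := K1_bcont hg.
have h0 : Kclass 0 (fun t => f t * g t).
  by apply: K0_bcont; [exact: KS hf|have [] := K1_bcont hg].
have [c0 i0 _] := h0; split => //.
move: (hf) (hg) => [_ _ [f' df f5]] [_ _ [g' dg g5]].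
exists (fun t => f' t * g t + g' t * f t); last first.
  apply: KD; first by apply: (IH s'.+1) => //; exact: ltnW.
  by apply: (IH s.+1) => //; exact: KS g5.
move=> t t0; apply: (is_derive_eq (is_deriveM (df t t0) (dg t t0))).
by rewrite /GRing.scale /=; ring.
Qed.

End WeightedClasses.

(** * Formal solutions in powers of [1 / k] *)

Section PolynomialFunctions.
Variable R : realType.
Notation mu := (@lebesgue_measure R).
Variable N : nat.
Implicit Types (P Q : R -> {poly R}).

(** Functions with values in the polynomials in [z = i / k] are handled
    coefficientwise. A bound [m] on the order is needed because in the recursion
    for the Riccati coefficients the regularity available at order [l]
    decreases with [l]. *)
Definition PKm (m s : nat) P := forall l, (l <= m)%N -> Kclass N s (fun t => (P t)`_l).
Definition PK (s : nat) P := forall l, Kclass N s (fun t => (P t)`_l).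
Definition Pb P := forall l, bcont (fun t => (P t)`_l).
Definition psize P := exists D : nat, forall t, (size (P t) <= D)%N.
Definition Pder P P' := forall (l : nat) (t : R), 0 < t ->
  is_derive t 1 (fun t => (P t)`_l) ((P' t)`_l).

Definition pmon (f : R -> R) (i : nat) (t : R) : {poly R} := (f t)%:P * 'X^i.

Lemma coef_pmon f i l t : (pmon f i t)`_l = if l == i then f t else 0.
Proof. by rewrite /pmon coefCM coefXn; case: eqP => _; rewrite ?mulr1 ?mulr0. Qed.

Lemma PKm_mon m s f i : ((i <= m)%N -> Kclass N s f) -> PKm m s (pmon f i).
Proof.
move=> h l lm; under eq_fun do rewrite coef_pmon.
by case: eqP => [li|_]; [apply: h; rewrite -li|exact: K0].
Qed.

Lemma PKmD m s P Q : PKm m s P -> PKm m s Q -> PKm m s (fun t => P t + Q t).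
Proof. by move=> hP hQ l lm; under eq_fun do rewrite coefD; apply: KD; [exact: hP|exact: hQ]. Qed.

Lemma PKmN m s P : PKm m s P -> PKm m s (fun t => - P t).
Proof. by move=> hP l lm; under eq_fun do rewrite coefN; apply: KN; exact: hP. Qed.

Lemma PKmM m s P Q : (0 < s)%N -> PKm m s P -> PKm m s Q -> PKm m s (fun t => P t * Q t).
Proof.
move=> s0 hP hQ l lm; under eq_fun do rewrite coefM.
apply: K_sum => i; apply: (@KM _ _ s s) => //.
  by apply: hP; rewrite (leq_trans _ lm)// -ltnS.
by apply: hQ; rewrite (leq_trans (leq_subr _ _)).
Qed.

Lemma PKmZ m s (a : R) P : PKm m s P -> PKm m s (fun t => a *: P t).
Proof. by move=> hP l lm; under eq_fun do rewrite coefZ; apply: KZ; exact: hP. Qed.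

Lemma PK_PKm m s P : PK s P -> PKm m s P.
Proof. by move=> h l _; exact: h. Qed.

Lemma PKmP s P : (forall m, PKm m s P) -> PK s P.
Proof. by move=> h l; exact: (h l). Qed.

Lemma PKD s P Q : PK s P -> PK s Q -> PK s (fun t => P t + Q t).
Proof. by move=> hP hQ; apply: PKmP => m; apply: PKmD; exact: PK_PKm. Qed.
Lemma PKN s P : PK s P -> PK s (fun t => - P t).
Proof. by move=> hP; apply: PKmP => m; apply: PKmN; exact: PK_PKm. Qed.
Lemma PKM s P Q : (0 < s)%N -> PK s P -> PK s Q -> PK s (fun t => P t * Q t).
Proof. by move=> s0 hP hQ; apply: PKmP => m; apply: PKmM => //; exact: PK_PKm. Qed.
Lemma PKZ s (a : R) P : PK s P -> PK s (fun t => a *: P t).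
Proof. by move=> hP; apply: PKmP => m; apply: PKmZ; exact: PK_PKm. Qed.
Lemma PK_mon s f i : Kclass N s f -> PK s (pmon f i).
Proof. by move=> h; apply: PKmP => m; exact: PKm_mon. Qed.

Lemma PKle s s' P : (s <= s')%N -> PK s' P -> PK s P.
Proof. by move=> ss h l; exact: KS (h l). Qed.

Lemma PK1_Pb s P : PK s.+1 P -> Pb P.
Proof. by move=> h l; have [] := K1_bcont (h l). Qed.

Lemma PK0_Pb P Q : PK 0 P -> Pb Q -> PK 0 (fun t => P t * Q t).
Proof.
move=> hP hQ l; under eq_fun do rewrite coefM.
by apply: K_sum => i; apply: K0_bcont.
Qed.

Lemma PK_Xn s i P : PK s P -> PK s (fun t => 'X^i * P t).
Proof.
move=> h l; under eq_fun do rewrite coefXnM.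
by case: (l < i)%N; [exact: K0|exact: h].
Qed.

Lemma PbM P Q : Pb P -> Pb Q -> Pb (fun t => P t * Q t).
Proof.
move=> hP hQ l; under eq_fun do rewrite coefM.
by apply: bcont_sum => i; apply: bcontM.
Qed.

Lemma PbD P Q : Pb P -> Pb Q -> Pb (fun t => P t + Q t).
Proof. by move=> hP hQ l; under eq_fun do rewrite coefD; apply: bcontD. Qed.

Lemma PK_drop s i P : PK s P -> PK s (fun t => drop_poly i (P t)).
Proof. by move=> h l; under eq_fun do rewrite coef_drop_poly; exact: h. Qed.

Lemma psizeD P Q : psize P -> psize Q -> psize (fun t => P t + Q t).
Proof.
move=> [D hD] [D' hD']; exists (D + D')%N => t.
apply: (leq_trans (size_polyD _ _)); rewrite geq_max.
by rewrite (leq_trans (hD t)) ?leq_addr// (leq_trans (hD' t)) ?leq_addl.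
Qed.

Lemma psizeN P : psize P -> psize (fun t => - P t).
Proof. by move=> [D hD]; exists D => t; rewrite size_polyN. Qed.

Lemma psizeM P Q : psize P -> psize Q -> psize (fun t => P t * Q t).
Proof.
move=> [D hD] [D' hD']; exists (D + D')%N => t.
apply: (leq_trans (size_polyMleq _ _)); rewrite (leq_trans (leq_pred _))//.
exact: leq_add.
Qed.

Lemma psizeZ (a : R) P : psize P -> psize (fun t => a *: P t).
Proof. by move=> [D hD]; exists D => t; rewrite (leq_trans (size_scale_leq _ _)). Qed.

Lemma psize_mon f i : psize (pmon f i).
Proof.
exists i.+1 => t; apply/leq_sizeP => j ij; rewrite coef_pmon.
by case: eqP ij => // ->; rewrite ltnn.
Qed.

Lemma psize_cst (p : {poly R}) : psize (fun=> p).
Proof. by exists (size p). Qed.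

Lemma psize_drop i P : psize P -> psize (fun t => drop_poly i (P t)).
Proof.
by move=> [D hD]; exists D => t; rewrite size_drop_poly (leq_trans (leq_subr _ _)).
Qed.

Lemma Pder_mon f f' i : (forall t : R, 0 < t -> is_derive t 1 f (f' t)) ->
  Pder (pmon f i) (pmon f' i).
Proof.
move=> h l t t0; under eq_fun do rewrite coef_pmon; rewrite coef_pmon.
by case: eqP => _; [exact: h|exact: is_derive_cst].
Qed.

Lemma PderD P P' Q Q' : Pder P P' -> Pder Q Q' ->
  Pder (fun t => P t + Q t) (fun t => P' t + Q' t).
Proof.
move=> hP hQ l t t0; under eq_fun do rewrite coefD; rewrite coefD.
by apply: is_deriveD; [exact: hP|exact: hQ].
Qed.

Lemma PK_der s P : PK s.+1 P -> psize P ->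
  exists P', [/\ Pder P P', PK s P' & psize P'].
Proof.
move=> h [D hD].
have ex l : exists f', (forall t : R, 0 < t -> is_derive t 1 (fun t => (P t)`_l) (f' t)) /\ Kclass N s f'.
  by have [_ _ [f' df kf]] := h l; exists f'.
pose f' l := sval (cid (ex l)).
have hf' l : (forall t : R, 0 < t -> is_derive t 1 (fun t => (P t)`_l) (f' l t)) /\ Kclass N s (f' l).
  by rewrite /f'; case: cid.
exists (fun t => \poly_(l < D) f' l t); split.
- move=> l t t0; rewrite coef_poly; case: ltnP => lD; first by case: (hf' l) => + _; exact.
  have E : (fun t => (P t)`_l) = fun=> 0.
    by apply/funext => x; rewrite nth_default// (leq_trans (hD x)).
  by rewrite E; exact: is_derive_cst.
- move=> l; under eq_fun do rewrite coef_poly.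
  by case: (l < D)%N; [case: (hf' l)|exact: K0].
- by exists D => t; exact: size_poly.
Qed.

End PolynomialFunctions.

Section Riccati.
Variable R : realType.
Notation mu := (@lebesgue_measure R).
Variable N : nat.
Variables (lam : R) (g0 g1 g2 : R -> R) (m : nat).
Hypothesis lam2 : lam ^+ 2 = 1.
Hypothesis hg0 : Kclass N ((m + 5) %/ 3) g0.
Hypothesis hg1 : Kclass N ((m + 4) %/ 3) g1.
Hypothesis hg2 : Kclass N ((m + 3) %/ 3) g2.

Definition gG (t : R) : R := g2 t - 2 * lam * g0 t ^+ 3.

(** With [kappa = - i k] and [z = 1 / kappa], the entries of the Lax matrix
    divided by [kappa ^ 2 = - k ^ 2] are polynomials in [z] with real
    coefficients. *)
Definition v12 (t : R) : {poly R} :=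
  pmon (fun t => 4 * g0 t) 0 t + pmon (fun t => - 2 * g1 t) 1 t + pmon gG 2 t.
Definition v21 (t : R) : {poly R} :=
  pmon (fun t => lam * (4 * g0 t)) 0 t + pmon (fun t => lam * (2 * g1 t)) 1 t +
  pmon (fun t => lam * gG t) 2 t.
Definition v22 (t : R) : {poly R} := pmon (fun t => - 2 * lam * g0 t ^+ 2) 1 t.

(** The residual of the Riccati equation of [u / v], multiplied by [z ^ 3];
    the leading term [8 W] comes from the exponent [8 kappa ^ 3]. *)
Definition riccati (W W' : R -> {poly R}) (t : R) : {poly R} :=
  - (8%:R *: W t) + 'X * (v12 t - 2%:R *: (v22 t * W t) - v21 t * (W t * W t)) -
  'X^3 * W' t.

(** The number of derivatives available: solving for the coefficient of order
    [l] costs one derivative of the coefficient of order [l - 3], so three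
    orders cost one derivative of the data. *)
Definition ord (l : nat) : nat := (m + 6 - l) %/ 3.

Lemma ord_le l l' : (l <= l')%N -> (ord l' <= ord l)%N.
Proof. by move=> h; apply: leq_div2r; rewrite leq_sub2l. Qed.

Lemma KG : Kclass N ((m + 3) %/ 3) gG.
Proof.
have h0 : Kclass N ((m + 3) %/ 3) g0.
  by apply: KS hg0; apply: leq_div2r; rewrite leq_add2l.
have m0 : (0 < (m + 3) %/ 3)%N by rewrite divn_gt0// leq_addl.
apply: KD => //; apply: KN; apply: KZ.
have -> : (fun t => g0 t ^+ 3) = (fun t => g0 t * (g0 t * g0 t)).
  by apply/funext => t; ring.
by apply: (KM (leqnn _)) => //; apply: (KM (leqnn _)).
Qed.

Lemma v12_K l : (l <= m.+2)%N -> PKm N l (ord l.+1) v12.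
Proof.
move=> lm; apply: PKmD; [apply: PKmD|]; apply: PKm_mon => h.
- by apply: KZ; apply: KS hg0; apply: leq_div2r; lia.
- by apply: KZ; apply: KS hg1; apply: leq_div2r; lia.
- by apply: KS KG; apply: leq_div2r; lia.
Qed.

Lemma v21_K l : (l <= m.+2)%N -> PKm N l (ord l.+1) v21.
Proof.
move=> lm; apply: PKmD; [apply: PKmD|]; apply: PKm_mon => h; apply: KZ.
- by apply: KZ; apply: KS hg0; apply: leq_div2r; lia.
- by apply: KZ; apply: KS hg1; apply: leq_div2r; lia.
- by apply: KS KG; apply: leq_div2r; lia.
Qed.

Lemma v22_K l : (l <= m.+2)%N -> PKm N l (ord l.+1) v22.
Proof.
move=> lm; apply: PKm_mon => h; apply: KZ.
have h0 : Kclass N (ord l.+1) g0 by apply: KS hg0; apply: leq_div2r; lia.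
have o0 : (0 < ord l.+1)%N by rewrite /ord divn_gt0//; lia.
by under eq_fun do rewrite expr2; apply: (KM (leqnn _)).
Qed.

(** The coefficient of order [n + 1] of the residual is [- 8 w_(n + 1)] plus
    terms in lower coefficients and in the derivative of [w_(n - 2)]; it can
    be made zero as long as that derivative exists. *)
Lemma riccati_solution n : (n <= m + 3)%N -> exists W W' : R -> {poly R},
  [/\ psize W /\ psize W', (forall t l, (l == 0) || (n < l)%N -> (W t)`_l = 0 /\ (W' t)`_l = 0),
   (forall l, Kclass N (ord l) (fun t => (W t)`_l) /\
      Kclass N (ord l).-1 (fun t => (W' t)`_l)), Pder W W' &
   forall t l, (l <= n)%N -> (riccati W W' t)`_l = 0].
Proof.
elim: n => [_|n IH nm].
  exists (fun=> 0), (fun=> 0); split.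
  - by split; exact: psize_cst.
  - by move=> t l _; rewrite coef0.
  - by move=> l; split; under eq_fun do rewrite coef0; exact: K0.
  - by move=> l t t0; under eq_fun do rewrite coef0; rewrite coef0; exact: is_derive_cst.
  - move=> t l; rewrite leqn0 => /eqP ->; rewrite /riccati.
    by rewrite !(coefD, coefN, coefXM, coefXnM, coefZ, coef0) /= mulr0 oppr0 !addr0.
have [W [W' [[sW sW'] W0 KW dW rW]]] := IH (ltnW nm).
set s := ord n.+1.
have s0 : (0 < s)%N by rewrite /s /ord divn_gt0//; lia.
have nm2 : (n <= m.+2)%N by lia.
have PW : PKm N n s W.
  by move=> l ln; apply: KS (KW l).1; apply: ord_le; exact: leqW.
have K1 : Kclass N s (fun t => (v12 t - 2%:R *: (v22 t * W t) - v21 t * (W t * W t))`_n).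
  suff : PKm N n s (fun t => v12 t - 2%:R *: (v22 t * W t) - v21 t * (W t * W t)).
    by move=> /(_ n (leqnn n)).
  apply: PKmD; last first.
    by apply: PKmN; apply: (PKmM s0); [exact: v21_K|exact: PKmM].
  apply: PKmD; first exact: v12_K.
  by apply: PKmN; apply: PKmZ; apply: (PKmM s0) => //; exact: v22_K.
have K2 : Kclass N s (fun t => if (n.+1 < 3)%N then 0 else (W' t)`_(n.+1 - 3)).
  case: ltnP => n3; first exact: K0.
  have := (KW (n.+1 - 3)%N).2; apply: KS; rewrite /s /ord.
  have -> : (m + 6 - (n.+1 - 3) = (m + 6 - n.+1) + 3)%N by lia.
  by rewrite divnDr// divnn addn1.
(* the residual is affine in the new coefficient, with slope - 8 *)
pose w t := (riccati W W' t)`_n.+1 / 8%:R.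
have Kw : Kclass N s w.
  rewrite /w; under eq_fun do rewrite mulrC.
  apply: KZ; rewrite /riccati.
  have -> : (fun t => (- (8%:R *: W t) + 'X *
     (v12 t - 2%:R *: (v22 t * W t) - v21 t * (W t * W t)) - 'X^3 * W' t)`_n.+1) =
     (fun t => (v12 t - 2%:R *: (v22 t * W t) - v21 t * (W t * W t))`_n -
       (if (n.+1 < 3)%N then 0 else (W' t)`_(n.+1 - 3))).
    apply/funext => t; set q := (v12 t - _ - _).
    rewrite coefB coefD coefXM coefXnM coefN coefZ.
    by have [|-> _] := W0 t n.+1; rewrite ?ltnSn ?orbT// mulr0 oppr0 add0r.
  by apply: KD => //; exact: KN.
have [w' dw Kw'] : exists2 w', (forall t : R, 0 < t -> is_derive t 1 w (w' t)) &
    Kclass N s.-1 w'.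
  by move: s0 Kw; case: (s) => // s' _ [_ _ ?].
exists (fun t => W t + pmon w n.+1 t), (fun t => W' t + pmon w' n.+1 t); split.
- by split; apply: psizeD => //; exact: psize_mon.
- move=> t l; rewrite !coefD !coef_pmon; have [-> |ln] := eqVneq l n.+1.
    by rewrite /= ltnn.
  move=> hl.
  have [|-> ->] := W0 t l; last by rewrite !addr0.
  by case/orP: hl => [->//|/ltnW ->]; rewrite orbT.
- move=> l; split; under eq_fun do rewrite coefD coef_pmon.
    apply: KD; first exact: (KW l).1.
    by case: eqP => [->|_] //; exact: K0.
  apply: KD; first exact: (KW l).2.
  by case: eqP => [->|_] //; exact: K0.
- by apply: PderD => //; exact: Pder_mon.
- move=> t l ln.
  pose Q := - 2%:R *: (v22 t * (w t)%:P) - v21 t * (2%:R *: (W t * (w t)%:P) +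
     (w t)%:P * (w t)%:P * 'X^(n.+1)) - 'X^2 * (w' t)%:P.
  have -> : riccati (fun t => W t + pmon w n.+1 t) (fun t => W' t + pmon w' n.+1 t) t =
     riccati W W' t - (8%:R * w t)%:P * 'X^(n.+1) + 'X^(n.+2) * Q.
    rewrite /riccati /pmon /Q -!mul_polyC [(8%:R * w t)%:P]polyCM.
    rewrite (exprS 'X n.+1); move: 'X^(n.+1) => x; ring.
  rewrite coefD coefB coefXnM ltnS ln addr0 coefCM coefXn.
  have [->|ln1] := eqVneq l n.+1.
    by rewrite mulr1 /w mulrC divfK ?subrr// pnatr_eq0.
  rewrite mulr0 subr0 rW//; move: ln; rewrite leq_eqVlt (negbTE ln1) /=.
  by rewrite ltnS.
Qed.

End Riccati.

Section FormalDiagonal.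
Variable R : realType.
Notation mu := (@lebesgue_measure R).
Variable N : nat.

(** The equation [v' = h v] with [h = z ht] is solved order by order: the
    factor [z] makes the right-hand side of each coefficient a combination of
    lower ones, and integrating from infinity keeps the coefficients bounded,
    though their weighted integrability is lost. *)
Lemma formal_exponential (ht : R -> {poly R}) (n : nat) : PK N 0 ht ->
  exists VV VV' : R -> {poly R},
  [/\ psize VV /\ psize VV', Pb VV /\ PK N 0 VV', Pder VV VV',
   forall t, (VV t)`_0 = 1 /\ (forall l, (n < l)%N -> (VV t)`_l = 0 /\ (VV' t)`_l = 0) &
   (forall l, (0 < l)%N -> rlim (fun t => (VV t)`_l) 0) /\
   forall t l, (l <= n)%N -> ('X * ht t * VV t - VV' t)`_l = 0].
Proof.
move=> hK; elim: n => [|n [VV [VV' [[sV sV'] [bV kV] dV V0 [lV rV]]]]].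
  exists (fun=> 1), (fun=> 0); split.
  - by split; exact: psize_cst.
  - split=> l; last by under eq_fun do rewrite coef0; exact: K0.
    exact: bcont_cst.
  - by move=> l t t0; rewrite coef0; exact: is_derive_cst.
  - by move=> t; split => [|l l0]; rewrite ?coef0 coef1// gtn_eqF.
  - split; last by move=> t l; rewrite leqn0 => /eqP ->; rewrite subr0 mulr1 coefXM.
    move=> l l0 e e0; exists 0 => // t _.
    by rewrite coef1 gtn_eqF// subrr normr0 ltW.
pose f t := (ht t * VV t)`_n.
have Kf : Kclass N 0 f by exact: (PK0_Pb hK bV).
have fi := K0_inth Kf; have [cf _ _] := Kf.
pose v t := - \int[mu]_(s in `[t, +oo[) f s.
have dv (t : R) : 0 < t -> is_derive t 1 v (f t).
  move=> t0; rewrite -(opprK (f t)); apply: is_deriveN.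
  by apply: is_derive_tail => //; exact: conth_for.
have bv : bcont v.
  split; first by apply: conthN; exact: conth_tail.
  exists (\int[mu]_(s in `[0, +oo[) `|f s|) => t t0; rewrite normrN.
  apply: le_trans (le_normr_Rintegral _ _) _ => //; first exact: inth_tail.
  by apply: (@le_tail _ (fun s => `|f s|)) => //; exact: integrable_norm.
have lv : rlim v 0.
  move=> e e0; have [L L0 hL] := norm_tail_cvg0 fi e0; exists L => // t Lt.
  by rewrite subr0 normrN hL.
exists (fun t => VV t + pmon v n.+1 t), (fun t => VV' t + pmon f n.+1 t); split.
- by split; apply: psizeD => //; exact: psize_mon.
- split; last by apply: PKD => //; exact: PK_mon.
  apply: PbD => // l; under eq_fun do rewrite coef_pmon.
  by case: eqP => _ //; exact: bcont_cst.
- by apply: PderD => //; exact: Pder_mon.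
- move=> t; have [h0 h1] := V0 t; split => [|l nl]; rewrite !coefD !coef_pmon.
    by rewrite h0 /= addr0.
  by have [-> ->] := h1 _ (ltnW nl); rewrite gtn_eqF// !addr0.
- split=> [l l0|t l ln].
    have [ln e e0|ln e e0] := eqVneq l n.+1.
      have [L L0 hL] := lv e e0; exists L => // t Lt.
      have [/(_ (ltnSn n))[V1 _]] := ((V0 t).2 n.+1, tt).
      by rewrite coefD coef_pmon ln eqxx V1 add0r hL.
    have [L L0 hL] := lV l l0 e e0; exists L => // t Lt.
    by rewrite coefD coef_pmon (negbTE ln) addr0 hL.
  have -> : 'X * ht t * (VV t + pmon v n.+1 t) - (VV' t + pmon f n.+1 t) =
    ('X * ht t * VV t - VV' t) - (f t)%:P * 'X^(n.+1) + 'X^(n.+2) * (ht t * (v t)%:P).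
    by rewrite /pmon (exprS 'X n.+1); move: 'X^(n.+1) => x; ring.
  rewrite coefD [(_ - _ * 'X^(n.+1))`_l]coefB coefXnM ltnS ln addr0 coefCM coefXn.
  have [->|ln1] := eqVneq l n.+1; last first.
    rewrite mulr0 subr0 rV//; move: ln; rewrite leq_eqVlt (negbTE ln1) /=.
    by rewrite ltnS.
  rewrite mulr1 coefB -mulrA coefXM /= -/(f t).
  by have [_ ->] := (V0 t).2 n.+1 (ltnSn n); rewrite subr0 subrr.
Qed.

End FormalDiagonal.

Section ComplexEvaluation.
Variable R : realType.
Implicit Types (P Q : R -> {poly R}) (p q : {poly R}) (z : R[i]).

Definition ev p z : R[i] := (map_poly (real_complex R) p).[z].

Lemma evD p q z : ev (p + q) z = ev p z + ev q z.
Proof. by rewrite /ev rmorphD hornerD. Qed.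
Lemma evN p z : ev (- p) z = - ev p z.
Proof. by rewrite /ev rmorphN hornerN. Qed.
Lemma evM p q z : ev (p * q) z = ev p z * ev q z.
Proof. by rewrite /ev rmorphM hornerM. Qed.
Lemma evZ a p z : ev (a *: p) z = a%:C * ev p z.
Proof. by rewrite -mul_polyC evM /ev map_polyC hornerC. Qed.
Lemma evC a z : ev a%:P z = a%:C.
Proof. by rewrite /ev map_polyC hornerC. Qed.
Lemma evXn i z : ev 'X^i z = z ^+ i.
Proof. by rewrite /ev map_polyXn hornerXn. Qed.
Lemma evX z : ev 'X z = z.
Proof. by rewrite /ev map_polyX hornerX. Qed.
Lemma ev_mon (f : R -> R) i t z : ev (pmon f i t) z = (f t)%:C * z ^+ i.
Proof. by rewrite evM evC evXn. Qed.

Definition evE := (evD, evN, evM, evZ, evC, evXn, evX, ev_mon).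

Lemma ev_sum p z (D : nat) : (size p <= D)%N -> ev p z = \sum_(l < D) (p`_l)%:C * z ^+ l.
Proof.
move=> pD; rewrite /ev (@horner_coef_wide _ D) ?(leq_trans (size_poly _ _))//.
by apply: eq_bigr => l _; rewrite coef_map.
Qed.

Lemma ev_drop p z (i : nat) : (forall l, (l < i)%N -> p`_l = 0) ->
  ev p z = z ^+ i * ev (drop_poly i p) z.
Proof.
move=> h; rewrite -{1}(poly_take_drop i p).
have -> : take_poly i p = 0.
  by apply/polyP => l; rewrite coef_take_poly coef0; case: ltnP => // /h.
by rewrite add0r !evE mulrC.
Qed.

Lemma cconth_ev P z : psize P -> (forall l, conth (fun t => (P t)`_l)) ->
  cconth (fun t => ev (P t) z).
Proof.
move=> [D hD] h.
apply: (@eq_cconth _ (fun t => \sum_(l < D) ((P t)`_l)%:C * z ^+ l)).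
  by move=> t _; rewrite (ev_sum _ (hD t)).
apply: cconth_sum => l _; apply: cconthM; last exact: cconth_cst.
exact: cconth_real.
Qed.

Lemma cder_ev P P' z : psize P -> psize P' -> Pder P P' ->
  cder (fun t => ev (P t) z) (fun t => ev (P' t) z).
Proof.
move=> [D hD] [D' hD'] h.
have E (Q : R -> {poly R}) (B : nat) : (forall t, (size (Q t) <= B)%N) ->
    (fun t => ev (Q t) z) = (fun t => \sum_(l < B) ((Q t)`_l)%:C * z ^+ l).
  by move=> hB; apply/funext => t; exact: ev_sum.
rewrite (E P (D + D')%N); last by move=> t; rewrite (leq_trans (hD t))// leq_addr.
rewrite (E P' (D + D')%N); last by move=> t; rewrite (leq_trans (hD' t))// leq_addl.
apply: cder_sum => l.
have := cderM (cder_real (h l)) (cder_cst (z ^+ l)).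
by apply: eq_cder => t _; rewrite mulr0 addr0.
Qed.

Lemma clim_ev0 P z : psize P -> (forall l, rlim (fun t => (P t)`_l) 0) ->
  clim (fun t => ev (P t) z) 0.
Proof.
move=> [D hD] h.
apply: (@clim_eq _ (fun t => \sum_(l < D) z ^+ l * ((P t)`_l)%:C)).
  move=> t _; rewrite (ev_sum _ (hD t)); apply: eq_bigr => l _; exact: mulrC.
have : forall r : seq nat, clim (fun t => \sum_(l <- r) z ^+ l * ((P t)`_l)%:C) 0.
  elim=> [|l r IH]; first by under eq_fun do rewrite big_nil; exact: clim_cst.
  have := climD (clim0Z (z ^+ l) (clim0_real (h l))) IH; rewrite addr0.
  by apply: clim_eq => t _; rewrite big_cons.
move=> /(_ (iota 0 D)); apply: clim_eq => t _.
by rewrite -(big_mkord xpredT (fun l => z ^+ l * ((P t)`_l)%:C)) /index_iota subn0.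
Qed.

Lemma bounded_ev P z : psize P -> Pb P ->
  exists M : R, forall t, 0 <= t -> nc (ev (P t) z) <= M.
Proof.
move=> [D hD] h.
have ex l : exists M : R, forall t, 0 <= t -> `|(P t)`_l| <= M by case: (h l).
exists (\sum_(l < D) sval (cid (ex l)) * nc z ^+ l) => t t0.
rewrite (ev_sum _ (hD t)); apply: (le_trans (nc_sum _ _ _)).
apply: ler_sum => l _; rewrite ncM ncX nc_real ler_wpM2r ?exprn_ge0 ?nc_ge0//.
by case: cid => /= M; exact.
Qed.

End ComplexEvaluation.

(** * The spectral column as the solution of a Volterra system *)

Section VolterraODE.
Variable R : realType.
Notation mu := (@lebesgue_measure R).
Implicit Types (f g y : R -> R[i]) (th : R[i]).

Lemma cexp_shift th (s t : R) : cexp (th * s%:C) = cexp (th * t%:C) * cexp (th * (s - t)%:C).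
Proof. by rewrite -cexpD; congr cexp; rewrite rmorphB /=; ring. Qed.

Lemma nc_cexp_shift_le1 th (t s : R) : complex.Re th <= 0 -> t <= s ->
  nc (cexp (th * (s - t)%:C)) <= 1.
Proof.
move=> h ts; apply: nc_cexp_le1; rewrite ReM /= mulr0 subr0.
by rewrite mulr_le0_ge0// subr_ge0.
Qed.

(** Variation of constants; the boundary term at infinity vanishes because the
    exponential stays bounded while [y] tends to 0. *)
Lemma volterra_of_ode th y g (G : R -> R) : complex.Re th <= 0 ->
  cconth y -> cconth g -> inth G -> (forall s, 0 <= s -> nc (g s) <= G s) ->
  cder y (fun t => - th * y t + g t) -> clim y 0 ->
  forall t, 0 <= t -> y t = - integralC `[t, +oo[ (fun s => cexp (th * (s - t)%:C) * g s).
Proof.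
move=> hth cy cg iG gG dy ly t t0.
pose M := expR (- (complex.Re th * t)).
have cM (s : R) : 0 <= s -> nc (cexp (th * (s - t)%:C)) <= M.
  move=> s0; rewrite nc_cexp ReM /= mulr0 subr0 /M ler_expR.
  by have := mulr_le0_ge0 hth s0; lra.
have cf : cconth (fun s => cexp (th * (s - t)%:C) * y s).
  by apply: cconthM => //; exact: cconth_cexp_lin.
have cfg : cconth (fun s => cexp (th * (s - t)%:C) * g s).
  by apply: cconthM => //; exact: cconth_cexp_lin.
have ig : integrableC `[(0 : R), +oo[ (fun s => cexp (th * (s - t)%:C) * g s).
  apply: (@integrableC_le _ _ _ (fun s => M * G s)) => //.
  - exact: cconth_cmeas.
  - exact: inthZ.
  move=> s /=; rewrite in_itv /= andbT => s0; rewrite ncM ler_pM ?nc_ge0//.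
    exact: cM.
  exact: gG.
have df : cder (fun s => cexp (th * (s - t)%:C) * y s)
    (fun s => cexp (th * (s - t)%:C) * g s).
  apply: eq_cder (cderM (cder_cexp_lin th t) dy) => s _; ring.
have lf : clim (fun s => cexp (th * (s - t)%:C) * y s) 0.
  exact: clim0M cM ly.
have := FTC_ctail cf cfg ig df lf t0.
by rewrite subrr mulr0 cexp0 mul1r sub0r.
Qed.

Lemma ode_of_volterra th y g : cconth g ->
  integrableC `[(0 : R), +oo[ (fun s => cexp (th * s%:C) * g s) ->
  (forall t, 0 <= t -> y t = - integralC `[t, +oo[ (fun s => cexp (th * (s - t)%:C) * g s)) ->
  cder y (fun t => - th * y t + g t).
Proof.
move=> cg ig hy.
have E t : 0 <= t -> y t = cexp (- th * (t - 0)%:C) *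
    - integralC `[t, +oo[ (fun s => cexp (th * s%:C) * g s).
  move=> t0; rewrite hy// mulrN; congr (- _); rewrite -integralCZ//.
    apply: eq_integralC => s _; rewrite mulrA -cexpD subr0; congr (cexp _ * _).
    by rewrite rmorphB /=; ring.
  by apply: integrableCS ig => //; exact: sub_tail.
have cfg : cconth (fun s => cexp (th * s%:C) * g s).
  apply: cconthM => //; have := @cconth_cexp_lin R th 0.
  by under eq_fun do rewrite subr0.
have d1 := cderM (cder_cexp_lin (- th) 0) (cderN (cder_ctail cfg ig)).
move=> t t0; have [h1 h2] := d1 t t0.
have nE : \forall s \near t, y s = cexp (- th * (s - 0)%:C) *
    - integralC `[s, +oo[ (fun s => cexp (th * s%:C) * g s).
  exists t => //= s; rewrite /ball_ /= ltr_norml => /andP[_].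
  by rewrite ltrBlDr ltrDl => s0; apply: E; exact: ltW.
have V : - th * y t + g t = - th * cexp (- th * (t - 0)%:C) *
    - integralC `[t, +oo[ (fun s => cexp (th * s%:C) * g s) +
    cexp (- th * (t - 0)%:C) * - - (cexp (th * t%:C) * g t).
  rewrite E ?ltW// opprK mulrA subr0 -cexpD.
  have -> : - th * t%:C + th * t%:C = 0 by ring.
  by rewrite cexp0 mul1r mulrA.
rewrite V; split.
  apply: near_eq_is_derive h1; move: nE; apply: filterS => s ->; by [].
apply: near_eq_is_derive h2; move: nE; apply: filterS => s ->; by [].
Qed.

End VolterraODE.

Section SpectralColumn.
Variable R : realType.
Notation mu := (@lebesgue_measure R).
Variables (N : nat) (lam : R) (g : 'I_3 -> R -> R).
Let g0 := g 0. Let g1 := g 1. Let g2 := g 2.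
Let G := gG lam g0 g2.

(** In this variable the coefficients of the system are real. *)
Definition kap (k : R[i]) : R[i] := - 'i%C * k.

(** The coefficient matrices of the powers of [kappa] are real: this is the
    source of the symmetry under [k -> - conj k]. *)
Definition lax (l : nat) (b b' : bool) (t : R) : R :=
  match l, b, b' with
  | 0%N, true, false => G t
  | 0%N, false, true => lam * G t
  | 1%N, true, true => 2 * lam * g0 t ^+ 2
  | 1%N, true, false => - (2 * g1 t)
  | 1%N, false, true => 2 * lam * g1 t
  | 1%N, false, false => - (2 * lam * g0 t ^+ 2)
  | 2%N, true, false => 4 * g0 t
  | 2%N, false, true => 4 * lam * g0 t
  | _, _, _ => 0
  end.

Definition laxrow k b (Y : bool -> R -> R[i]) (s : R) : R[i] :=
  \sum_(l < 3) kap k ^+ l * src (lax l) Y b s.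

Lemma laxrow_true k Y s : laxrow k true Y s =
  (2 * lam * g0 s ^+ 2)%:C * kap k * Y true s +
  (4 * (g0 s)%:C * kap k ^+ 2 - 2 * (g1 s)%:C * kap k + (G s)%:C) * Y false s.
Proof.
rewrite /laxrow !big_ord_recr big_ord0 /= /src /= expr0 expr1.
rewrite ?(rmorph0, rmorphN, rmorphXn, rmorphM, rmorph_nat); ring.
Qed.

Lemma laxrow_false k Y s : laxrow k false Y s =
  lam%:C * (4 * (g0 s)%:C * kap k ^+ 2 + 2 * (g1 s)%:C * kap k + (G s)%:C) * Y true s -
  (2 * lam * g0 s ^+ 2)%:C * kap k * Y false s.
Proof.
rewrite /laxrow !big_ord_recr big_ord0 /= /src /= expr0 expr1.
rewrite ?(rmorph0, rmorphN, rmorphXn, rmorphM, rmorph_nat); ring.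
Qed.

Definition idx (b : bool) : 'I_2 := if b then 0 else 1.

Hypothesis lam2 : lam ^+ 2 = 1.

Lemma Vmx_row k b (Tm : 'M[R[i]]_2) s :
  (Vmx lam g s k *m Tm) (idx b) 1 = laxrow k b (fun b' _ => Tm (idx b') 1) s.
Proof.
have i2 : ('i%C : R[i]) ^+ 2 = -1 by rewrite sqr_i.
have l2 : (lam%:C : R[i]) ^+ 2 = 1 by rewrite -rmorphXn lam2 rmorph1.
rewrite mxE !big_ord_recl big_ord0 addr0.
have -> : lift ord0 ord0 = 1 :> 'I_2 by exact/val_inj.
rewrite !mxE /idx; case: b => /=.
  rewrite laxrow_true /kap /G /gG /g0 /g1 /g2 ?(rmorphB, rmorphXn, rmorphM, rmorph_nat) /=.
  have -> : Tm ord0 1 = Tm 0 1 by [].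
  ring: i2.
rewrite laxrow_false /kap /G /gG /g0 /g1 /g2 ?(rmorphB, rmorphXn, rmorphM, rmorph_nat) /=.
have -> : Tm ord0 1 = Tm 0 1 by [].
ring: i2 l2.
Qed.

End SpectralColumn.

Section ColumnOfT.
Variable R : realType.
Notation mu := (@lebesgue_measure R).
Variables (N : nat) (lam : R) (g : 'I_3 -> R -> R) (T : R -> R[i] -> 'M[R[i]]_2).
Hypothesis lam2 : lam ^+ 2 = 1.
Hypothesis hT : volterra_solution lam g T.
Hypothesis hlax : forall l, weighted_L1 N (lax lam g l).

Let phi := lax lam g.
Definition col (k : R[i]) (b : bool) (t : R) : R[i] := T t k (idx b) 1.
Definition free (b : bool) (t : R) : R[i] := if b then 0 else 1.

Lemma exp_hat_row (c : R[i]) (M : 'M[R[i]]_2) b :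
  exp_hat_sigma3 c M (idx b) 1 = (if b then cexp (2 * c) else 1) * M (idx b) 1.
Proof.
rewrite /exp_hat_sigma3 /exp_sigma3 !mxE !big_ord_recl big_ord0 addr0.
have -> : lift ord0 ord0 = 1 :> 'I_2 by exact/val_inj.
rewrite !mxE !big_ord_recl !big_ord0 !addr0.
have -> : lift ord0 ord0 = 1 :> 'I_2 by exact/val_inj.
rewrite !mxE /=; case: b => /=; rewrite !mulr0 !mul0r ?add0r ?addr0 opprK.
  rewrite (_ : 2 * c = c + c); last by ring.
  by rewrite cexpD; ring.
by rewrite mulrAC cexpNK.
Qed.

(** By continuity from the open domain, where the real part of [8 i k ^ 3] is
    [- 8 Im (k ^ 3)]. *)
Lemma Re_theta_closure_Dplus (k : R[i]) : closure Dplus k -> complex.Re (theta true k) <= 0.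
Proof.
move=> cl; have Re_th (z : R[i]) : complex.Re (theta true z) = - (8 * complex.Im (z ^+ 3)) :> R.
  rewrite /theta -(rmorph_nat (real_complex R) 8) !exprS expr0 mulr1 !ReImE /=; ring.
rewrite leNgt; apply/negP => h.
have [C C0 hC] := theta_lipschitz k.
pose e := complex.Re (theta true k).
have e0 : 0 < e by [].
have d0 : 0 < Num.min 1 (e / 2 / C) by rewrite lt_min ltr01 !divr_gt0.
have [k' Dk' kk] := (closure_nc _ _).1 cl _ d0.
move: kk; rewrite lt_min => /andP[k1 k2].
have h1 := hC true k' (ltW k1).
have h2 : `|complex.Re (theta true k') - e| <= C * nc (k' - k).
  by apply: le_trans h1; rewrite /e -ReN -ReD; exact: Re_nc.
have h3 : C * nc (k' - k) < e / 2 by rewrite mulrC -ltr_pdivlMr.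
have h4 : complex.Re (theta true k') < 0.
  by rewrite Re_th oppr_lt0 mulr_gt0//; case: Dk' => [[]|[]].
by move: h2; rewrite ler_norml => /andP[+ _]; move: h3 h4 e0; lra.
Qed.

Variable k : R[i].
Hypothesis hk : closure Dplus k.
Let th := theta true k.
Let hth : complex.Re th <= 0 := Re_theta_closure_Dplus hk.

Lemma col_eq b t : 0 <= t ->
  integrableC `[t, +oo[ (fun s => cexp (theta b k * (s - t)%:C) * laxrow lam g k b (col k) s) /\
  col k b t = free b t -
    integralC `[t, +oo[ (fun s => cexp (theta b k * (s - t)%:C) * laxrow lam g k b (col k) s).
Proof.
move=> t0; have := hT (idx b) (j := 1) t0 hk.
have E s : exp_hat_sigma3 (4 * 'i%C * k ^+ 3 * (s - t)%:C)
    (Vmx lam g s k *m T s k) (idx b) 1 =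
    cexp (theta b k * (s - t)%:C) * laxrow lam g k b (col k) s.
  rewrite exp_hat_row Vmx_row//; congr (_ * _).
  rewrite /theta; case: b; first by congr cexp; ring.
  by rewrite mul0r cexp0.
rewrite /=; under [X in integrableC _ X]eq_fun do rewrite E.
under [X in integralC _ X]eq_fun do rewrite E.
by move=> [h1 h2]; split => //; rewrite /col h2 mxE /free; case: b {E h1 h2}.
Qed.

(** The column with its exponential factor undone: its Volterra equation
    contains [t] only as a limit of integration. *)
Let hat (b : bool) (t : R) := cexp (theta b k * t%:C) * col k b t.

Lemma hat_integrable b :
  integrableC `[(0 : R), +oo[ (fun s => cexp (theta b k * s%:C) * laxrow lam g k b (col k) s).
Proof.
have [h _] := col_eq b (lexx 0).
by apply: eq_integrableC h => // s _; rewrite subr0.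
Qed.

Lemma hat_tail b t : 0 <= t -> hat b t = free b t -
  integralC `[t, +oo[ (fun s => cexp (theta b k * s%:C) * laxrow lam g k b (col k) s).
Proof.
move=> t0; have [h e] := col_eq b t0; rewrite /hat e mulrBr -integralCZ//.
congr (_ - _).
  by rewrite /free; case: b {h e}; rewrite ?mulr0// /theta mul0r cexp0 mul1r.
by apply: eq_integralC => s _; rewrite mulrA -cexp_shift.
Qed.

Lemma col_cconth b : cconth (col k b).
Proof.
apply: (@eq_cconth _ (fun t => cexp (- theta b k * (t - 0)%:C) * (free b t -
  integralC `[t, +oo[ (fun s => cexp (theta b k * s%:C) * laxrow lam g k b (col k) s)))).
  move=> t t0; rewrite -hat_tail// /hat mulrA subr0 -cexpD.
  by rewrite (_ : - theta b k * t%:C + theta b k * t%:C = 0) ?cexp0 ?mul1r//; ring.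
apply: cconthM; first exact: cconth_cexp_lin.
apply: cconthD; first by rewrite /free; case: b; exact: cconth_cst.
by apply: cconthN; apply: cconth_ctail; exact: hat_integrable.
Qed.

Lemma col_adm : adm (col k).
Proof. by move=> b; apply: cconth_cmeas; exact: col_cconth. Qed.

Let C := 1 + nc (kap k) + nc (kap k) ^+ 2.
Let C0 : 0 <= C. Proof. by rewrite !addr_ge0 ?exprn_ge0 ?nc_ge0. Qed.
Let hC l : (l < 3)%N -> nc (kap k ^+ l) <= C.
Proof.
have n0 := nc_ge0 (kap k); have n2 := exprn_ge0 2 n0.
rewrite ncX /C; case: l => [|[|[|//]]] _; rewrite ?expr0 ?expr1; lra.
Qed.

Let Phi s := C * \sum_(l < 3) total (phi l) s.

Lemma nc_laxrow b Y s (a1 a2 : R) : nc (Y true s) <= a1 -> nc (Y false s) <= a2 ->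
  nc (laxrow lam g k b Y s) <= Phi s * (a1 + a2).
Proof.
move=> h1 h2; have a10 := le_trans (nc_ge0 _) h1; have a20 := le_trans (nc_ge0 _) h2.
have -> : Phi s * (a1 + a2) = \sum_(l < 3) C * (total (phi l) s * (a1 + a2)).
  by rewrite -mulr_sumr -mulr_suml mulrA.
apply: le_trans (nc_sum _ _ _) _; apply: ler_sum => l _.
rewrite ncM ler_pM ?nc_ge0 ?hC//.
have tot b' : `|phi l b b' s| <= total (phi l) s.
  have n b1 b2 : 0 <= `|phi l b1 b2 s| by [].
  have := (n true true, n true false, n false true, n false false).
  by rewrite /total => -[[[]]] *; case: (b); case: b'; lra.
by apply: le_trans (ncD _ _) _; rewrite !ncM !nc_real mulrDr lerD// ler_pM ?nc_ge0.
Qed.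

(** The Volterra equation alone only bounds [exp (theta t) u], so a priori [u]
    could grow like [exp (- theta t)]. The Volterra equation for [exp (theta
    t) u] is fed by [v], which is bounded, times the decreasing function [eta
    = |exp (theta t)|]; iterating the contraction replaces the crude bound of
    [exp (theta t) u] by a multiple of [eta]. *)
Lemma col_bounded : exists B, bnd (col k) B.
Proof.
pose om := omega 3 phi C.
have om1 t : 1 <= om t := omega_ge1 3 phi C0 t.
have iPhi : inth Phi.
  have := inthZ C (sum_total_inth hlax (iota 0 3)).
  apply: eq_inth => s _; rewrite /Phi.
  by rewrite -(big_mkord xpredT (fun l => total (phi l) s)) /index_iota subn0.
have Phi0 s : 0 <= Phi s.
  by rewrite /Phi mulr_ge0// sumr_ge0// => l _; exact: total_ge0.
have hatb b : exists B, forall t, 0 <= t -> nc (hat b t) <= B.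
  apply: (@cconth_clim_bounded _ _ (free b 0)).
    apply: cconthM; last exact: col_cconth.
    by have := cconth_cexp_lin (theta b k) 0; under eq_fun do rewrite subr0.
  move=> e e0; have [L L0 hL] := clim_ctail (hat_integrable b) e0; exists L => // t Lt.
  rewrite hat_tail ?(le_trans L0)//; have := hL t Lt; rewrite subr0.
  by rewrite /free; case: b {hL} => h; rewrite addrAC subrr add0r ncN.
have [Bv hBv] := hatb false; have [Bu hBu] := hatb true.
have hv t : 0 <= t -> nc (col k false t) <= Bv.
  by move=> t0; have := hBv t t0; rewrite /hat /theta mul0r cexp0 mul1r.
have Bv0 : 0 <= Bv by exact: le_trans (nc_ge0 _) (hv 0 (lexx 0)).
have Bu0 : 0 <= Bu by exact: le_trans (nc_ge0 _) (hBu 0 (lexx 0)).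
pose eta t := expR (complex.Re th * t).
have eta0 t : 0 <= eta t := expR_ge0 _.
have etaE t : nc (cexp (th * t%:C)) = eta t.
  by rewrite nc_cexp ReM /= mulr0 subr0.
have eta_dec t s : t <= s -> eta s <= eta t.
  by move=> ts; rewrite /eta ler_expR ler_wnM2l.
(* each step halves the crude part and reproduces the part proportional to eta *)
have step n t : 0 <= t -> nc (hat true t) <= (Bu / 2 ^+ n + 3 * Bv * eta t) * om t.
  elim: n t => [|n IH] t t0.
    rewrite expr0 divr1; apply: le_trans (hBu t t0) _.
    rewrite -[leLHS]mulr1 ler_pM//.
    by rewrite lerDl !mulr_ge0.
  rewrite hat_tail// sub0r ncN.
  pose D := Bu / 2 ^+ n + 4 * Bv * eta t.
  have D0 : 0 <= D by rewrite addr_ge0 ?divr_ge0 ?exprn_ge0// !mulr_ge0.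
  have iPo : inth (fun s => D * (Phi s * om s)).
    by apply: inthZ; exact: (Phi_omega_inth 3 hlax C0).
  have ig : integrableC `[t, +oo[ (fun s => cexp (theta true k * s%:C) * laxrow lam g k true (col k) s).
    by apply: integrableCS (hat_integrable true) => //; exact: sub_tail.
  apply: (@le_trans _ _ (\int[mu]_(s in `[t, +oo[) (D * (Phi s * om s)))).
    apply: nc_integralC_le => //; first exact: inth_tail.
    move=> s /=; rewrite in_itv /= andbT => ts; have s0 := le_trans t0 ts.
    have -> : cexp (theta true k * s%:C) * laxrow lam g k true (col k) s =
      laxrow lam g k true (fun b s => cexp (th * s%:C) * col k b s) s.
      rewrite /laxrow mulr_sumr; apply: eq_bigr => l _; rewrite /src /th; ring.
    have h1 := IH s s0.
    have h2 : nc (cexp (th * s%:C) * col k false s) <= eta s * Bv.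
      by rewrite ncM etaE ler_wpM2l// hv.
    have := @nc_laxrow true (fun b s => cexp (th * s%:C) * col k b s) s _ _ h1 h2.
    move=> h; apply: le_trans h _.
    rewrite mulrCA ler_wpM2l// /D.
    have ed := eta_dec _ _ ts; have e1 := eta0 s; have o1 := om1 s.
    have q0 : 0 <= Bu / 2 ^+ n by rewrite divr_ge0// exprn_ge0.
    have b1 : eta s * Bv <= eta t * Bv by rewrite ler_wpM2r.
    have b2 : eta s * Bv <= eta t * Bv * om s.
      by apply: (le_trans b1); rewrite ler_peMr// mulr_ge0.
    have b3 : (Bu / 2 ^+ n + 3 * Bv * eta s) * om s <= (Bu / 2 ^+ n + 3 * Bv * eta t) * om s.
      by rewrite ler_wpM2r ?(le_trans ler01)// lerD2l ler_wpM2l// mulr_ge0.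
    apply: (le_trans (lerD b3 b2)).
    by rewrite -mulrDl ler_wpM2r ?(le_trans ler01)//; lra.
  rewrite RintegralZl//; last exact: (inth_tail t0 (Phi_omega_inth 3 hlax C0)).
  rewrite (integral_Phi_omega 3 hlax C0 t0) -/om.
  have q : Bu / 2 ^+ n.+1 = Bu / 2 ^+ n / 2 by rewrite exprSr invfM mulrA.
  rewrite q; have := om1 t; have e0 := mulr_ge0 Bv0 (eta0 t).
  have q0 : 0 <= Bu / 2 ^+ n by rewrite divr_ge0// exprn_ge0.
  have -> : D = Bu / 2 ^+ n + 4 * (Bv * eta t) by rewrite /D mulrA.
  rewrite -[3 * _ * _]mulrA.
  move: (Bu / 2 ^+ n) q0 (Bv * eta t) e0 (om t) => x x0 y y0 o o1.
  have := mulr_ge0 y0 (le_trans ler01 o1).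
  by have := mulr_ge0 x0 (le_trans ler01 o1); nra.
have lim t : 0 <= t -> nc (hat true t) <= 3 * Bv * eta t * om t.
  move=> t0; apply/ler_addgt0Pr => e e0.
  have o0 : 0 < om t := expR_gt0 _.
  have h0 : 0 <= Bu * om t / e by rewrite divr_ge0 ?mulr_ge0// ltW.
  have /andP[_ h1] := truncn_itv h0.
  set n := (Num.truncn (Bu * om t / e)).+1 in h1.
  have hn : Bu * om t / e < 2 ^+ n.
    by apply: (lt_trans h1); rewrite -natrX ltr_nat; exact: ltn_expl.
  apply: le_trans (step n t t0) _; rewrite mulrDl addrC lerD2l.
  by rewrite mulrAC ler_pdivrMr ?exprn_gt0// [leRHS]mulrC -ler_pdivrMr// ltW.
pose M := expR (2 * (C * mass 3 phi)).
have omM t : 0 <= t -> om t <= M by move=> t0; exact: (omega_le 3 hlax C0 t0).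
exists (3 * Bv * M + Bv) => b t t0.
have M0 : 0 <= M := expR_ge0 _.
case: b; last first.
  by apply: (le_trans (hv t t0)); rewrite lerDr !mulr_ge0.
apply: (@le_trans _ _ (3 * Bv * M)); last by rewrite lerDl.
have et : 0 < eta t := expR_gt0 _.
rewrite -(ler_pM2l et).
have := lim t t0; rewrite /hat ncM etaE => h; apply: (le_trans h).
rewrite mulrAC mulrC ler_wpM2l//.
by rewrite ler_wpM2l ?omM// mulr_ge0.
Qed.

Lemma col_solves : solves 3 phi (fun l k => kap k ^+ l) k (col k) free.
Proof.
have [B hB] := col_bounded.
move=> b t t0; have [h ->] := col_eq b t0; rewrite addrC; congr (_ + _).
rewrite /opL; congr (- _).
have iO l : integrableC `[t, +oo[ (fun s => expker 0 k b (s - t) * src (phi l) (col k) b s).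
  exact: (opM_integrable (hlax l) (leq0n N) b hth col_adm hB t0).
transitivity (integralC `[t, +oo[ (fun s => \sum_(l < 3)
   kap k ^+ l * (expker 0 k b (s - t) * src (phi l) (col k) b s))); last first.
  rewrite integralC_sum//; last by move=> l; exact: integrableCZ.
  by apply: eq_bigr => l _; rewrite integralCZ.
apply: eq_integralC => s _; rewrite /laxrow mulr_sumr; apply: eq_bigr => l _.
by rewrite /expker expr0 mul1r mulrCA.
Qed.

Lemma laxrow_cconth b : cconth (laxrow lam g k b (col k)).
Proof.
apply: cconth_sum => l _; apply: cconthM; first exact: cconth_cst.
apply: cconthD; apply: cconthM; try exact: col_cconth; apply: cconth_real.
  exact: (hlax l b true).1.
exact: (hlax l b false).1.
Qed.

Lemma col_ode b : cder (col k b) (fun t => - theta b k * col k b t + laxrow lam g k b (col k) t).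
Proof.
have fb t : theta b k * free b t = 0.
  by rewrite /theta /free; case: b; rewrite ?mulr0 ?mul0r.
have df : cder (free b) (fun=> 0) by move: b {fb} => [] /=; exact: cder_cst.
pose y t := col k b t - free b t.
have dy : cder y (fun t => - theta b k * y t + laxrow lam g k b (col k) t).
  apply: ode_of_volterra.
  - exact: laxrow_cconth.
  - exact: hat_integrable.
  - by move=> t t0; have [_ h] := col_eq b t0; rewrite /y h addrC addKr.
have := cderD dy df; rewrite /y.
have -> : (fun s => col k b s - free b s + free b s) = col k b.
  by apply/funext => s; rewrite subrK.
by apply: eq_cder => t _; rewrite mulrBr [- _ * free b t]mulNr fb oppr0 subr0 addr0.
Qed.

Lemma col_limit b : clim (fun t => col k b t - free b t) 0.
Proof.
have [B hB] := col_bounded.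
pose H s := Phi s * (B + B).
have iH : inth H.
  have := inthZ (C * (B + B)) (sum_total_inth hlax (iota 0 3)).
  apply: eq_inth => s _; rewrite /H /Phi.
  by rewrite -(big_mkord xpredT (fun l => total (phi l) s)) /index_iota subn0 /phi; ring.
have B0 := bnd_ge0 hB.
have H0 s : 0 <= H s.
  have Ph0 : 0 <= Phi s by rewrite /Phi mulr_ge0// sumr_ge0// => l _; exact: total_ge0.
  by rewrite /H mulr_ge0// addr_ge0.
move=> e e0; have [L L0 hL] := tail_cvg0 (fun s _ => H0 s) iH e0; exists L => // t Lt.
have t0 := le_trans L0 Lt; have [h E] := col_eq b t0.
rewrite subr0 E addrAC subrr add0r ncN; apply: le_trans (hL t Lt).
apply: nc_integralC_le => //; first exact: inth_tail.
move=> s /=; rewrite in_itv /= andbT => ts; have s0 := le_trans t0 ts.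
rewrite ncM -[leRHS]mul1r ler_pM ?nc_ge0//.
  rewrite /theta; case: b {h E}; first exact: nc_cexp_shift_le1.
  by rewrite mul0r cexp0 nc1.
by apply: nc_laxrow; exact: hB.
Qed.

End ColumnOfT.

(** * Transformation to a system with bounded coefficients *)

Section PolynomialSystems.
Variable R : realType.
Notation mu := (@lebesgue_measure R).
Variables (N D : nat) (P : bool -> bool -> R -> {poly R}) (Q : bool -> R -> {poly R}).
Hypothesis sP : forall b b' t, (size (P b b' t) <= D)%N.
Hypothesis sQ : forall b t, (size (Q b t) <= D)%N.
Hypothesis kP : forall b b', PK N 0 (P b b').
Hypothesis kQ : forall b, PK N 0 (Q b).

Definition pcoef (l : nat) (b b' : bool) (t : R) : R := (P b b' t)`_l.
Definition psrc (l : nat) (b b' : bool) (t : R) : R := if b' then (Q b t)`_l else 0.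
Definition one (b : bool) (t : R) : R[i] := 1.

Lemma pcoef_L1 l : weighted_L1 N (pcoef l).
Proof. by move=> b b'; have [] := kP b b' l. Qed.

Lemma psrc_L1 l : weighted_L1 N (psrc l).
Proof.
by move=> b [] /=; [have [] := kQ b l|have [] := K0 R N 0].
Qed.

Lemma one_adm : adm one. Proof. exact: (adm_cst (fun=> 1)). Qed.
Lemma one_bnd : bnd one 1. Proof. by move=> b t _; rewrite /one nc1. Qed.

Lemma pcoef_sum (z : R[i]) b Y t : \sum_(l < D) z ^+ l * src (pcoef l) Y b t =
  ev (P b true t) z * Y true t + ev (P b false t) z * Y false t.
Proof.
rewrite !(ev_sum _ (sP _ _ _)) !mulr_suml -big_split; apply: eq_bigr => l _.
by rewrite /src /pcoef /=; ring.
Qed.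

Lemma psrc_sum (z : R[i]) b t : \sum_(l < D) z ^+ l * src (psrc l) one b t = ev (Q b t) z.
Proof.
rewrite (ev_sum _ (sQ _ _)); apply: eq_bigr => l _.
by rewrite /src /psrc /one /= rmorph0 mul0r addr0 mulr1 mulrC.
Qed.

Lemma nc_le_sum (z : R[i]) l : (l < D)%N -> nc (z ^+ l) <= \sum_(i < D) nc (z ^+ i).
Proof.
move=> lD; rewrite (bigD1 (Ordinal lD)) //= lerDl sumr_ge0// => i _; exact: nc_ge0.
Qed.

Lemma nc_row_le (z : R[i]) (phi : nat -> bool -> bool -> R -> R) Y b t B : bnd Y B -> 0 <= t ->
  nc (\sum_(l < D) z ^+ l * src (phi l) Y b t) <=
  (\sum_(i < D) nc (z ^+ i)) * B * \sum_(l <- iota 0 D) total (phi l) t.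
Proof.
move=> hB t0; have B0 := bnd_ge0 hB.
have -> : iota 0 D = index_iota 0 D by rewrite /index_iota subn0.
rewrite big_mkord mulr_sumr.
apply: le_trans (nc_sum _ _ _) _; apply: ler_sum => l _.
rewrite ncM -mulrA ler_pM ?nc_ge0 ?nc_le_sum//.
by rewrite mulrC; exact: nc_src.
Qed.

Variables (k z : R[i]).
Hypothesis hk : complex.Re (theta true k) <= 0.

Let c (l : nat) (_ : R[i]) : R[i] := z ^+ l.

Lemma row_cconth (phi : nat -> bool -> bool -> R -> R) Y b :
  (forall l, weighted_L1 N (phi l)) -> (forall b, cconth (Y b)) ->
  cconth (fun t => \sum_(l < D) z ^+ l * src (phi l) Y b t).
Proof.
move=> hphi cY; apply: cconth_sum => l _; apply: cconthM; first exact: cconth_cst.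
by apply: cconthD; apply: cconthM; rewrite //; apply: cconth_real;
  [exact: (hphi l b true).1|exact: (hphi l b false).1].
Qed.

Lemma row_integral (phi : nat -> bool -> bool -> R -> R) Y b B t :
  (forall l, weighted_L1 N (phi l)) -> adm Y -> bnd Y B -> 0 <= t ->
  integrableC `[t, +oo[ (fun s => cexp (theta b k * (s - t)%:C) *
     \sum_(l < D) z ^+ l * src (phi l) Y b s) /\
  - integralC `[t, +oo[ (fun s => cexp (theta b k * (s - t)%:C) *
     \sum_(l < D) z ^+ l * src (phi l) Y b s) = opL D phi c k Y b t.
Proof.
move=> hphi aY hY t0.
have iO l : integrableC `[t, +oo[ (fun s => expker 0 k b (s - t) * src (phi l) Y b s).
  exact: (opM_integrable (hphi l) (leq0n N) b hk aY hY t0).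
have E s : \sum_(l < D) z ^+ l * (expker 0 k b (s - t) * src (phi l) Y b s) =
    cexp (theta b k * (s - t)%:C) * \sum_(l < D) z ^+ l * src (phi l) Y b s.
  rewrite mulr_sumr; apply: eq_bigr => l _.
  by rewrite /expker expr0 mul1r mulrCA.
split.
  apply: (@eq_integrableC _ _ (fun s => \sum_(l < D)
     z ^+ l * (expker 0 k b (s - t) * src (phi l) Y b s))) => //.
  by apply: integrableC_sum => // l; exact: integrableCZ.
rewrite /opL; congr (- _).
rewrite -(eq_integralC (f := fun s => \sum_(l < D)
     z ^+ l * (expker 0 k b (s - t) * src (phi l) Y b s))) => [|s _]; last exact: E.
rewrite integralC_sum//; last by move=> l; exact: integrableCZ.
by apply: eq_bigr => l _; rewrite integralCZ.
Qed.

(** Coefficients and source are polynomials in [z]; separating the powers of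
    [z] puts the system in the form to which the operators [opL] apply, with a
    source of the same shape applied to the constant function [one]. *)
Lemma system_of_ode Y B : bnd Y B -> (forall b, cconth (Y b)) ->
  (forall b, clim (Y b) 0) ->
  (forall b, cder (Y b) (fun t => - theta b k * Y b t +
     (ev (P b true t) z * Y true t + ev (P b false t) z * Y false t + ev (Q b t) z))) ->
  solves D pcoef c k Y (opL D psrc c k one).
Proof.
move=> hB cY lY dY b t t0.
have aY : adm Y by move=> b'; exact: cconth_cmeas.
pose g s := \sum_(l < D) z ^+ l * src (pcoef l) Y b s +
  \sum_(l < D) z ^+ l * src (psrc l) one b s.
have c1 b' : cconth (one b') by exact: cconth_cst.
have cg : cconth g.
  by apply: cconthD; apply: row_cconth => //; [exact: pcoef_L1|exact: psrc_L1].
pose G s := (\sum_(i < D) nc (z ^+ i)) * B * \sum_(l <- iota 0 D) total (pcoef l) s +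
  (\sum_(i < D) nc (z ^+ i)) * 1 * \sum_(l <- iota 0 D) total (psrc l) s.
have iG : inth G.
  apply: inthD; apply: inthZ.
    exact: (sum_total_inth pcoef_L1).
  exact: (sum_total_inth psrc_L1).
have gG s : 0 <= s -> nc (g s) <= G s.
  move=> s0; apply: le_trans (ncD _ _) _; apply: lerD; apply: nc_row_le => //.
  exact: one_bnd.
have hth : complex.Re (theta b k) <= 0 by case: (b).
have := volterra_of_ode hth (cY b) cg iG gG _ (lY b) t0.
have d1 : cder (Y b) (fun t => - theta b k * Y b t + g t).
  by apply: eq_cder (dY b) => s _; rewrite /g pcoef_sum psrc_sum.
move=> /(_ d1) ->.
have [i1 <-] := row_integral b pcoef_L1 aY hB t0.
have [i2 <-] := row_integral b psrc_L1 one_adm one_bnd t0.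
rewrite -opprD -integralCD//; congr (- _).
by apply: eq_integralC => s _; rewrite -mulrDr.
Qed.

End PolynomialSystems.

(** The algebra of the change of unknowns, with [M = kappa ^ (m + 1)] the rescaling
    factor, [Mi] its inverse, and the error terms of the formal solutions as
    hypotheses. *)
Section RiccatiAlgebra.
Variable F : fieldType.
Variables (kp z M Mi u v w w' v12 v21 v22 h rt x x' V V' e lG : F).
Hypotheses (kz : kp * z = 1) (MM : M * Mi = 1).
Hypothesis E1 : - (8 * w) + z * (v12 - 2 * (v22 * w) - v21 * (w * w)) - z ^+ 3 * w' =
  z ^+ 3 * Mi * rt.
Hypothesis E2 : v21 * w + v22 = z ^+ 3 * h.
Hypothesis E3 : kp ^+ 2 * v21 + 8 * kp ^+ 3 * x = lG.
Hypothesis E4 : z * h * V - V' = Mi * e.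

Let du := - (8 * kp ^+ 3) * u + (- (kp ^+ 2 * v22) * u + kp ^+ 2 * v12 * v).
Let dv := kp ^+ 2 * v21 * u + kp ^+ 2 * v22 * v.

Let z0 : z != 0. Proof. by apply: contraTneq isT => zz; move/eqP: kz; rewrite zz mulr0 eq_sym oner_eq0. Qed.
Let kE : kp = z^-1. Proof. by apply: (mulIf z0); rewrite kz mulVf. Qed.
Let M0 : M != 0. Proof. by apply: contraTneq isT => zz; move/eqP: MM; rewrite zz mul0r eq_sym oner_eq0. Qed.
Let MiE : Mi = M^-1. Proof. by apply: (mulfI M0); rewrite MM mulfV. Qed.

Let w'E : w' = kp ^+ 3 * (- (8 * w) + z * (v12 - 2 * (v22 * w) - v21 * (w * w))) - Mi * rt.
Proof.
have -> : - (8 * w) + z * (v12 - 2 * (v22 * w) - v21 * (w * w)) = z ^+ 3 * Mi * rt + z ^+ 3 * w'.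
  by rewrite -E1 subrK.
by rewrite kE; field.
Qed.

Let v22E : v22 = z ^+ 3 * h - v21 * w.
Proof. by rewrite -E2 addrC addKr. Qed.

Let V'E : V' = z * h * V - Mi * e.
Proof. by rewrite -E4 subKr. Qed.

Let q' : du - (w' * v + w * dv) = - (8 * kp ^+ 3) * (u - w * v) -
  z * h * (u - w * v) + Mi * rt * v.
Proof. by rewrite /du /dv w'E v22E kE; field. Qed.

Lemma transformed_row_true :
  M * (du - (w' * v + w * dv)) =
  - (8 * kp ^+ 3) * (M * (u - w * v)) +
  ((- (z * h) + Mi * rt * x) * (M * (u - w * v)) +
   Mi * rt * (M * (v - x * (u - w * v) - V)) + rt * V).
Proof. by rewrite q' MiE; field. Qed.

Lemma transformed_row_false :
  M * (dv - (x' * (u - w * v) + x * (du - (w' * v + w * dv))) - V') =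
  (lG - x' + 2 * (z * h * x) - Mi * rt * (x * x)) * (M * (u - w * v)) +
  (z * h - Mi * rt * x) * (M * (v - x * (u - w * v) - V)) + (e - rt * (x * V)).
Proof. by rewrite q' V'E -E3 /dv v22E MiE kE; field; rewrite z0 M0. Qed.

End RiccatiAlgebra.

Section NormalForm.
Variable R : realType.
Notation mu := (@lebesgue_measure R).
Variables (N m : nat) (lam : R) (g : 'I_3 -> R -> R) (T : R -> R[i] -> 'M[R[i]]_2).
Hypothesis lam2 : lam ^+ 2 = 1.
Hypothesis hT : volterra_solution lam g T.
Hypothesis hg : forall j : 'I_3, Kclass N ((m + 5 - j) %/ 3) (g j).
Let g0 := g 0. Let g1 := g 1. Let g2 := g 2.

Let hg0 : Kclass N ((m + 5) %/ 3) g0.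
Proof. by have := hg 0; rewrite subn0. Qed.
Let hg1 : Kclass N ((m + 4) %/ 3) g1.
Proof. by have := hg 1; have -> : nat_of_ord (1%R : 'I_3) = 1%N by []; rewrite -addnBA. Qed.
Let hg2 : Kclass N ((m + 3) %/ 3) g2.
Proof. by have := hg 2; have -> : nat_of_ord (2%R : 'I_3) = 2%N by []; rewrite -addnBA. Qed.

Lemma lax_L1 l : weighted_L1 N (lax lam g l).
Proof.
have m1 : (0 < (m + 3) %/ 3)%N by rewrite divn_gt0//; lia.
have k0 : Kclass N 1 g0 by apply: KS hg0; rewrite divn_gt0//; lia.
have k1 : Kclass N 1 g1 by apply: KS hg1; rewrite divn_gt0//; lia.
have kG : Kclass N 1 (gG lam g0 g2) by apply: KS (KG lam hg0 hg2).
have k00 : Kclass N 1 (fun t => g0 t ^+ 2).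
  by under eq_fun do rewrite expr2; exact: (KM (leqnn 1)).
suff h b b' : Kclass N 1 (lax lam g l b b').
  by move=> b b'; have [] := h b b'.
rewrite /lax; case: l => [|[|[|l]]]; case: b; case: b'; try exact: K0;
  try (by []); try (apply: KZ; by []); try (apply: KN; apply: KZ; by []).
Qed.

Let K10 : Kclass N 1 g0. Proof. by apply: KS hg0; rewrite divn_gt0//; lia. Qed.
Let K11 : Kclass N 1 g1. Proof. by apply: KS hg1; rewrite divn_gt0//; lia. Qed.
Let K1G : Kclass N 1 (gG lam g0 g2).
Proof. by apply: KS (KG lam hg0 hg2); rewrite divn_gt0//; lia. Qed.

Let P12 : PK N 1 (v12 lam g0 g1 g2).
Proof. by apply: PKD; [apply: PKD|]; apply: PK_mon => //; exact: KZ. Qed.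
Let P21 : PK N 1 (v21 lam g0 g1 g2).
Proof. by apply: PKD; [apply: PKD|]; apply: PK_mon; do ?apply: KZ. Qed.
Let P22 : PK N 1 (v22 lam g0).
Proof.
apply: PK_mon; apply: KZ; under eq_fun do rewrite expr2; exact: (KM (leqnn 1)).
Qed.
Let s12 : psize (v12 lam g0 g1 g2).
Proof. by apply: psizeD; [apply: psizeD|]; exact: psize_mon. Qed.
Let s21 : psize (v21 lam g0 g1 g2).
Proof. by apply: psizeD; [apply: psizeD|]; exact: psize_mon. Qed.
Let s22 : psize (v22 lam g0). Proof. exact: psize_mon. Qed.

Let PK_X s (P : R -> {poly R}) : PK N s P -> PK N s (fun t => 'X * P t).
Proof. by move=> h; have := PK_Xn 1 h; under eq_fun do rewrite expr1. Qed.

Let psizeXM (p : {poly R}) (P : R -> {poly R}) : psize P -> psize (fun t => p * P t).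
Proof. by apply: psizeM; exact: psize_cst. Qed.

Section Evaluation.
Variables (z : R[i]) (p q r w w' x y e : {poly R}).

Lemma ev_riccati : ev (- (8%:R *: w) + 'X * (p - 2%:R *: (q * w) - r * (w * w)) - 'X^3 * w') z =
  - (8 * ev w z) + z * (ev p z - 2 * (ev q z * ev w z) - ev r z * (ev w z * ev w z)) -
  z ^+ 3 * ev w' z.
Proof. by rewrite !evE !rmorph_nat. Qed.

Lemma ev_sub_mul : ev ('X * p * q - r) z = z * ev p z * ev q z - ev r z.
Proof. by rewrite !evE. Qed.

Lemma ev_row11 : ev (- ('X * p) + 'X^(m.+1) * r * x) z =
  - (z * ev p z) + z ^+ m.+1 * ev r z * ev x z.
Proof. by rewrite !evE. Qed.

Lemma ev_row12 : ev ('X^(m.+1) * r) z = z ^+ m.+1 * ev r z.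
Proof. by rewrite !evE. Qed.

Lemma ev_row21 : ev (e - y + 2%:R *: ('X * p * x) - 'X^(m.+1) * r * (x * x)) z =
  ev e z - ev y z + 2 * (z * ev p z * ev x z) - z ^+ m.+1 * ev r z * (ev x z * ev x z).
Proof. by rewrite !evE rmorph_nat. Qed.

Lemma ev_row22 : ev ('X * p - 'X^(m.+1) * r * x) z =
  z * ev p z - z ^+ m.+1 * ev r z * ev x z.
Proof. by rewrite !evE. Qed.

Lemma ev_src2 : ev (e - r * (x * p)) z = ev e z - ev r z * (ev x z * ev p z).
Proof. by rewrite !evE. Qed.

End Evaluation.

Section Coefficients.
Variables W W' : R -> {poly R}.
Hypothesis W0 : forall t, (W t)`_0 = 0.
Hypothesis rW : forall t l, (l <= m + 3)%N -> (riccati lam g0 g1 g2 W W' t)`_l = 0.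

Let rc l (t : R) : (l < 2)%N -> 8%:R * (W t)`_l.+1 =
  (v12 lam g0 g1 g2 t - 2%:R *: (v22 lam g0 t * W t) - v21 lam g0 g1 g2 t * (W t * W t))`_l.
Proof.
move=> l2; have := rW t (l := l.+1); rewrite /riccati.
set q := (_ - _ - _ * (_ * _)).
rewrite coefB coefD coefN coefZ coefXM coefXnM /=.
have -> : (l.+1 < 3)%N by [].
by rewrite subr0 => /(_ _)/eqP; rewrite addrC subr_eq0 => /(_ _)/eqP <-//; lia.
Qed.

Let W1E (t : R) : (W t)`_1 = g0 t / 2.
Proof.
have := rc t (isT : (0 < 2)%N).
rewrite !coefB coefZ !coefM !big_ord_recl !big_ord0 /= !coefM !big_ord_recl !big_ord0 /=.
rewrite W0 /v12 !coefD !coef_pmon /= !(mulr0, mul0r, addr0, add0r, subr0) => h.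
have h8 : (8%:R : R) != 0 by rewrite pnatr_eq0.
by apply: (mulfI h8); rewrite h; field.
Qed.

Let coef1_row (p q r w : {poly R}) : w`_0 = 0 ->
  (p - 2%:R *: (q * w) - r * (w * w))`_1 = p`_1 - 2%:R * (q`_0 * w`_1).
Proof.
move=> w0; rewrite !coefB coefZ !coefM !big_ord_recl !big_ord0 /= /bump /=.
rewrite !coefM !big_ord_recl !big_ord0 /= /bump /= !add1n !subn0 !subnn w0.
by rewrite !(mulr0, mul0r, addr0, add0r, subr0).
Qed.

Let W2E (t : R) : (W t)`_2 = - g1 t / 4.
Proof.
have h8 : (8%:R : R) != 0 by rewrite pnatr_eq0.
apply: (mulfI h8); rewrite rc// coef1_row// /v12 /v22 !coefD !coef_pmon /=.
by rewrite !(mulr0, mul0r, addr0, add0r, subr0); field.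
Qed.

(** The first two coefficients [w_1 = g0 / 2] and [w_2 = - g1 / 4] are
    explicit, and [4 g0 w_1 = 2 g0 ^ 2] compensates the coefficient of [v22];
    the terms of order two in [v21 W] cancel each other. *)
Lemma leading_cancellation t l : (l < 3)%N ->
  (v21 lam g0 g1 g2 t * W t + v22 lam g0 t)`_l = 0.
Proof.
rewrite coefD coefM /v22 coef_pmon; case: l => [|[|[|//]]] _;
  rewrite !big_ord_recl big_ord0 /= /bump /= ?W0 ?W1E ?W2E /v21 !coefD !coef_pmon /=.
- by rewrite !(mulr0, addr0).
- by field.
- by field.
Qed.

End Coefficients.

(** The new unknowns are [M (u - W v)] and [M (v - X q - V)] with [M = kappa ^
    (m + 1)]; undoing the change of unknowns at [t = 0] gives the two final
    equations. *)
Theorem normal_form : exists (D : nat) (psi chi : nat -> bool -> bool -> R -> R) (w x p : {poly R}),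
  [/\ forall l, weighted_L1 N (psi l), forall l, weighted_L1 N (chi l), w`_0 = 0,
   p`_0 = 1 /\ (size p <= m.+1)%N &
   forall k, closure Dplus k -> k != 0 -> let z := (kap k)^-1 in exists Y,
   [/\ adm Y, exists B, bnd Y B,
    solves D psi (fun l _ => z ^+ l) k Y (opL D chi (fun l _ => z ^+ l) k (@one R)),
    col T k false 0 = ev p z + z ^+ m.+1 * (Y false 0 + ev x z * Y true 0) &
    col T k true 0 = ev w z * col T k false 0 + z ^+ m.+1 * Y true 0]].
Proof.
have [W [W' [[sW sW'] W0 KW dW rW]]] := riccati_solution lam hg0 hg1 hg2 (leqnn (m + 3)).
have PW : PK N 1 W.
  move=> l; have [lm|lm] := leqP l (m + 3); last first.
    by under eq_fun => t do rewrite (W0 t l _).1 ?lm ?orbT//; exact: K0.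
  by apply: KS (KW l).1; rewrite /ord divn_gt0//; lia.
have PW' : PK N 0 W' by move=> l; exact: KS (KW l).2.
have W00 t : (W t)`_0 = 0 by have [] := W0 t 0%N isT.
have lc := leading_cancellation W00 rW.
pose Ric := riccati lam g0 g1 g2 W W'.
pose Rt t := drop_poly (m + 4) (Ric t).
pose ht t := drop_poly 3 (v21 lam g0 g1 g2 t * W t + v22 lam g0 t).
have le01 s (P : R -> {poly R}) : PK N s P -> PK N 0 P by exact: PKle.
have PRic : PK N 0 Ric.
  apply: PKD; last by apply: PKN; exact: PK_Xn.
  apply: PKD; first by apply: PKN; apply: PKZ; exact: le01 PW.
  apply: PK_X; apply: (@le01 1); apply: PKD.
    by apply: PKD => //; apply: PKN; apply: PKZ; exact: PKM.
  by apply: PKN; apply: PKM => //; exact: PKM.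
have sRic : psize Ric.
  apply: psizeD; last by apply: psizeN; exact: psizeXM.
  apply: psizeD; first by apply: psizeN; exact: psizeZ.
  apply: psizeXM; apply: psizeD.
    by apply: psizeD => //; apply: psizeN; apply: psizeZ; exact: psizeM.
  by apply: psizeN; apply: psizeM => //; exact: psizeM.
have PRt : PK N 0 Rt by exact: PK_drop.
have sRt : psize Rt by exact: psize_drop.
have Pht : PK N 1 ht by apply: PK_drop; apply: PKD => //; exact: PKM.
have sht : psize ht by apply: psize_drop; apply: psizeD => //; exact: psizeM.
have [VV [VV' [[sV sV'] [bV kV'] dV V0 [lV rV]]]] := formal_exponential m (le01 1 _ Pht).
pose Et t := drop_poly m.+1 ('X * ht t * VV t - VV' t).
have PhV : PK N 0 (fun t => 'X * ht t * VV t).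
  by apply: PK0_Pb => //; apply: PK_X; exact: le01 Pht.
have PEt : PK N 0 Et by apply: PK_drop; apply: PKD => //; exact: PKN.
have sEt : psize Et.
  apply: psize_drop; apply: psizeD; last exact: psizeN.
  by apply: psizeM => //; exact: psizeXM.
(* chosen so that kappa^2 v21 + 8 kappa^3 X has order zero *)
pose Xp t := pmon (fun t => - (lam / 2) * g0 t) 1 t + pmon (fun t => - (lam / 4) * g1 t) 2 t.
have PX : PK N 1 Xp by apply: PKD; apply: PK_mon; exact: KZ.
have sX : psize Xp by apply: psizeD; exact: psize_mon.
have [Xp' [dX PX' sX']] := PK_der PX sX.
have bX := PK1_Pb PX.
pose LG t := pmon (fun t => lam * gG lam g0 g2 t) 0 t.
have PLG : PK N 1 LG by apply: PK_mon; exact: KZ.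
pose P b b' t := if b then
    (if b' then - ('X * ht t) + 'X^(m.+1) * Rt t * Xp t else 'X^(m.+1) * Rt t)
  else (if b' then LG t - Xp' t + 2%:R *: ('X * ht t * Xp t) -
      'X^(m.+1) * Rt t * (Xp t * Xp t)
    else 'X * ht t - 'X^(m.+1) * Rt t * Xp t).
pose Q b t := if b then Rt t * VV t else Et t - Rt t * (Xp t * VV t).
have PXh : PK N 1 (fun t => 'X * ht t) by exact: PK_X.
have PXR : PK N 0 (fun t => 'X^(m.+1) * Rt t) by exact: PK_Xn.
have sXh : psize (fun t => 'X * ht t) by exact: psizeXM.
have sXR : psize (fun t => 'X^(m.+1) * Rt t) by exact: psizeXM.
have bXX : Pb (fun t => Xp t * Xp t) by exact: PbM.
have kP b b' : PK N 0 (P b b').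
  case: b; case: b'; rewrite /P.
  - by apply: PKD; [apply: PKN; exact: le01 PXh|exact: PK0_Pb].
  - by [].
  - apply: PKD; last by apply: PKN; exact: PK0_Pb.
    apply: PKD; last by apply: PKZ; apply: (@le01 1); exact: PKM.
    by apply: PKD; [exact: le01 PLG|exact: PKN].
  - by apply: PKD; [exact: le01 PXh|apply: PKN; exact: PK0_Pb].
have kQ b : PK N 0 (Q b).
  case: b; rewrite /Q; first exact: PK0_Pb.
  by apply: PKD => //; apply: PKN; apply: PK0_Pb => //; exact: PbM.
have psP b b' : psize (P b b').
  case: b; case: b'; rewrite /P //.
  - by apply: psizeD; [exact: psizeN|exact: psizeM].
  - apply: psizeD; last by apply: psizeN; apply: psizeM => //; exact: psizeM.
    apply: psizeD; last by apply: psizeZ; exact: psizeM.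
    by apply: psizeD; [exact: psize_mon|exact: psizeN].
  - by apply: psizeD => //; apply: psizeN; exact: psizeM.
have psQ b : psize (Q b).
  case: b; rewrite /Q; first exact: psizeM.
  by apply: psizeD => //; apply: psizeN; apply: psizeM => //; exact: psizeM.
have [D [sP sQ]] : exists D, (forall b b' t, (size (P b b' t) <= D)%N) /\
    (forall b t, (size (Q b t) <= D)%N).
  have [D1 h1] := psP true true; have [D2 h2] := psP true false.
  have [D3 h3] := psP false true; have [D4 h4] := psP false false.
  have [D5 h5] := psQ true; have [D6 h6] := psQ false.
  exists (D1 + D2 + D3 + D4 + D5 + D6)%N; split => [[] [] t|[] t].
  - by rewrite (leq_trans (h1 t))//; lia.
  - by rewrite (leq_trans (h2 t))//; lia.
  - by rewrite (leq_trans (h3 t))//; lia.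
  - by rewrite (leq_trans (h4 t))//; lia.
  - by rewrite (leq_trans (h5 t))//; lia.
  - by rewrite (leq_trans (h6 t))//; lia.
exists D, (pcoef P), (psrc Q), (W 0), (Xp 0), (VV 0); split.
- exact: pcoef_L1.
- exact: psrc_L1.
- exact: W00.
- split; first exact: (V0 0).1.
  by apply/leq_sizeP => l lm; have [] := (V0 0).2 l lm.
move=> k clk k0; set z := (kap k)^-1; set kp := kap k.
have hk := Re_theta_closure_Dplus clk.
have kp0 : kp != 0.
  rewrite /kp /kap mulf_neq0// oppr_eq0 -nc_eq0 nc_i; exact: oner_neq0.
have kz : kp * z = 1 by rewrite /z mulfV.
have MM : kp ^+ m.+1 * z ^+ m.+1 = 1 by rewrite -exprMn kz expr1n.
have thE : theta true k = 8 * kp ^+ 3.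
  have i2 : ('i%C : R[i]) ^+ 2 = -1 by rewrite sqr_i.
  by rewrite /theta /kp /kap; ring: i2.
pose u := col T k true; pose v := col T k false.
pose M := kp ^+ m.+1.
pose q t := u t - ev (W t) z * v t.
pose Y b t := if b then M * q t else M * (v t - ev (Xp t) z * q t - ev (VV t) z).
have cu := col_cconth lam2 hT clk true; have cv := col_cconth lam2 hT clk false.
have cPK s (P0 : R -> {poly R}) : psize P0 -> PK N s P0 -> cconth (fun t => ev (P0 t) z).
  by move=> sp kp1; apply: cconth_ev => // l; have [] := KclassE (kp1 l).
have cVV : cconth (fun t => ev (VV t) z) by apply: cconth_ev => // l; have [] := bV l.
have cq : cconth q.
  by apply: cconthD => //; apply: cconthN; apply: cconthM => //; exact: cPK PW.
have cY b : cconth (Y b).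
  case: b; rewrite /Y; apply: (cconthM (cconth_cst M)); first exact: cq.
  apply: cconthD; last exact: cconthN.
  by apply: cconthD => //; apply: cconthN; apply: cconthM => //; exact: cPK PX.
have lu : clim u 0.
  have := col_limit lam2 hT lax_L1 clk true.
  by apply: clim_eq => t _; rewrite /free subr0.
have lv := col_limit lam2 hT lax_L1 clk false.
have [B hB] := col_bounded lam2 hT lax_L1 clk.
have lW : clim (fun t => ev (W t) z) 0.
  by apply: clim_ev0 => // l; have [] := K1_bcont (PW l).
have lq : clim q 0.
  have := climD lu (clim0Z (-1) (clim0M (hB false) lW)); rewrite addr0.
  by apply: clim_eq => t _; rewrite /q mulN1r mulrC.
have lY b : clim (Y b) 0.
  case: b; rewrite /Y; apply: clim0Z => //.
  have [B2 hB2] := bounded_ev z sX bX.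
  have lV1 : clim (fun t => ev (VV t - 1) z) 0.
    apply: clim_ev0; first by apply: psizeD => //; apply: psizeN; exact: psize_cst.
    move=> l; have [->|l0] := eqVneq l 0%N.
      move=> e e0; exists 0 => // t _.
      by rewrite coefB (V0 t).1 coef1 eqxx subrr subr0 normr0 ltW.
    move=> e e0; have [|L L0 hL] := lV l _ e e0; first by rewrite lt0n.
    exists L => // t Lt; rewrite coefB coef1 (negbTE l0) subr0; exact: hL.
  have := climD lv (climD (clim0Z (-1) (clim0M hB2 lq)) (clim0Z (-1) lV1)).
  rewrite !addr0; apply: clim_eq => t _.
  by rewrite /free evD evN -(polyC1 R) evC rmorph1 -/(v t); ring.
have [B' hB'] : exists B', bnd Y B'.
  have [B1 h1] := cconth_clim_bounded (cY true) (lY true).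
  have [B2 h2] := cconth_clim_bounded (cY false) (lY false).
  exists (Num.max B1 B2) => b t t0; rewrite le_max.
  by case: b; [rewrite h1|rewrite h2// orbT].
have E1 t : - (8 * ev (W t) z) + z * (ev (v12 lam g0 g1 g2 t) z -
    2 * (ev (v22 lam g0 t) z * ev (W t) z) -
    ev (v21 lam g0 g1 g2 t) z * (ev (W t) z * ev (W t) z)) - z ^+ 3 * ev (W' t) z =
    z ^+ 3 * z ^+ m.+1 * ev (Rt t) z.
  rewrite -exprD.
  have -> : (3 + m.+1 = m + 4)%N by lia.
  rewrite -ev_drop; last by move=> l lm; apply: rW; lia.
  by rewrite /Ric /riccati ev_riccati.
have E2 t : ev (v21 lam g0 g1 g2 t) z * ev (W t) z + ev (v22 lam g0 t) z = z ^+ 3 * ev (ht t) z.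
  rewrite -ev_drop => [|l]; last exact: lc.
  by rewrite [RHS]evD; congr (_ + _); rewrite [RHS]evM.
have E3 t : kp ^+ 2 * ev (v21 lam g0 g1 g2 t) z + 8 * kp ^+ 3 * ev (Xp t) z = ev (LG t) z.
  have kE : kp = z^-1 by rewrite /z invrK.
  have z0 : z != 0 by rewrite /z invr_eq0.
  rewrite /v21 /Xp /LG !evE kE !(rmorphM, rmorphN, fmorphV, rmorph_nat, rmorphXn) /=.
  by field.
have E4 t : z * ev (ht t) z * ev (VV t) z - ev (VV' t) z = z ^+ m.+1 * ev (Et t) z.
  rewrite -ev_drop => [|l lm]; last exact: rV.
  by rewrite ev_sub_mul.
have du : cder u (fun t => - (8 * kp ^+ 3) * u t +
   (- (kp ^+ 2 * ev (v22 lam g0 t) z) * u t + kp ^+ 2 * ev (v12 lam g0 g1 g2 t) z * v t)).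
  apply: eq_cder (col_ode lam2 hT lax_L1 clk true) => t _.
  rewrite thE laxrow_true -/kp -/u -/v; congr (_ + _).
  have kE : kp = z^-1 by rewrite /z invrK.
  have z0 : z != 0 by rewrite /z invr_eq0.
  rewrite /v22 /v12 !evE kE !(rmorphM, rmorphN, rmorph_nat, rmorphXn) /=.
  by field.
have dv : cder v (fun t => kp ^+ 2 * ev (v21 lam g0 g1 g2 t) z * u t +
   kp ^+ 2 * ev (v22 lam g0 t) z * v t).
  apply: eq_cder (col_ode lam2 hT lax_L1 clk false) => t _.
  rewrite /theta oppr0 mul0r add0r laxrow_false -/kp -/u -/v.
  have kE : kp = z^-1 by rewrite /z invrK.
  have z0 : z != 0 by rewrite /z invr_eq0.
  rewrite /v22 /v21 !evE kE !(rmorphM, rmorphN, rmorph_nat, rmorphXn) /=.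
  by field.
have dq := cderD du (cderN (cderM (cder_ev z sW sW' dW) dv)).
exists Y; split.
- by move=> b; exact: cconth_cmeas.
- by exists B'.
- apply: (system_of_ode sP sQ kP kQ hk hB' cY lY) => -[].
    have := cderM (cder_cst M) dq; rewrite /Y; apply: eq_cder => t _.
    rewrite mul0r add0r thE /P /Q ev_row11 ev_row12 [ev (_ * _) _]evM.
    by rewrite -(@transformed_row_true _ kp z _ _ (u t) (v t) _ _ _ _ _ _ _ (ev (Xp t) z) (ev (VV t) z) kz MM (E1 t) (E2 t)).
  have := cderM (cder_cst M) (cderD (cderD dv (cderN (cderM (cder_ev z sX sX' dX) dq)))
    (cderN (cder_ev z sV sV' dV))).
  rewrite /Y; apply: eq_cder => t _.
  rewrite mul0r add0r /theta oppr0 mul0r add0r /P /Q ev_row21 ev_row22 ev_src2.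
  by rewrite -(transformed_row_false (u t) (v t) (ev (Xp' t) z) kz MM (E1 t) (E2 t) (E3 t) (E4 t)).
- have MM' := MM; rewrite mulrC in MM'.
  rewrite /Y [ev (Xp 0) z * (M * _)]mulrCA -mulrDr [z ^+ _ * (M * _)]mulrA MM' mul1r.
  set a := ev (VV 0) z; set b := ev (Xp 0) z * q 0; rewrite /v.
  by ring.
- have MM' := MM; rewrite mulrC in MM'.
  by rewrite /Y mulrA MM' mul1r /q addrC subrK.
Qed.

End NormalForm.

(** * Relative derivatives and complex derivatives *)

Section RelativeDerivatives.
Variable R : realType.
Implicit Types (U V : set R[i]) (f g : R[i] -> R[i]) (k : R[i]).

Definition rcont U f := forall k, U k -> forall e : R, 0 < e ->
  exists2 d : R, 0 < d & forall k', U k' -> nc (k' - k) < d -> nc (f k' - f k) <= e.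

Definition rder U f f' := forall k, U k -> forall e : R, 0 < e ->
  exists2 d : R, 0 < d & forall k', U k' -> nc (k' - k) < d ->
    nc (f k' - f k - (k' - k) * f' k) <= e * nc (k' - k).

(** No isolated points: the condition under which relative derivatives are
    unique. *)
Definition perfect U := forall k, U k -> forall d : R, 0 < d ->
  exists2 k', U k' & (k' != k) && (nc (k' - k) < d).

Lemma rderS U V f f' : V `<=` U -> rder U f f' -> rder V f f'.
Proof.
move=> VU h k Vk e e0; have [d d0 H] := h k (VU _ Vk) e e0.
by exists d => // k' Vk'; apply: H; exact: VU.
Qed.

Lemma eq_rder U f g f' g' : (forall k, U k -> f k = g k) -> (forall k, U k -> f' k = g' k) ->
  rder U f f' -> rder U g g'.
Proof.
move=> fg fg' h k Uk e e0; have [d d0 H] := h k Uk e e0; exists d => // k' Uk' kd.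
by rewrite -!fg// -fg'//; exact: H.
Qed.

Lemma rderD U f f' g g' : rder U f f' -> rder U g g' ->
  rder U (fun k => f k + g k) (fun k => f' k + g' k).
Proof.
move=> hf hg k Uk e e0; have e2 : 0 < e / 2 by rewrite divr_gt0.
have [d d0 H] := hf k Uk _ e2; have [d' d'0 H'] := hg k Uk _ e2.
exists (Num.min d d'); first by rewrite lt_min d0.
move=> k' Uk'; rewrite lt_min => /andP[kd kd'].
have -> : f k' + g k' - (f k + g k) - (k' - k) * (f' k + g' k) =
  (f k' - f k - (k' - k) * f' k) + (g k' - g k - (k' - k) * g' k) by ring.
apply: le_trans (ncD _ _) _.
by rewrite [e in leRHS]splitr [leRHS]mulrDl lerD ?H ?H'.
Qed.

Lemma rder_unique U f f1 f2 : perfect U -> rder U f f1 -> rder U f f2 ->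
  forall k, U k -> f1 k = f2 k.
Proof.
move=> pU h1 h2 k Uk; apply/eqP; rewrite -subr_eq0 -nc_eq0; apply/eqP/le_anti.
rewrite nc_ge0 andbT; apply/ler_addgt0Pr => e e0; rewrite add0r.
have e2 : 0 < e / 2 by rewrite divr_gt0.
have [d d0 H] := h1 k Uk _ e2; have [d' d'0 H'] := h2 k Uk _ e2.
have [|k' Uk' /andP[k'k]] := pU k Uk (Num.min d d'); first by rewrite lt_min d0.
rewrite lt_min => /andP[kd kd'].
have n0 : 0 < nc (k' - k) by rewrite nc_gt0 subr_eq0.
rewrite -(ler_pM2r n0) -ncM mulrC.
have -> : (k' - k) * (f1 k - f2 k) = (f k' - f k - (k' - k) * f2 k) -
  (f k' - f k - (k' - k) * f1 k) by ring.
apply: le_trans (ncB _ _) _.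
by rewrite [e in leRHS]splitr [leRHS]mulrDl lerD ?H ?H'.
Qed.

(** On a set with boundary the derivatives cannot be obtained by iterating an
    operator on all of [R[i]]; they are carried along, and [tower_unique]
    shows that the first function determines them. *)
Definition tower U (n : nat) (F : nat -> R[i] -> R[i]) :=
  (forall j, (j <= n)%N -> rcont U (F j)) /\
  (forall j, (j < n)%N -> rder U (F j) (F j.+1)).

Lemma towerS U V n F : V `<=` U -> tower U n F -> tower V n F.
Proof.
move=> VU [h1 h2]; split => j jn; last by apply: rderS VU _; exact: h2.
move=> k Vk e e0; have [d d0 H] := h1 j jn k (VU _ Vk) e e0.
by exists d => // k' Vk'; apply: H; exact: VU.
Qed.

Lemma tower_unique U n F G : perfect U -> tower U n F -> tower U n G ->
  (forall k, U k -> F 0%N k = G 0%N k) ->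
  forall j, (j <= n)%N -> forall k, U k -> F j k = G j k.
Proof.
move=> pU [_ hF] [_ hG] FG0; elim=> [//|j IH] jn.
apply: (rder_unique pU (hF _ jn)).
by apply: eq_rder (hG _ jn) => // k Uk; rewrite IH// ltnW.
Qed.

Lemma rder_derive1 U f f' k : open U -> rder U f f' -> U k ->
  derivable f k 1 /\ derive1 f k = f' k.
Proof.
move=> /open_nc oU h Uk.
have lim_f : (fun t => t^-1 *: (f (t *: (1 : R[i]^o) + k) - f k)) @ (0 : R[i])^' --> f' k.
  apply/cvg_nc => e e0; have e2 : 0 < e / 2 by rewrite divr_gt0.
  have [d d0 H] := h k Uk _ e2; have [d1 d10 H1] := oU _ Uk.
  have : \forall t \near (0 : R[i]), t != 0 -> nc (t^-1 *: (f (t *: (1 : R[i]^o) + k) - f k) - f' k) < e.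
    apply/near_nc; exists (Num.min d d1); first by rewrite lt_min d0.
    move=> t; rewrite subr0 lt_min => /andP[td td1] t0.
    have tk : t *: (1 : R[i]^o) + k - k = t by rewrite addrK; exact: mulr1.
    have := H (t *: (1 : R[i]^o) + k); rewrite tk => /(_ _ td).
    have Ut : U (t *: (1 : R[i]^o) + k) by apply: H1; rewrite tk.
    move=> /(_ Ut) Ht.
    have n0 : 0 < nc t by rewrite nc_gt0.
    have -> : t^-1 *: (f (t *: (1 : R[i]^o) + k) - f k) - f' k =
       t^-1 * (f (t *: (1 : R[i]^o) + k) - f k - t * f' k).
      by rewrite mulrBr mulKf.
    rewrite ncM ncV -(ltr_pM2l n0) mulVKf ?gt_eqF// (le_lt_trans Ht)//.
    by rewrite mulrC ltr_pM2l// ltr_pdivrMr// ltr_pMr// ltr1n.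
  by apply: filterS => t ht /ht.
split; first by apply/cvg_ex; exists (f' k).
by rewrite derive1E /derive; exact: cvg_lim.
Qed.

Lemma near_derive1 U f g k : open U -> (forall k', U k' -> f k' = g k') -> U k ->
  (derivable f k 1 <-> derivable g k 1) /\ derive1 f k = derive1 g k.
Proof.
move=> oU fg Uk.
have n1 : \forall k' \near k, f k' = g k'.
  by apply: filterS (open_nbhs_nbhs (conj oU Uk)).
have n2 : \forall k' \near k, g k' = f k' by apply: filterS n1 => x ->.
split; last by rewrite !derive1E; exact: near_eq_derive.
by split; apply: near_eq_derivable; rewrite ?oner_eq0.
Qed.

(** On an open set relative derivatives are complex derivatives. *)
Lemma tower_derive1n U n F f : open U -> tower U n F -> (forall k, U k -> f k = F 0%N k) ->
  (forall j, (j <= n)%N -> forall k, U k -> derive1n j f k = F j k) /\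
  (forall j, (j < n)%N -> forall k, U k -> derivable (derive1n j f) k 1).
Proof.
move=> oU [_ hF] f0.
have E j : (j <= n)%N -> forall k, U k -> derive1n j f k = F j k.
  elim: j => [_ k Uk|j IH jn k Uk]; first by rewrite derive1n0 f0.
  rewrite derive1nS; have [_ ->] := near_derive1 oU (IH (ltnW jn)) Uk.
  by have [_ ->] := rder_derive1 oU (hF _ jn) Uk.
split=> // j jn k Uk; have [h _] := near_derive1 oU (E j (ltnW jn)) Uk.
by apply/h; have [] := rder_derive1 oU (hF _ jn) Uk.
Qed.

Variables (Om : set R[i]) (rho : R[i] -> R).
Hypothesis rho_ge0 : forall k, Om k -> 0 <= rho k.

(** The recursion that defines [smooth] is unfolded into a sequence of functions
    of [k] alone, to which uniqueness of relative derivatives applies. *)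
Lemma smooth_tower n w (f : R[i] -> bool -> R -> R[i]) b : smooth Om rho n w f ->
  exists F : nat -> R[i] -> R[i], [/\ (forall k, F 0%N k = f k b 0), tower Om n F &
    forall j, (j <= n)%N -> exists C : R, forall k, Om k ->
      nc (F j k) <= C * (w k * rho k ^+ j)].
Proof.
elim: n w f => [|n IH] w f sf; have [_ cf [C C0 bf]] := smoothE sf.
  exists (fun _ k => f k b 0); split=> //; [split=> // j _ k Ok e e0|case=> // _].
    have [d d0 H] := cf k Ok e e0; exists d => // k' Ok' kd; exact: H.
  by exists C => k Ok; rewrite expr0 mulr1; exact: bf.
move: sf => [_ _ _ [f' df sf']].
have [F [F0 [cF dF] bF]] := IH _ _ sf'.
exists (fun j k => if j is j'.+1 then F j' k else f k b 0); split=> //.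
  split=> [[|j]|[|j]] jn.
  - move=> k Ok e e0; have [d d0 H] := cf k Ok e e0; exists d => // k' Ok' kd; exact: H.
  - exact: cF.
  - move=> k Ok e e0; have [d d0 H] := df k Ok e e0; exists d => // k' Ok' kd.
    by rewrite F0; exact: H.
  - exact: dF.
case=> [_|j jn]; first by exists C => k Ok; rewrite expr0 mulr1; exact: bf.
have [C' hC'] := bF j jn; exists C' => k Ok; apply: (le_trans (hC' _ Ok)).
by rewrite exprS [w k * (_ * _)]mulrA.
Qed.

End RelativeDerivatives.

(** * Geometry of the domain *)

Section Geometry.
Variable R : realType.
Implicit Types (k : R[i]).

Lemma Im_cube k : complex.Im (k ^+ 3) =
  complex.Im k * (3 * complex.Re k ^+ 2 - complex.Im k ^+ 2).
Proof. rewrite !exprS expr0 mulr1 !ReImE; ring. Qed.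

Lemma DplusE k : Dplus k <-> complex.Im k != 0 /\ 0 < complex.Im (k ^+ 3).
Proof.
split; first by case=> -[h1 h2]; split => //; [rewrite lt_eqF|rewrite gt_eqF].
case; case: (ltgtP (complex.Im k) 0) => // h _ h2; [left|right]; by split.
Qed.

Lemma nc_cubeB_le (a b : R[i]) : nc (a - b) < 1 -> nc (a ^+ 3 - b ^+ 3) <=
  nc (a - b) * (3 * (nc b + 1) ^+ 2).
Proof.
move=> h; have -> : a ^+ 3 - b ^+ 3 = (a - b) * (a * a + a * b + b * b) by ring.
rewrite ncM ler_wpM2l ?nc_ge0//.
have an : nc a <= nc b + 1.
  by have := ncD (a - b) b; rewrite subrK; move: h; lra.
have bn : nc b <= nc b + 1 by rewrite lerDl.
have -> : 3 * (nc b + 1) ^+ 2 = (nc b + 1) * (nc b + 1) + (nc b + 1) * (nc b + 1) +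
  (nc b + 1) * (nc b + 1) by ring.
have n0 := @nc_ge0 R.
rewrite (le_trans (ncD _ _))// lerD//; last by rewrite ncM ler_pM.
by rewrite (le_trans (ncD _ _))// lerD// ncM ler_pM.
Qed.

Lemma open_Dplus : open (@Dplus R).
Proof.
apply/open_nc => k /DplusE[h1 h2].
set M := 3 * (nc k + 1) ^+ 2.
have M0 : 0 < M by rewrite mulr_gt0// exprn_gt0//; have := nc_ge0 k; lra.
have h1' : 0 < `|complex.Im k| by rewrite normr_gt0.
exists (Num.min 1 (Num.min `|complex.Im k| (complex.Im (k ^+ 3) / M))).
  by rewrite !lt_min ltr01 h1' divr_gt0.
move=> k'; rewrite !lt_min => /and3P[d1 d2 d3]; apply/DplusE; split.
  apply: contraTneq d2 => i0; rewrite -leNgt.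
  by have := Im_nc (k' - k); rewrite !ReImE i0 add0r normrN.
have := le_trans (Im_nc _) (nc_cubeB_le d1).
rewrite ltr_pdivlMr// in d3 => /le_lt_trans/(_ d3).
by rewrite !ReImE ltr_norml; move=> /andP[]; lra.
Qed.

Lemma Dplus_scale k (s : R) : 0 < s -> Dplus k -> Dplus (s%:C * k).
Proof.
move=> s0 /DplusE[h1]; rewrite Im_cube => h2; apply/DplusE; rewrite Im_cube !ReImE /=.
rewrite !mul0r subr0 addr0 mulf_neq0 ?(gt_eqF s0)//; split=> //.
set x := complex.Re k in h2 *; set y := complex.Im k in h2 *.
have -> : s * y * (3 * (s * x) ^+ 2 - (s * y) ^+ 2) = s ^+ 3 * (y * (3 * x ^+ 2 - y ^+ 2)).
  by ring.
by rewrite mulr_gt0// exprn_gt0.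
Qed.

Lemma closure_Dplus_scale k (s : R) : 0 < s -> closure Dplus k -> closure Dplus (s%:C * k).
Proof.
move=> s0 /closure_nc h; apply/closure_nc => d d0.
have [|k' Dk' kd] := h (d / s); first by rewrite divr_gt0.
exists (s%:C * k'); first exact: Dplus_scale.
by rewrite -mulrBr ncM nc_real gtr0_norm// mulrC -ltr_pdivlMr.
Qed.

Lemma closure_Dplus_Nconj k : closure Dplus k -> closure Dplus (- conjc k).
Proof.
move=> /closure_nc h; apply/closure_nc => d d0; have [k' Dk' kd] := h _ d0.
exists (- conjc k'); last by rewrite -opprD ncN -rmorphN -rmorphD nc_conj.
move/DplusE: Dk' => [h1 h2]; apply/DplusE; rewrite !Im_cube !(ImN, ReN, Im_conj, Re_conj).
by rewrite !opprK sqrrN -Im_cube.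
Qed.

(** The points with real cube lie on three lines through the origin that bound
    the six sectors, three of which form the domain. *)
Lemma closure_Dplus_real_cube k : complex.Im (k ^+ 3) = 0 -> closure Dplus k.
Proof.
move=> k3; apply/closure_nc => d d0.
(* unless k = 0, moving it slightly parallel to an axis enters the domain *)
case: k k3 => a b; rewrite Im_cube /= => /eqP; rewrite mulf_eq0 => h.
have [b0|b0] := eqVneq b 0.
  have [a0|a0] := eqVneq a 0.
    exists ((d / 2 / 2) +i* (d / 2 / 2)).
      apply/DplusE; rewrite Im_cube /=; have d4 : 0 < d / 2 / 2 by rewrite !divr_gt0.
      rewrite gt_eqF//; split=> //.
      set y := d / 2 / 2 in d4 *; have -> : y * (3 * y ^+ 2 - y ^+ 2) = 2 * y ^+ 3 by ring.
      by rewrite mulr_gt0// exprn_gt0.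
    apply: (le_lt_trans (nc_ReIm _)); rewrite !ReImE /= a0 b0 !subr0.
    by rewrite ger0_norm ?divr_ge0 ?ltW//; lra.
  have a0' : 0 < `|a| by rewrite normr_gt0.
  set y := Num.min (d / 2) `|a|.
  have y0 : 0 < y by rewrite lt_min a0' divr_gt0.
  have yd : y <= d / 2 by rewrite ge_min lexx.
  have ya : y <= `|a| by rewrite ge_min lexx orbT.
  exists (a +i* y).
    apply/DplusE; rewrite Im_cube /= gt_eqF//; split=> //.
    have : y ^+ 2 <= a ^+ 2 by rewrite -(real_normK (num_real a)) ler_pXn2r// nnegrE ltW.
    by move=> h'; rewrite mulr_gt0// subr_gt0 (le_lt_trans h')//; nra.
  apply: (le_lt_trans (nc_ReIm _)); rewrite !ReImE /= b0 subrr normr0 subr0 add0r.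
  by rewrite gtr0_norm//; lra.
have {}h : 3 * a ^+ 2 = b ^+ 2.
  by move: h; rewrite (negbTE b0) /= subr_eq0 => /eqP.
have b2 : 0 < b ^+ 2 by rewrite exprn_even_gt0.
have a0 : a != 0 by apply: contraTneq b2 => a0; rewrite -h a0; rewrite expr0n mulr0 ltxx.
have a0' : 0 < `|a| by rewrite normr_gt0.
set e := Num.min (1 / 2) (d / 2 / `|a|).
have e0 : 0 < e by rewrite lt_min !divr_gt0.
have e1 : e <= 1 / 2 by rewrite ge_min lexx.
have ea : e * `|a| < d.
  have : e <= d / 2 / `|a| by rewrite ge_min lexx orbT.
  by rewrite ler_pdivlMr//; lra.
have a2 : 0 < a ^+ 2 by rewrite exprn_even_gt0.
exists ((a * (1 + Num.sg b * e)) +i* b).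
  apply/DplusE; rewrite Im_cube /= b0; split=> //.
  rewrite exprMn mulrA h -[X in _ - X]mulr1 -mulrBr mulrCA pmulr_rgt0//.
  case: (sgrP b) b0 => // bs _.
    by rewrite mulr_gt0//; nra.
  by rewrite nmulr_rgt0//; nra.
apply: (le_lt_trans (nc_ReIm _)); rewrite !ReImE /= subrr normr0 addr0.
have -> : a * (1 + Num.sg b * e) - a = Num.sg b * (e * a) by ring.
by rewrite !normrM (gtr0_norm e0) normr_sg b0 mul1r.
Qed.

Lemma contour_real_cube k : contour k -> complex.Im (k ^+ 3) = 0.
Proof.
have cexp3 (x : R) : cexp ('i%C * x%:C) ^+ 3 = cexp ('i%C * (3 * x)%:C).
  rewrite !exprS expr0 mulr1 -!cexpD; congr cexp.
  by rewrite rmorphM rmorph_nat; ring.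
have real_pow (c : R[i]) (x : R) : complex.Im c = 0 -> complex.Im (c * x%:C ^+ 3) = 0.
  by move=> c0; rewrite -rmorphXn ImM c0 /= mulr0 mul0r addr0.
move=> [[|]|] [x _ <-].
- by rewrite -(mul1r (_ ^+ _)); exact: real_pow.
- rewrite exprMn cexp3; apply: real_pow; rewrite Im_cexp.
  have -> : complex.Im ('i%C * (3 * (pi / 3))%:C) = pi :> R.
    by rewrite !ReImE /= mul0r add0r mul1r; field.
  by rewrite sinpi mulr0.
- rewrite exprMn cexp3; apply: real_pow; rewrite Im_cexp.
  have -> : complex.Im ('i%C * (3 * (2 * pi / 3))%:C) = pi *+ 2 :> R.
    by rewrite !ReImE /= mul0r add0r mul1r -mulr_natl; field.
  by rewrite sin2pi mulr0.
Qed.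

(** The closure of the domain is a cone, so its points can be approached along
    their own ray. *)
Lemma radial_limit_point (U : set R[i]) k (s d : R) : k != 0 -> (s = 1 \/ s = -1) ->
  (forall x : R, 0 < x -> x < 1 -> U ((1 + s * x)%:C * k)) -> 0 < d ->
  exists2 k', U k' & (k' != k) && (nc (k' - k) < d).
Proof.
move=> k0 s1 H d0; have n0 : 0 < nc k by rewrite nc_gt0.
set x := Num.min (1 / 2) (d / 2 / nc k).
have x0 : 0 < x by rewrite lt_min !divr_gt0.
have xe : x < 1.
  by rewrite (le_lt_trans (_ : _ <= 1 / 2)) ?ge_min ?lexx// ltr_pdivrMr// mul1r ltr1n.
have xd : x * nc k < d.
  have : x <= d / 2 / nc k by rewrite ge_min lexx orbT.
  by rewrite ler_pdivlMr//; lra.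
have E : (1 + s * x)%:C * k - k = (s * x)%:C * k by rewrite rmorphD; ring.
have nE : nc ((s * x)%:C * k) = x * nc k.
  by rewrite ncM nc_real normrM (gtr0_norm x0); case: s1 => ->; rewrite ?normrN normr1 mul1r.
exists ((1 + s * x)%:C * k); first exact: H.
rewrite -subr_eq0 -nc_eq0 E nE xd andbT gt_eqF// mulr_gt0//.
Qed.

End Geometry.

(** * Smoothness of the spectral functions *)

Section ScalarFamilies.
Variable R : realType.
Variables (Om : set R[i]) (rho : R[i] -> R).
Hypothesis rho_ge0 : forall k, Om k -> 0 <= rho k.
Implicit Types (f : R[i] -> R[i]) (w : R[i] -> R).

Definition scalar f (k : R[i]) (b : bool) (t : R) : R[i] := f k.

Lemma adm_scalar f k : adm (scalar f k).
Proof. exact: (adm_cst (fun=> f k)). Qed.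

Lemma smooth_scalar_cst n (a : R[i]) : smooth Om rho n (fun=> 1) (scalar (fun=> a)).
Proof.
by apply: (smooth_cst rho_ge0 n (w := fun=> 1) (Y := fun _ _ => a) (c := nc a)) => //;
  exact: (adm_cst (fun=> a)).
Qed.

Lemma smooth_id n w : (forall k, Om k -> nc k <= w k) ->
  (forall k, Om k -> 1 <= w k * rho k) -> smooth Om rho n w (scalar id).
Proof.
move=> w0 w1.
have h1 : fam_cont Om (scalar id).
  by move=> k Ok e e0; exists e => // k' _ kd b t _; exact: ltW.
have h2 : fam_bounded Om w (scalar id).
  by exists 1 => // k Ok b t _; rewrite mul1r w0.
case: n => [|n]; split => //; try by move=> k _; exact: adm_scalar.
exists (scalar (fun=> 1)).
  move=> k Ok e e0; exists 1 => // k' _ _ b t _.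
  by rewrite /scalar mulr1 subrr nc0 mulr_ge0 ?nc_ge0// ltW.
apply: (smoothW rho_ge0 ler01 _ (smooth_scalar_cst n 1)) => k Ok.
by rewrite mul1r w1.
Qed.

Lemma smooth_dtheta w : (forall n, smooth Om rho n w (scalar id)) ->
  (forall k, Om k -> w k * w k <= rho k) ->
  forall n, smooth Om rho n rho (fun k b _ => dtheta b k).
Proof.
move=> sid w2 n.
pose a (b : bool) : R[i] := if b then 24 * 'i%C else 0.
have s0 : smooth Om rho n (fun=> 1) (fun _ b _ => a b).
  apply: (smooth_cst rho_ge0 n (w := fun=> 1) (Y := fun b _ => a b) (c := nc (24 * 'i%C))) => //.
  by move=> [] t _; rewrite /a ?nc0 ?nc_ge0.
apply: (smoothW rho_ge0 ler01 (w := fun k => 1 * (w k * w k))) => [k Ok|].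
  by rewrite !mul1r w2.
apply: eq_smooth (smoothM rho_ge0 s0 (smoothM rho_ge0 (sid n) (sid n))) => k b t _ _.
by rewrite /scalar /dtheta /a expr2; case: b; rewrite ?mul0r.
Qed.

Lemma eq_fam_der (f g f' g' : R[i] -> bool -> R -> R[i]) : (forall k b t, f k b t = g k b t) ->
  (forall k b t, f' k b t = g' k b t) -> fam_der Om f f' -> fam_der Om g g'.
Proof.
move=> fg fg' h k Ok e e0; have [d d0 H] := h k Ok e e0; exists d => // k' Ok' kd.
by apply: eq_bnd (H _ Ok' kd) => b t _; rewrite !fg fg'.
Qed.

Section Powers.
Variables (f f' : R[i] -> R[i]).
Hypothesis sf : forall n, smooth Om rho n (fun=> 1) (scalar f).
Hypothesis sf' : forall n, smooth Om rho n rho (scalar f').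
Hypothesis df : fam_der Om (scalar f) (scalar f').

Lemma smooth_power n l : smooth Om rho n (fun=> 1) (scalar (fun k => f k ^+ l)).
Proof.
apply: (smoothW rho_ge0 ler01 _ (smoothX rho_ge0 l (sf n))) => k _.
by rewrite expr1n mul1r.
Qed.

Lemma smooth_power' n l :
  smooth Om rho n rho (scalar (fun k => l%:R * f k ^+ l.-1 * f' k)).
Proof.
apply: (smoothW rho_ge0 ler01 _
  (smoothM rho_ge0 (smoothZ rho_ge0 l%:R (smooth_power n l.-1)) (sf' n))) => k _.
by rewrite !mul1r.
Qed.

Lemma fam_der_power l : fam_der Om (scalar (fun k => f k ^+ l))
  (scalar (fun k => l%:R * f k ^+ l.-1 * f' k)).
Proof.
elim: l => [|l IH].
  move=> k Ok e e0; exists 1 => // k' _ _ b t _.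
  by rewrite /scalar !expr0 !mul0r mulr0 !subrr nc0 mulr_ge0 ?nc_ge0// ltW.
have [_ _ bf] := smoothE (sf 0); have [_ _ bf'] := smoothE (sf' 0).
have [_ cl bl] := smoothE (smooth_power 0 l).
apply: eq_fam_der (fam_derM df IH cl bf bf' bl) => k b t; rewrite /scalar.
  by rewrite exprS.
by case: l {IH cl bl} => [|l] /=; rewrite ?expr0 ?exprS -?(natr1 l.+1); ring.
Qed.

End Powers.
End ScalarFamilies.

Section Interior.
Variable R : realType.
Variables (N : nat) (lam : R) (g : 'I_3 -> R -> R) (T : R -> R[i] -> 'M[R[i]]_2).
Hypothesis lam2 : lam ^+ 2 = 1.
Hypothesis hT : volterra_solution lam g T.
Hypothesis hlax : forall l, weighted_L1 N (lax lam g l).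

Definition inner (K : R) : set R[i] := [set k | closure Dplus k /\ nc k < K].

Lemma free_adm : adm (@free R).
Proof. exact: (adm_cst (fun b : bool => if b then 0 else 1)). Qed.

Lemma free_bnd : bnd (@free R) 1.
Proof. by move=> [] t _; rewrite /free /= ?nc0 ?nc1. Qed.

(** On a bounded set powers of [k] are bounded, and no loss per derivative has
    to be recorded. *)
Theorem smooth_inner K : 1 <= K -> smooth (inner K) (fun=> 1) N (fun=> 1) (col T).
Proof.
move=> K1; have K0 : 0 <= K by exact: le_trans K1.
have r0 k : inner K k -> 0 <= 1 :> R by [].
have sid n : smooth (inner K) (fun=> 1) n (fun=> 1) (scalar id).
  apply: (smoothW r0 K0 (w := fun=> K)) => [k _|]; first by rewrite mulr1.
  by apply: (smooth_id r0) => k [_ kK]; rewrite ?mulr1// ltW.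
have sk n : smooth (inner K) (fun=> 1) n (fun=> 1) (scalar (@kap R)).
  by apply: (smoothZ r0); exact: sid.
have sk' n : smooth (inner K) (fun=> 1) n (fun=> 1) (scalar (fun=> - 'i%C : R[i])).
  exact: (smooth_scalar_cst r0).
have dk : fam_der (inner K) (scalar (@kap R)) (scalar (fun=> - 'i%C : R[i])).
  move=> k Ok e e0; exists 1 => // k' _ _ b t _; rewrite /scalar /kap.
  have -> : - 'i%C * k' - - 'i%C * k - (k' - k) * - 'i%C = 0 :> R[i] by ring.
  by rewrite nc0 mulr_ge0 ?nc_ge0// ltW.
have hF := smooth_cst r0 N (w := fun=> 1) free_adm free_bnd (fun _ _ => lexx 1).
have hth k : inner K k -> complex.Re (theta true k) <= 0 by move=> [/Re_theta_closure_Dplus].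
have w2 k : inner K k -> 1 * 1 <= 1 :> R by rewrite mulr1.
apply: (smooth_solution (d := 3) (c := fun l k => kap k ^+ l) hlax r0 hth
  (smooth_dtheta r0 sid w2)
  (smooth_power r0 sk) (smooth_power' r0 sk sk') (fam_der_power r0 sk sk' dk) (leqnn N) _ hF).
- by [].
- by move=> k [clk _]; exact: (col_adm lam2 hT clk).
- by move=> k [clk _]; exact: (col_bounded lam2 hT hlax clk).
- by move=> k [clk _]; exact: (col_solves lam2 hT hlax clk).
Qed.

End Interior.

Section Exterior.
Variable R : realType.

Definition outer : set R[i] := [set k | 1 < nc k].
Definition sq (k : R[i]) : R := nc k ^+ 2.

Section Inverse.
Variable Om : set R[i].
Hypothesis Om1 : Om `<=` outer.

Lemma outer_neq0 k : Om k -> k != 0.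
Proof. by move=> /Om1 h; rewrite -nc_gt0; exact: lt_trans h. Qed.

Lemma sq_ge0 k : Om k -> 0 <= sq k. Proof. by move=> _; rewrite exprn_ge0 ?nc_ge0. Qed.

Lemma ncV_le1 k : Om k -> (nc k)^-1 <= 1.
Proof. by move=> /Om1 h; rewrite invf_le1 ?(lt_trans ltr01)// ltW. Qed.

Lemma fam_der_inv (a : R[i]) :
  fam_der Om (scalar (fun k => a * k^-1)) (scalar (fun k => - a * (k^-1 * k^-1))).
Proof.
move=> k Ok e e0; have k0 := outer_neq0 Ok.
have a1 : 0 < nc a + 1 by rewrite ltr_wpDl ?nc_ge0.
exists (e / (nc a + 1)); first by rewrite divr_gt0.
move=> k' Ok' kd b t _; have k'0 := outer_neq0 Ok'; rewrite /scalar.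
have -> : a * k'^-1 - a * k^-1 - (k' - k) * (- a * (k^-1 * k^-1)) =
    a * (k' - k) * (k^-1 * k^-1 * k'^-1) * (k' - k) by field; rewrite k0 k'0.
rewrite ncM ler_wpM2r ?nc_ge0// !ncM !ncV.
have n0 := @nc_ge0 R; have vle := ncV_le1.
apply: (@le_trans _ _ (nc a * nc (k' - k) * 1)).
  rewrite ler_wpM2l ?mulr_ge0//.
  have v0 (x : R[i]) : 0 <= (nc x)^-1 by rewrite invr_ge0.
  by rewrite mulr_ile1 ?mulr_ge0// ?mulr_ile1// vle.
rewrite mulr1; move: kd; rewrite ltr_pdivlMr// => kd.
apply: le_trans (ltW kd); rewrite mulrC ler_wpM2l// lerDl//.
Qed.

(** By induction, since the derivative of [1 / k] is again a product of such
    functions. *)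
Lemma smooth_inv n (a : R[i]) : smooth Om sq n (fun k => (nc k)^-1) (scalar (fun k => a * k^-1)).
Proof.
have v0 (x : R[i]) : 0 <= (nc x)^-1 by rewrite invr_ge0 nc_ge0.
elim: n a => [|n IH] a.
all: have h1 : fam_cont Om (scalar (fun k => a * k^-1)).
1,3: move=> k Ok e e0; have a1 : 0 < nc a + 1 by [rewrite ltr_wpDl ?nc_ge0];
  exists (e / (nc a + 1)); [by rewrite divr_gt0|move=> k' Ok' kd b t _];
  have k0 := outer_neq0 Ok; have k'0 := outer_neq0 Ok';
  rewrite /scalar; have -> : a * k'^-1 - a * k^-1 = - (a * (k' - k)) * (k^-1 * k'^-1)
    by [field; rewrite k0 k'0];
  rewrite !(ncM, ncN, ncV); move: kd; rewrite ltr_pdivlMr// => kd;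
  apply: (@le_trans _ _ (nc a * nc (k' - k) * 1));
  [by rewrite ler_wpM2l ?mulr_ge0 ?nc_ge0// mulr_ile1 ?ncV_le1//|];
  rewrite mulr1; apply: le_trans (ltW kd); rewrite mulrC ler_wpM2l ?nc_ge0// lerDl//.
all: have h2 : fam_bounded Om (fun k => (nc k)^-1) (scalar (fun k => a * k^-1)) by
  [exists (nc a); [exact: nc_ge0|move=> k _ b t _; rewrite /scalar ncM ncV]].
  by split=> // k _; exact: adm_scalar.
split=> //.
exists (scalar (fun k => - a * (k^-1 * k^-1))); first exact: fam_der_inv.
apply: (eq_smooth (f := fun k b t => scalar (fun k => - a * k^-1) k b t *
    scalar (fun k => 1 * k^-1) k b t)).
  by move=> k b t _ _; rewrite /scalar mul1r mulrA.
apply: (smoothW sq_ge0 ler01 _ (smoothM sq_ge0 (IH (- a)) (IH 1))) => k Ok.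
have /Om1 n1 := Ok; have n0 : 0 < nc k by exact: lt_trans n1.
rewrite mul1r /sq expr2 mulrA mulVf ?gt_eqF// mul1r.
by rewrite (le_trans (mulr_ile1 _ _ _ _)) ?ncV_le1// ltW.
Qed.

(** A factor [(a / k) ^ j] of a bounded family gains the weight [|k| ^ - j],
    which is preserved by differentiation. *)
Lemma smooth_decay n (j : nat) (f : R[i] -> bool -> R -> R[i]) (a : R[i]) :
  smooth Om sq n (fun=> 1) f ->
  smooth Om sq n (fun k => (nc k)^-1 ^+ j) (fun k b t => (a * k^-1) ^+ j * f k b t).
Proof.
move=> sf.
apply: (smoothW sq_ge0 ler01 _ (smoothM sq_ge0 (smoothX sq_ge0 j (smooth_inv n a)) sf)) => k _.
by rewrite mulr1 mul1r.
Qed.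

Lemma smooth_inv1 n (a : R[i]) : smooth Om sq n (fun=> 1) (scalar (fun k => a * k^-1)).
Proof.
by apply: (smoothW sq_ge0 ler01 _ (smooth_inv n a)) => k Ok; rewrite mul1r ncV_le1.
Qed.

Lemma smooth_inv1' n (a : R[i]) : smooth Om sq n sq (scalar (fun k => - a * (k^-1 * k^-1))).
Proof.
apply: (smoothW sq_ge0 ler01 (w := fun=> 1 * 1)) => [k Ok|].
  by rewrite !mul1r /sq -[leLHS](expr1n _ 2) ler_pXn2r ?nnegrE ?nc_ge0// ltW// Om1.
apply: eq_smooth (smoothM sq_ge0 (smooth_inv1 n (- a)) (smooth_inv1 n 1)) => k b t _ _.
by rewrite /scalar mul1r mulrA.
Qed.

Lemma smooth_ev n (p : {poly R}) (a : R[i]) :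
  smooth Om sq n (fun=> 1) (scalar (fun k => ev p (a * k^-1))).
Proof.
apply: (eq_smooth (f := fun k b t => \sum_(l <- iota 0 (size p))
    (p`_l)%:C * (a * k^-1) ^+ l)) => [k b t _ _|].
  by rewrite /scalar (ev_sum _ (leqnn _)) -(big_mkord xpredT (fun l => (p`_l)%:C * (a * k^-1) ^+ l))
    /index_iota subn0.
apply: (smooth_sum sq_ge0) => // l; apply: (smoothZ sq_ge0).
apply: (smoothW sq_ge0 ler01 _ (smoothX sq_ge0 l (smooth_inv1 n a))) => k _.
by rewrite expr1n mul1r.
Qed.

Lemma smooth_expansion n c0 (c : nat -> R[i]) m :
  smooth Om sq n (fun=> 1) (scalar (expansion c0 c m)).
Proof.
apply: smoothD; first exact: (smooth_scalar_cst sq_ge0).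
apply: (smooth_sum sq_ge0) => // l; apply: (smoothZ sq_ge0 (c l)).
apply: (eq_smooth (f := fun k b t => (scalar (fun k => 1 * k^-1) k b t) ^+ l)).
  by move=> k b t _ _; rewrite /scalar mul1r exprVn.
apply: (smoothW sq_ge0 ler01 _ (smoothX sq_ge0 l (smooth_inv1 n 1))) => k _.
by rewrite expr1n mul1r.
Qed.

End Inverse.
End Exterior.

(** * Expansion of the spectral functions and of their derivatives *)

Section Assembly.
Variable R : realType.
Implicit Types (k : R[i]) (f : R[i] -> R[i]).

Definition far : set R[i] := [set k | closure Dplus k /\ 1 < nc k].

Lemma far_outer : far `<=` @outer R. Proof. by move=> k []. Qed.

Lemma perfect_inner (K : R) : 0 < K -> perfect (@inner R K).
Proof.
move=> K0 k [clk kK] d d0; have [k0|k0] := eqVneq k 0.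
  set x := Num.min (d / 2) (K / 2); have x0 : 0 < x by rewrite lt_min !divr_gt0.
  exists (x%:C).
    split; first by apply: closure_Dplus_real_cube; rewrite -rmorphXn.
    rewrite nc_real gtr0_norm// (le_lt_trans (_ : _ <= K / 2)) ?ge_min ?lexx ?orbT//.
    by rewrite ltr_pdivrMr// ltr_pMr// ltr1n.
  rewrite k0 subr0 nc_real gtr0_norm// -nc_eq0 nc_real gtr0_norm// gt_eqF//=.
  rewrite (le_lt_trans (_ : _ <= d / 2)) ?ge_min ?lexx//.
  by rewrite ltr_pdivrMr// ltr_pMr// ltr1n.
apply: (@radial_limit_point R (inner K) k (-1) d k0 (or_intror erefl) _ d0) => x x0 x1.
 have x2 : 0 < 1 + -1 * x by lra.
split; first exact: closure_Dplus_scale.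
rewrite ncM nc_real gtr0_norm//; apply: le_lt_trans kK.
by rewrite ler_piMl ?nc_ge0//; lra.
Qed.

Lemma perfect_far : perfect far.
Proof.
move=> k [clk k1] d d0.
have k0 : k != 0 by rewrite -nc_gt0; exact: lt_trans k1.
apply: (@radial_limit_point R far k 1 d k0 (or_introl erefl) _ d0) => x x0 x1.
have x2 : 0 < 1 + 1 * x by lra.
split; first exact: closure_Dplus_scale.
by rewrite ncM nc_real gtr0_norm//; apply: (lt_le_trans k1); rewrite ler_peMl ?nc_ge0//; lra.
Qed.

Lemma open_outer : open (@outer R).
Proof.
apply/open_nc => k k1; exists (nc k - 1); first by rewrite subr_gt0.
move=> k' kd; have := ncB k (k - k'); rewrite opprB addrC subrK.
have := ncD k' (k - k'); rewrite addrC subrK ncC => h _.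
by rewrite /outer /=; move: h kd; lra.
Qed.

Lemma towerD (U : set R[i]) n F G : tower U n F -> tower U n G ->
  tower U n (fun j k => F j k + G j k).
Proof.
move=> [cF dF] [cG dG]; split => j jn; last exact: rderD (dF _ jn) (dG _ jn).
move=> k Uk e e0; have e2 : 0 < e / 2 by rewrite divr_gt0.
have [d d0 H] := cF _ jn k Uk _ e2; have [d' d'0 H'] := cG _ jn k Uk _ e2.
exists (Num.min d d'); first by rewrite lt_min d0.
move=> k' Uk'; rewrite lt_min => /andP[kd kd'].
have -> : F j k' + G j k' - (F j k + G j k) = (F j k' - F j k) + (G j k' - G j k) by ring.
by apply: le_trans (ncD _ _) _; rewrite [e]splitr lerD ?H ?H'.
Qed.

(** The derivatives on [|k| < K] agree for all values of [K]; the one with [K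
    = |k| + 1] is used at [k]. *)
Lemma exists_global_tower n f :
  (forall K : R, 1 <= K -> exists F, tower (@inner R K) n F /\ forall k, F 0%N k = f k) ->
  exists F, tower (closure Dplus) n F /\ forall k, closure Dplus k -> F 0%N k = f k.
Proof.
move=> h.
have h' K : exists F, 1 <= K -> tower (@inner R K) n F /\ forall k, F 0%N k = f k.
  have [K1|K1] := boolP (1 <= K); last by exists (fun=> f).
  by have [F HF] := h _ K1; exists F.
pose FK K := sval (cid (h' K)).
have hFK K : 1 <= K -> tower (@inner R K) n (FK K) /\ forall k, FK K 0%N k = f k.
  by rewrite /FK; case: cid.
have k1 k : 1 <= nc k + 1 by rewrite lerDr nc_ge0.
pose F j k := FK (nc k + 1) j k.
have FE K k j : 1 <= K -> inner K k -> (j <= n)%N -> F j k = FK K j k.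
  move=> K1 [clk kK] jn; set K' := Num.min K (nc k + 1).
  have K'0 : 0 < K' by rewrite lt_min (lt_le_trans ltr01 K1) (lt_le_trans ltr01 (k1 k)).
  have sub1 : inner K' `<=` inner K.
    by move=> x [? xK]; split => //; apply: (lt_le_trans xK); rewrite ge_min lexx.
  have sub2 : inner K' `<=` inner (nc k + 1).
    by move=> x [? xK]; split => //; apply: (lt_le_trans xK); rewrite ge_min lexx orbT.
  have [t1 e1] := hFK _ K1; have [t2 e2] := hFK _ (k1 k).
  apply: (tower_unique (perfect_inner K'0) (towerS sub2 t2) (towerS sub1 t1)) => //.
    by move=> x _; rewrite e1 e2.
  by split => //; rewrite lt_min kK ltrDl ltr01.
exists F; split; last by move=> k _; have [_ h0] := hFK _ (k1 k); exact: h0.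
have near_inner k k' : nc (k' - k) < 1 -> closure Dplus k' -> inner (nc k + 1) k'.
  move=> kd clk'; split => //; have := ncD (k' - k) k; rewrite subrK; move: kd; lra.
split => j jn k clk e e0; have [[cF dF] _] := hFK _ (k1 k).
  have Ik : inner (nc k + 1) k by apply: near_inner => //; rewrite subrr nc0.
  have [d d0 H] := cF j jn k Ik e e0.
  exists (Num.min 1 d); first by rewrite lt_min ltr01.
  move=> k' clk'; rewrite lt_min => /andP[kd1 kd]; have Ik' := near_inner _ _ kd1 clk'.
  by rewrite (FE _ _ _ (k1 k) Ik jn) (FE _ _ _ (k1 k) Ik' jn); exact: H.
have Ik : inner (nc k + 1) k by apply: near_inner => //; rewrite subrr nc0.
have [d d0 H] := dF j jn k Ik e e0.
exists (Num.min 1 d); first by rewrite lt_min ltr01.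
move=> k' clk'; rewrite lt_min => /andP[kd1 kd]; have Ik' := near_inner _ _ kd1 clk'.
rewrite (FE _ _ _ (k1 k) Ik (ltnW jn)) (FE _ _ _ (k1 k) Ik' (ltnW jn)) (FE _ _ _ (k1 k) Ik jn).
exact: H.
Qed.

Lemma exprz_weight (F : fieldType) (x : F) (m j : nat) : x != 0 ->
  x ^ (- (m%:Z + 1 - 2 * j%:Z)) = x^-1 ^+ m.+1 * (x ^+ 2) ^+ j.
Proof.
move=> x0; have -> : - (m%:Z + 1 - 2 * j%:Z) = (2 * j)%N%:Z - (m.+1)%:Z by lia.
by rewrite expfzDr// -exprnP -exprnN exprVn exprM mulrC.
Qed.

(** Each derivative contributes a factor [|k| ^ 2] to the bound of the
    remainder. *)
Lemma bigO_weight (f : R[i] -> R[i]) (m j : nat) (C : R) :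
  (forall k, far k -> nc (f k) <= C * ((nc k)^-1 ^+ m.+1 * sq k ^+ j)) ->
  bigO_infty (closure Dplus) f (m%:Z + 1 - 2 * j%:Z).
Proof.
move=> h; exists C, 2; split => // k clk; rewrite !normrE_nc lecR => k2.
have k1 : 1 < nc k by apply: lt_le_trans k2; rewrite ltr1n.
have k0 : (nc k)%:C != 0 :> R[i].
  by rewrite -nc_eq0 nc_real normr_eq0 gt_eqF// (lt_trans ltr01).
rewrite exprz_weight// -fmorphV -!rmorphXn -!rmorphM lecR.
by apply: h; split.
Qed.

Section Function.
Variables (n m : nat) (f : R[i] -> R[i]) (c0 : R[i]) (c : nat -> R[i]).
Hypothesis n0 : (0 < n)%N.
Hypothesis f_inner : forall K : R, 1 <= K ->
  smooth (@inner R K) (fun=> 1) n (fun=> 1) (scalar f).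
Hypothesis f_far : smooth far (@sq R) n (fun k => (nc k)^-1 ^+ m.+1)
  (scalar (fun k => f k - expansion c0 c m k)).

Let h := expansion c0 c m.

(** Near infinity the derivatives of [f] are those of the expansion plus those
    of the remainder, by uniqueness of relative derivatives; those of the
    expansion, which is defined off the origin, are complex derivatives. *)
Theorem expansion_of_smooth :
  [/\ {within closure Dplus, continuous f}, holomorphic_on Dplus f,
   bigO_infty (closure Dplus) (fun k => f k - expansion c0 c m k) (m%:Z + 1) &
   forall j, (1 <= j <= n)%N ->
     derivative_expansion Dplus f (expansion c0 c m) j (m%:Z + 1 - 2 * j%:Z)].
Proof.
have [F [tF F0]] : exists F, tower (closure Dplus) n F /\
    forall k, closure Dplus k -> F 0%N k = f k.
  apply: exists_global_tower => K K1.
  by have [F [F0 tF _]] := smooth_tower true (f_inner K1); exists F.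
have [E [E0 tE bE]] := smooth_tower true f_far.
have sh : smooth (@outer R) (@sq R) n (fun=> 1) (scalar h).
  exact: (smooth_expansion (fun _ => id)).
have [H [H0 tH _]] := smooth_tower true sh.
have [dH _] := tower_derive1n open_outer tH (fun k _ => esym (H0 k)).
have FE j k : (j <= n)%N -> far k -> F j k - derive1n j h k = E j k.
  move=> jn fk; rewrite dH//; last by case: fk.
  apply/eqP; rewrite subr_eq; apply/eqP.
  have cf : far `<=` closure Dplus by move=> ? [].
  apply: (tower_unique perfect_far (towerS cf tF) (towerD tE (towerS far_outer tH))) => //.
  by move=> x fx; rewrite F0 ?E0 ?H0 ?/scalar ?subrK//; case: fx.
have [dF hF] := tower_derive1n (@open_Dplus R) (towerS (@subset_closure _ Dplus) tF)
  (fun k Dk => esym (F0 k (subset_closure Dk))).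
have cF j : (j <= n)%N -> {within closure Dplus, continuous (F j)}.
  move=> jn; apply: within_continuous_nc => k clk e e0.
  have e2 : 0 < e / 2 by rewrite divr_gt0.
  have [d d0 hd] := tF.1 j jn k clk _ e2; exists d => // k' clk' kd.
  apply: le_lt_trans (hd _ clk' kd) _; rewrite ltr_pdivrMr// ltr_pMr// ltr1n//.
have bO j : (j <= n)%N ->
    bigO_infty (closure Dplus) (fun k => F j k - derive1n j h k) (m%:Z + 1 - 2 * j%:Z).
  move=> jn; have [C hC] := bE j jn.
  by apply: (@bigO_weight _ m j C) => k fk; rewrite FE//; exact: hC.
split.
- have := cF 0%N isT; apply: subspace_eq_continuous => k /set_mem; exact: F0.
- by move=> k Dk; exact: (hF 0%N n0).
- have := bO 0%N isT; rewrite mulr0 subr0 => -[C [K [K0 HC]]]; exists C, K; split=> // k clk kK.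
  by have := HC k clk kK; rewrite F0.
- move=> j /andP[j1 jn]; split.
    by move=> i ij k Dk; apply: hF => //; exact: leq_trans ij jn.
  by exists (F j); split; [exact: cF|move=> k Dk; rewrite dF|exact: bO].
Qed.

End Function.

Lemma smooth_eval (Om : set R[i]) rho n w (F : R[i] -> bool -> R -> R[i]) b :
  smooth Om rho n w F -> smooth Om rho n w (scalar (fun k => F k b 0)).
Proof.
elim: n w F => [|n IH] w F sF; have [_ cF [C C0 bF]] := smoothE sF.
all: have h1 : fam_cont Om (scalar (fun k => F k b 0)) by
  [move=> k Ok e e0; have [d d0 H] := cF k Ok e e0; exists d => // k' Ok' kd b' t _; exact: H].
all: have h2 : fam_bounded Om w (scalar (fun k => F k b 0)) by
  [exists C => // k Ok b' t _; exact: bF].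
  by split=> // k _; exact: adm_scalar.
move: sF => [_ _ _ [F' dF sF']]; split=> //.
exists (scalar (fun k => F' k b 0)); last exact: IH.
by move=> k Ok e e0; have [d d0 H] := dF k Ok e e0; exists d => // k' Ok' kd b' t _; exact: H.
Qed.

Lemma ev_expansion m (q : {poly R}) k : (size q <= m.+1)%N ->
  ev q ('i%C * k^-1) = expansion (q`_0)%:C (fun l => (q`_l)%:C * 'i%C ^+ l) m k.
Proof.
move=> sq; rewrite (ev_sum _ sq) /expansion.
rewrite -(big_mkord xpredT (fun l => (q`_l)%:C * ('i%C * k^-1) ^+ l)) big_ltn// expr0 mulr1.
by congr (_ + _); apply: eq_bigr => l _; rewrite exprMn exprVn mulrA.
Qed.

Lemma kapV k : (kap k)^-1 = 'i%C * k^-1.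
Proof.
have i2 : ('i%C : R[i]) * 'i%C = -1 by rewrite -expr2 sqr_i.
have iV : (- 'i%C : R[i])^-1 = 'i%C.
  by apply: (mulfI (x := - 'i%C)); rewrite ?mulfV ?mulNr ?i2 ?opprK// oppr_eq0 -nc_eq0 nc_i oner_neq0.
by rewrite /kap invfM iV.
Qed.

Section SpectralExpansion.
Variables (N m : nat) (lam : R) (g : 'I_3 -> R -> R) (T : R -> R[i] -> 'M[R[i]]_2).
Hypothesis lam2 : lam ^+ 2 = 1.
Hypothesis hT : volterra_solution lam g T.
Hypothesis hg : forall j : 'I_3, Kclass N ((m + 5 - j) %/ 3) (g j).

(** The constants of the expansions are the coefficients of [V] and [W V] at
    [t = 0], times powers of [i]; the part of [W V] of degree above [m] goes
    into the remainder. *)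
Theorem smooth_remainder : exists a b : nat -> R[i],
  smooth far (@sq R) N (fun k => (nc k)^-1 ^+ m.+1)
    (scalar (fun k => col T k false 0 - expansion 1 a m k)) /\
  smooth far (@sq R) N (fun k => (nc k)^-1 ^+ m.+1)
    (scalar (fun k => col T k true 0 - expansion 0 b m k)).
Proof.
have [D [psi [chi [w [x [p [hpsi hchi w0 [p0 sp] H]]]]]]] := normal_form lam2 hT hg.
pose z k := 'i%C * k^-1; pose c (l : nat) k := z k ^+ l.
have exY k : exists Y, far k -> [/\ adm Y, exists B : R, bnd Y B,
    solves D psi c k Y (opL D chi c k (@one R)),
    col T k false 0 = ev p (z k) + z k ^+ m.+1 * (Y false 0 + ev x (z k) * Y true 0) &
    col T k true 0 = ev w (z k) * col T k false 0 + z k ^+ m.+1 * Y true 0].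
  have [[clk k1]|nf] := pselect (far k); last by exists (fun _ _ => 0).
  have k0 : k != 0 by rewrite -nc_gt0 (lt_trans ltr01).
  by have := H k clk k0; rewrite kapV => -[Y hY]; exists Y.
have [Y hY] := boolp.choice exY.
have r0 := @sq_ge0 R far.
have zs n : smooth far (@sq R) n (fun=> 1) (scalar z) by exact: (smooth_inv1 far_outer).
have zs' n : smooth far (@sq R) n (@sq R) (scalar (fun k => - 'i%C * (k^-1 * k^-1))).
  exact: (smooth_inv1' far_outer).
have dz := fam_der_inv far_outer 'i%C.
have sid n : smooth far (@sq R) n (@nc R) (scalar id).
  apply: (smooth_id r0) => k [_ k1]; rewrite ?lexx// /sq.
  by rewrite -exprS -[leLHS](expr1n _ 3) ler_pXn2r ?nnegrE ?nc_ge0// ltW.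
have hth k : far k -> complex.Re (theta true k) <= 0 by move=> [/Re_theta_closure_Dplus].
have dth : forall n, smooth far (@sq R) n (@sq R) (fun k b _ => dtheta b k).
  by apply: (smooth_dtheta r0 sid) => k _; rewrite /sq expr2.
have sF : smooth far (@sq R) N (fun=> 1) (fun k => opL D chi c k (@one R)).
  have s1 := smooth_cst r0 N (w := fun=> 1) (@one_adm R) (@one_bnd R) (fun _ _ => lexx 1).
  exact: (smooth_opL D (c := c) hchi r0 hth dth (smooth_power r0 zs) (leqnn N)
    (fun _ _ => ler01) s1).
have sY : smooth far (@sq R) N (fun=> 1) Y.
  apply: (smooth_solution (d := D) (c := c) hpsi r0 hth dth (smooth_power r0 zs)
    (smooth_power' r0 zs zs') (fam_der_power r0 zs zs' dz) (leqnn N) (fun _ _ => ler01) sF).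
  - by move=> k fk; have [h _ _ _ _] := hY k fk; exact: h.
  - by move=> k fk; have [_ h _ _ _] := hY k fk.
  - by move=> k fk; have [_ _ h _ _] := hY k fk.
have sM1 f1 f2 : smooth far (@sq R) N (fun=> 1) (scalar f1) ->
    smooth far (@sq R) N (fun=> 1) (scalar f2) ->
    smooth far (@sq R) N (fun=> 1) (scalar (fun k => f1 k * f2 k)).
  by move=> s1 s2; apply: (smoothW r0 ler01 _ (smoothM r0 s1 s2)) => k _; rewrite !mulr1.
have sev q : smooth far (@sq R) N (fun=> 1) (scalar (fun k => ev q (z k))).
  exact: (smooth_ev far_outer).
pose rA k := Y k false 0 + ev x (z k) * Y k true 0.
have srA : smooth far (@sq R) N (fun=> 1) (scalar rA).
  by apply: smoothD; [exact: smooth_eval|apply: sM1 => //; exact: smooth_eval].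
pose rB k := ev (drop_poly m.+1 (w * p)) (z k) + (ev w (z k) * rA k + Y k true 0).
have srB : smooth far (@sq R) N (fun=> 1) (scalar rB).
  apply: smoothD; first exact: sev.
  by apply: smoothD; [exact: sM1|exact: smooth_eval].
exists (fun l => (p`_l)%:C * 'i%C ^+ l), (fun l => ((take_poly m.+1 (w * p))`_l)%:C * 'i%C ^+ l).
split.
- apply: eq_smooth (smooth_decay far_outer m.+1 'i%C srA) => k b t fk _.
  have [_ _ _ Ak _] := hY k fk.
  rewrite /scalar Ak (ev_expansion _ sp) p0 -/(z k) -/(rA k).
  by rewrite addrAC subrr add0r.
- apply: eq_smooth (smooth_decay far_outer m.+1 'i%C srB) => k b t fk _.
  have [_ _ _ Ak Bk] := hY k fk.
  have sq : (size (take_poly m.+1 (w * p)) <= m.+1)%N by exact: size_take_poly.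
  have q0 : (take_poly m.+1 (w * p))`_0 = 0.
    by rewrite coef_take_poly /= coefM big_ord_recl big_ord0 w0 mul0r addr0.
  have := ev_expansion k sq; rewrite q0 (_ : 0%:C = 0 :> R[i])// => qE.
  have E : ev w (z k) * ev p (z k) = ev (take_poly m.+1 (w * p)) (z k) +
      ev (drop_poly m.+1 (w * p)) (z k) * z k ^+ m.+1.
    by rewrite -evM -[in LHS](poly_take_drop m.+1 (w * p)) evD evM evXn.
  rewrite /scalar -qE Bk Ak -/(rA k) [ev w (z k) * (_ + _)]mulrDr E -/(z k) /rB.
  by move: (ev _ _) (ev _ _) (ev _ _) (rA k) (Y k true 0) (z k ^+ m.+1) => *; ring.
Qed.

End SpectralExpansion.
End Assembly.

(** * Symmetries and conclusion *)

Section Regularity.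
Variable R : realType.

(** At an interior point of the half-line the relative difference quotient is
    eventually the usual one. *)
Lemma diff_quot_is_derive (f : R -> R) (t : R) : 0 < t ->
  cvg (diff_quot_on (@half_line R) f t) -> is_derive t 1 f (derive_on (@half_line R) f t).
Proof.
move=> t0 cf; set l := derive_on _ _ _.
have fl : (fun s => (s - t)^-1 * (f s - f t)) @ within (@half_line R) t^' --> l by exact: cf.
have shift : (fun h : R => h *: (1 : R) + t) @ 0^' --> within (@half_line R) t^'.
  move=> U; rewrite /within /= /dnbhs /within /= => /nbhs_ballP[e /= e0 He].
  apply/nbhs_ballP; exists (Num.min e t); first by rewrite /= lt_min e0.
  move=> h; rewrite /ball /= sub0r normrN lt_min => /andP[he ht] h0.
  have E : h *: (1 : R) = h by exact: mulr1.
  apply: He; rewrite E.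
  - by rewrite /ball /= opprD addrCA subrr addr0 normrN.
  - by rewrite -subr_eq0 addrK.
  - rewrite /half_line /= in_itv /= andbT; move: ht; rewrite ltr_norml => /andP[]; lra.
have lim_f : (fun h : R => h^-1 *: (f (h *: (1 : R) + t) - f t)) @ 0^' --> l.
  have := cvg_comp _ _ shift fl; apply: cvg_trans; apply: near_eq_cvg.
  by apply: nearW => h /=; rewrite addrK [h *: 1]mulr1.
have df : derivable f t 1 by apply/cvg_ex; exists l.
by split; [exact: df|rewrite /derive; apply: (cvg_lim _ lim_f)].
Qed.

Lemma Kclass_of_cont_diff_on n S (f : R -> R) : cont_diff_on (@half_line R) S f ->
  (forall i, (i <= S)%N -> (@lebesgue_measure R).-integrable (@half_line R)
     (EFin \o (fun t => (1 + t) ^+ n * deriven_on (@half_line R) i f t))) ->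
  Kclass n S f.
Proof.
move=> [hd hc] hi.
suff h s i : (i + s)%N = S -> Kclass n s (deriven_on (@half_line R) i f) by exact: (h S 0%N).
elim: s i => [|s IH] i iS; split => //; try (by apply: hc; lia); try (by apply: hi; lia).
exists (deriven_on (@half_line R) i.+1 f); last by apply: IH; lia.
move=> t t0; apply: diff_quot_is_derive => //; apply: hd; first by lia.
by rewrite /half_line /= in_itv /= andbT ltW.
Qed.

End Regularity.

Section Conjugation.
Variable R : realType.
Implicit Types (f g : R -> R[i]) (k : R[i]).

Lemma cconth_conj f : cconth f -> cconth (fun s => conjc (f s)).
Proof.
move=> [h1 h2]; split; first by under eq_fun do rewrite Re_conj.
by under eq_fun do rewrite Im_conj; exact: conthN.
Qed.

Lemma cder_conj f f' : cder f f' -> cder (fun s => conjc (f s)) (fun s => conjc (f' s)).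
Proof.
move=> h t t0; have [h1 h2] := h t t0; split.
  by under eq_fun do rewrite Re_conj; rewrite Re_conj.
by under eq_fun do rewrite Im_conj; rewrite Im_conj; exact: is_deriveN.
Qed.

Lemma clim_conj f l : clim f l -> clim (fun s => conjc (f s)) (conjc l).
Proof.
move=> h e e0; have [L L0 H] := h e e0; exists L => // t Lt.
by rewrite -rmorphB nc_conj H.
Qed.

Lemma conj_i : conjc ('i%C : R[i]) = - 'i%C.
Proof. by apply: complex_ext; rewrite /= ?oppr0. Qed.

Lemma conjM (z w : R[i]) : conjc (z * w) = conjc z * conjc w. Proof. exact: rmorphM. Qed.
Lemma conjX (z : R[i]) n : conjc (z ^+ n) = conjc z ^+ n. Proof. exact: rmorphXn. Qed.
Lemma conjD (z w : R[i]) : conjc (z + w) = conjc z + conjc w. Proof. exact: rmorphD. Qed.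
Lemma conjN (z : R[i]) : conjc (- z) = - conjc z. Proof. exact: rmorphN. Qed.
Lemma conj_nat n : conjc (n%:R : R[i]) = n%:R. Proof. exact: rmorph_nat. Qed.
Lemma conj0 : conjc (0 : R[i]) = 0. Proof. exact: rmorph0. Qed.

Definition conjE := (conjX, conjD, conjN, conjM, conj_nat, conj_i, @conjc_real R, @conjcK R, conj0).

Lemma theta_Nconj b k : theta b (- conjc k) = conjc (theta b k).
Proof.
by case: b; rewrite /theta ?conj0// !conjE; ring.
Qed.

Lemma kap_Nconj k : kap (- conjc k) = conjc (kap k).
Proof.
by rewrite /kap !conjE; ring.
Qed.

End Conjugation.

Section Symmetries.
Variable R : realType.
Variables (N : nat) (lam : R) (g : 'I_3 -> R -> R) (T : R -> R[i] -> 'M[R[i]]_2).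
Hypothesis lam2 : lam ^+ 2 = 1.
Hypothesis hT : volterra_solution lam g T.
Hypothesis hlax : forall l, weighted_L1 N (lax lam g l).
Implicit Types (k : R[i]).

Let c (l : nat) (k : R[i]) := kap k ^+ l.

Lemma opL_Nconj k Y B b (t : R) : complex.Re (theta true k) <= 0 -> adm Y -> bnd Y B ->
  0 <= t -> opL 3 (lax lam g) c (- conjc k) (fun b t => conjc (Y b t)) b t =
  conjc (opL 3 (lax lam g) c k Y b t).
Proof.
move=> hk aY hY t0; rewrite /opL conjN rmorph_sum /=; congr (- _).
apply: eq_bigr => l _; rewrite /c kap_Nconj [RHS]conjM conjX; congr (_ * _).
have mt : @measurable _ (measurableTypeR R) `[t, +oo[ by exact: measurable_itv.
rewrite /opM /genop -(integralC_conj mt); last first.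
  exact: (opM_integrable (hlax l) (leq0n N) b hk aY hY t0).
apply: eq_integralC => s _; rewrite /expker /src theta_Nconj conjM; congr (_ * _).
  by rewrite expr0 !mul1r -cexp_conj conjM conjc_real.
by rewrite !conjE.
Qed.

Lemma solution_unique k Y Z F : complex.Re (theta true k) <= 0 ->
  adm Y -> adm Z -> (exists B, bnd Y B) -> (exists B, bnd Z B) ->
  solves 3 (lax lam g) c k Y F -> solves 3 (lax lam g) c k Z F ->
  forall b (t : R), 0 <= t -> Y b t = Z b t.
Proof.
move=> hk aY aZ [B hB] [B' hB'] sY sZ b t t0.
pose C := \sum_(l < 3) nc (c l k).
have C0 : 0 <= C by apply: sumr_ge0 => l _; exact: nc_ge0.
have hC l : (l < 3)%N -> nc (c l k) <= C.
  move=> l3; rewrite /C (bigD1 (Ordinal l3)) //= lerDl sumr_ge0// => i _; exact: nc_ge0.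
have b0 : bnd (fun _ _ => 0 : R[i]) 0 by move=> ? ? _; rewrite nc0.
have s0 : solves 3 (lax lam g) c k (fun b t => Y b t - Z b t) (fun _ _ => 0).
  move=> b' t' t'0; rewrite (opLB 3 c hlax hk b' t'0 aY hB aZ hB') addr0.
  by rewrite (sY b' t' t'0) (sZ b' t' t'0); ring.
have := apriori hlax C0 hk hC (admB aY aZ) (bndB hB hB') b0 s0 b t0.
rewrite mulr0 => h; apply/eqP; rewrite -subr_eq0 -nc_eq0; apply/eqP/le_anti.
by rewrite h nc_ge0.
Qed.

(** The system is real in [- i k], so conjugating a solution amounts to
    reflecting [k] in the imaginary axis. *)
Lemma col_Nconj k b (t : R) : closure Dplus k -> 0 <= t ->
  col T k b t = conjc (col T (- conjc k) b t).
Proof.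
move=> clk; have clk' := closure_Dplus_Nconj clk.
have [B hB] := col_bounded lam2 hT hlax clk'.
have aY := col_adm lam2 hT clk'.
apply: (solution_unique (F := @free R) (Z := fun b t => conjc (col T (- conjc k) b t))
  (Re_theta_closure_Dplus clk)).
- exact: (col_adm lam2 hT clk).
- by move=> b'; apply: cconth_cmeas; apply: cconth_conj; exact: (col_cconth lam2 hT clk').
- exact: (col_bounded lam2 hT hlax clk).
- by exists B => b' t' t'0; rewrite nc_conj hB.
- exact: (col_solves lam2 hT hlax clk).
- move=> b' t' t'0.
  have := opL_Nconj b' (Re_theta_closure_Dplus clk') aY hB t'0.
  rewrite conjN conjcK opprK => ->.
  rewrite {1}(col_solves lam2 hT hlax clk' b' t'0) conjD; congr (_ + _).
  by case: b'; rewrite /free ?rmorph0 ?rmorph1.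
Qed.

(** The Wronskian of the column at [k] and of the conjugate column at the
    conjugate point is constant in time; its value is read off at infinity. *)
Lemma col_wronskian k : complex.Im (k ^+ 3) = 0 ->
  col T k false 0 * conjc (col T (conjc k) false 0) -
  lam%:C * col T k true 0 * conjc (col T (conjc k) true 0) = 1.
Proof.
move=> k3.
have clk : closure Dplus k by exact: closure_Dplus_real_cube.
have clk' : closure Dplus (conjc k).
  by apply: closure_Dplus_real_cube; rewrite -rmorphXn Im_conj k3 oppr0.
pose u := col T k true; pose v := col T k false.
pose u' t := conjc (col T (conjc k) true t); pose v' t := conjc (col T (conjc k) false t).
pose W t := v t * v' t - lam%:C * (u t * u' t).
have cu : cconth u by exact: col_cconth lam2 hT _ clk true.
have cv : cconth v by exact: col_cconth lam2 hT _ clk false.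
have cu' : cconth u' by apply: cconth_conj; exact: col_cconth lam2 hT _ clk' true.
have cv' : cconth v' by apply: cconth_conj; exact: col_cconth lam2 hT _ clk' false.
have cW : cconth W.
  apply: cconthD; first exact: cconthM.
  by apply: cconthN; apply: cconthM; [exact: cconth_cst|exact: cconthM].
have du := col_ode lam2 hT hlax clk true; have dv := col_ode lam2 hT hlax clk false.
have du' := cder_conj (col_ode lam2 hT hlax clk' true).
have dv' := cder_conj (col_ode lam2 hT hlax clk' false).
have dW : cder W (fun=> 0).
  (* the terms in theta cancel because theta (conj k) is - conj (theta k) *)
  apply: eq_cder (cderD (cderM dv dv')
    (cderN (cderM (cder_cst lam%:C) (cderM du du')))) => t _.
  rewrite -/u -/v !laxrow_true !laxrow_false -/u -/v.
  rewrite /theta /kap !conjE -/(u' t) -/(v' t).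
  have l2 : lam%:C ^+ 2 = 1 :> R[i] by rewrite -rmorphXn lam2 rmorph1.
  by ring: l2.
have lu : clim u 0.
  by apply: clim_eq (col_limit lam2 hT hlax clk true) => t _; rewrite /free subr0.
have lu' : clim u' 0.
  have := clim_conj (col_limit lam2 hT hlax clk' true); rewrite rmorph0.
  by apply: clim_eq => t _; rewrite /free subr0.
have lv := col_limit lam2 hT hlax clk false.
have lv' := clim_conj (col_limit lam2 hT hlax clk' false).
have [B hB] := col_bounded lam2 hT hlax clk; have [B' hB'] := col_bounded lam2 hT hlax clk'.
have bv' t : 0 <= t -> nc (v' t) <= B' by move=> t0; rewrite nc_conj hB'.
have lW : clim W 1.
  have := climD (clim0M bv' lv) (climD lv' (climD (clim_cst 1)
    (clim0Z (- lam%:C) (clim0M (hB true) lu')))).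
  rewrite rmorph0 !addr0 !add0r; apply: clim_eq => t _.
  by rewrite /W /free conjD conjN conjc1 -/(v' t) -/(v t) -/(u t); ring.
have iz : integrableC `[(0 : R), +oo[ (fun=> 0 : R[i]).
  by split; exact: integrable0.
have := FTC_ctail cW (cconth_cst 0) iz dW lW (lexx 0).
rewrite integralC0 ?subr0; last exact: measurable_itv.
by rewrite /W mulrA.
Qed.

End Symmetries.

Theorem theorem4p3 (R : realType) (lambda : R) (m n : nat)
    (g : 'I_3 -> R -> R) (T : R -> R[i] -> 'M[R[i]]_2)
    (hlambda : lambda = 1 \/ lambda = -1)
    (hm : (1 <= m)%N) (hn : (1 <= n)%N)
    (hgC : forall j : 'I_3,
       cont_diff_on (@half_line R) ((m + 5 - j) %/ 3) (g j))
    (hgL1 : forall (j : 'I_3) (i : nat), (i <= (m + 5 - j) %/ 3)%N ->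
       (@lebesgue_measure R).-integrable (@half_line R)
         (EFin \o (fun t => (1 + t) ^+ n * deriven_on (@half_line R) i (g j) t)))
    (hT : volterra_solution lambda g T) :
  let A := spectralA T in
  let B := spectralB T in
  ({within closure Dplus, continuous A} /\ holomorphic_on Dplus A /\
   {within closure Dplus, continuous B} /\ holomorphic_on Dplus B) /\
  (exists a b : nat -> R[i],
     (bigO_infty (closure Dplus) (fun k => A k - expansion 1 a m k) (m%:Z + 1) /\
      bigO_infty (closure Dplus) (fun k => B k - expansion 0 b m k) (m%:Z + 1)) /\
     (forall j : nat, (1 <= j <= n)%N ->
        derivative_expansion Dplus A (expansion 1 a m) j (m%:Z + 1 - 2 * j%:Z) /\
        derivative_expansion Dplus B (expansion 0 b m) j (m%:Z + 1 - 2 * j%:Z))) /\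
  (forall k : R[i], closure Dplus k ->
     A k = conjc (A (- conjc k)) /\ B k = conjc (B (- conjc k))) /\
  (forall k : R[i], contour k ->
     A k * conjc (A (conjc k)) - lambda%:C * B k * conjc (B (conjc k)) = 1).
Proof.
move=> A B.
have lam2 : lambda ^+ 2 = 1 by case: hlambda => ->; rewrite ?sqrrN expr1n.
have hg (j : 'I_3) : Kclass n ((m + 5 - j) %/ 3) (g j).
  by apply: Kclass_of_cont_diff_on; [exact: hgC|exact: hgL1].
have hlax := lax_L1 lambda hg.
have [a [b [sA sB]]] := smooth_remainder lam2 hT hg.
have AE k : A k = col T k false 0 by [].
have BE k : B k = col T k true 0 by [].
have sIA K : 1 <= K -> smooth (inner K) (fun=> 1) n (fun=> 1) (scalar A).
  by move=> K1; exact: (smooth_eval false (smooth_inner lam2 hT hlax K1)).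
have sIB K : 1 <= K -> smooth (inner K) (fun=> 1) n (fun=> 1) (scalar B).
  by move=> K1; exact: (smooth_eval true (smooth_inner lam2 hT hlax K1)).
have [A1 A2 A3 A4] := expansion_of_smooth (f := A) hn sIA sA.
have [B1 B2 B3 B4] := expansion_of_smooth (f := B) hn sIB sB.
clearbody A B.
split; first exact: (conj A1 (conj A2 (conj B1 B2))).
split.
  exists a, b; split; first exact: (conj A3 B3).
  by move=> j jn; exact: (conj (A4 j jn) (B4 j jn)).
split=> k hk.
  split; rewrite ?AE ?BE.
    exact: (col_Nconj lam2 hT hlax false hk (lexx 0)).
  exact: (col_Nconj lam2 hT hlax true hk (lexx 0)).
rewrite !AE !BE; exact: (col_wronskian lam2 hT hlax (contour_real_cube hk)).
Qed.
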